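(* Let $\mathcal{A}\subset\mathbb{N}^{2n}$ be finite and let $\sum_{(\alpha,\beta)\in\mathcal{A}}c_{\alpha,\beta}x^\alpha D^\beta$ be a partial differential operator with coefficients $c_{\alpha,\beta}\in\overline{\mathbb{C}}$. Suppose there exists a representative $(a_\epsilon(x,\xi))_\epsilon:=\big(\sum_{(\alpha,\beta)\in\mathcal{A}}c_{\alpha,\beta,\epsilon}x^\alpha\xi^\beta\big)_\epsilon$ of $\sum_{(\alpha,\beta)\in\mathcal{A}}c_{\alpha,\beta}x^\alpha\xi^\beta$ (that is, $(c_{\alpha,\beta,\epsilon})_\epsilon$ is a representative of $c_{\alpha,\beta}$ for each $(\alpha,\beta)\in\mathcal{A}$) belonging to the set $H\mathcal{S}^{m,l}_{\Lambda,\rho,N}$ of hypoelliptic symbols. If $$\sum_{(\alpha,\beta)\in\mathcal{A}}c_{\alpha,\beta}x^\alpha D^\beta u=v ,$$ where $u\in\mathcal{G}_{\tau,\mathcal{S}}(\mathbb{R}^n)$ and $v\in\mathcal{G}^\infty_{\mathcal{S}}(\mathbb{R}^n)$, then $u$ is equal in the weak sense to a generalized function in $\mathcal{G}^\infty_{\mathcal{S}}(\mathbb{R}^n)$.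
   Context: Notation: $\langle x\rangle=(1+|x|^2)^{1/2}$, $\hat f(\xi)=\int e^{-ix\xi}f(x)\,dx$, $D^\beta=(-i)^{|\beta|}\partial^\beta$. $f(z)\prec g(z)$ on a set means $f\le c\,g$ there with a constant $c>0$ independent of $z$; $f\sim g$ means both $f\prec g$ and $g\prec f$. $\mathcal{E}[\mathbb{R}^p]$ is the algebra of all nets $(u_\epsilon)_{\epsilon\in(0,1]}$ with $u_\epsilon\in\mathcal{C}^\infty(\mathbb{R}^p)$. $\mathcal{E}_\tau(\mathbb{R}^n)$ is the set of $(u_\epsilon)_\epsilon\in\mathcal{E}[\mathbb{R}^n]$ such that for all $\alpha$ there is $N\in\mathbb{N}$ with $\sup_\epsilon\epsilon^N\|\langle x\rangle^{-N}\partial^\alpha u_\epsilon\|_{L^\infty}<\infty$; $\mathcal{N}_{\mathcal{S}}(\mathbb{R}^n)$ is the set of those such that for all $\alpha,\beta$, $q\in\mathbb{N}$, $\sup_\epsilon\epsilon^{-q}\|x^\alpha\partial^\beta u_\epsilon\|_{L^\infty}<\infty$; $\mathcal{E}^\infty_{\mathcal{S}}(\mathbb{R}^n)$ is the set of those for which there is $N\in\mathbb{N}$ such that for all $\alpha,\beta$, $\sup_\epsilon\epsilon^{N}\|x^\alpha\partial^\beta u_\epsilon\|_{L^\infty}<\infty$. $\mathcal{G}_{\tau,\mathcal{S}}(\mathbb{R}^n)=\mathcal{E}_\tau(\mathbb{R}^n)/\mathcal{N}_{\mathcal{S}}(\mathbb{R}^n)$, $\mathcal{G}^\infty_{\mathcal{S}}(\mathbb{R}^n)=\mathcal{E}^\infty_{\mathcal{S}}(\mathbb{R}^n)/\mathcal{N}_{\mathcal{S}}(\mathbb{R}^n)$.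 Mollifier: $\varphi\in\mathcal{S}(\mathbb{R}^n)$ is fixed with $\int\varphi\,dx=1$ and $\int x^\alpha\varphi\,dx=0$ for all $\alpha\neq0$; $\varphi_\epsilon(x)=\epsilon^{-n}\varphi(x/\epsilon)$, so $\widehat{\varphi_\epsilon}(y)=\hat\varphi(\epsilon y)$. Embedding: $\imath(w)=(w\ast\varphi_\epsilon)_\epsilon+\mathcal{N}_{\mathcal{S}}(\mathbb{R}^n)$ for $w\in\mathcal{S}'(\mathbb{R}^n)$. Generalized numbers, integral, weak equality: $\overline{\mathbb{C}}=\mathcal{E}_{o,M}/\mathcal{N}_o$, where $\mathcal{E}_{o,M}$ consists of nets $(h_\epsilon)_\epsilon\in\mathbb{C}^{(0,1]}$ with $\sup_\epsilon\epsilon^N|h_\epsilon|<\infty$ for some $N\in\mathbb{N}$ and $\mathcal{N}_o$ of those with $\sup_\epsilon\epsilon^{-q}|h_\epsilon|<\infty$ for all $q\in\mathbb{N}$. For $u\in\mathcal{G}_{\tau,\mathcal{S}}(\mathbb{R}^n)$, $\int u(x)\,dx:=\big(\int u_\epsilon(x)\widehat{\varphi_\epsilon}(x)\,dx\big)_\epsilon+\mathcal{N}_o$. $u$ and $v$ are equal in the weak sense ($u=_{g.t.d.}v$) if $\int(u-v)(x)\imath(f)(x)\,dx=0$ in $\overline{\mathbb{C}}$ for all $f\in\mathcal{S}(\mathbb{R}^n)$. The partial differential operator acts on $\mathcal{G}_{\tau,\mathcal{S}}(\mathbb{R}^n)$ by sending the class of $(u_\epsilon)_\epsilon$ to the class of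 $\big(\sum c_{\alpha,\beta,\epsilon}x^\alpha D^\beta u_\epsilon\big)_\epsilon$. Weight function: a continuous real function $\Lambda$ on $\mathbb{R}^{2n}$ such that (i) there is $\mu>0$ with $\langle z\rangle^\mu\prec\Lambda(z)\prec\langle z\rangle$; (ii) $\Lambda(z)\sim\Lambda(\zeta)$ on $\{|\zeta-z|\le\mu\Lambda(z)\}$; (iii) for all $t\in\mathbb{R}^{2n}$, $\Lambda(t_1z_1,\dots,t_{2n}z_{2n})\prec\Lambda(z)$. Symbols (for a weight function $\Lambda$, $\rho\in(0,1]$, $l\le m$ real, $N\in\mathbb{N}$): $\mathcal{S}^m_{\Lambda,\rho,N}$ is the set of $(a_\epsilon)_\epsilon\in\mathcal{E}[\mathbb{R}^{2n}]$ such that for all $\alpha\in\mathbb{N}^{2n}$ there is $c>0$ with $|\partial^\alpha a_\epsilon(z)|\le c\Lambda(z)^{m-\rho|\alpha|}\epsilon^{-N}$ for all $\epsilon\in(0,1]$, $z=(x,\xi)\in\mathbb{R}^{2n}$. $H\mathcal{S}^{m,l}_{\Lambda,\rho,N}$ is the set of $(a_\epsilon)_\epsilon\in\mathcal{S}^m_{\Lambda,\rho,N}$ for which there is $R>0$ such that: (i) there is $c>0$ with $|a_\epsilon(z)|\ge c\Lambda(z)^l\epsilon^N$ for all $|z|\ge R$, $\epsilon\in(0,1]$; (ii) for all $\gamma\in\mathbb{N}^{2n}$ there is $c_\gamma>0$ with $|\partial^\gamma a_\epsilon(z)|\le c_\gamma|a_\epsilon(z)|\Lambda(z)^{-\rho|\gamma|}$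 for all $|z|\ge R$, $\epsilon\in(0,1]$. *)

(* Defs.v *)
From HB Require Import structures.
From mathcomp Require Import all_boot all_order all_algebra.
From mathcomp Require Import finmap.
From mathcomp Require Import complex.
From mathcomp Require Import all_classical all_reals all_analysis.

Set Implicit Arguments.
Unset Strict Implicit.
Unset Printing Implicit Defensive.

Import Order.TTheory GRing.Theory Num.Theory.
Import numFieldNormedType.Exports.

Local Open Scope classical_set_scope.
Local Open Scope ring_scope.
Local Open Scope complex_scope.

(* The library has no Lebesgue measure on R^n; it is built on n.-tuple R by
   iterating the product measure with the one-dimensional one. *)
Section lebesgue_measure_step.
Context {R : realType} {n : nat}.
Local Notation X := (measurableTypeR R).
Variable mu : {sigma_finite_measure set (n.-tuple X) -> \bar R}.

Definition tcons (p : X * n.-tuple X) : n.+1.-tuple X := [tuple of p.1 :: p.2].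

Definition lebesgueS (A : set (n.+1.-tuple X)) : \bar R :=
  (@lebesgue_measure R \x mu)%E (tcons @^-1` A).

Lemma measurable_tcons : measurable_fun [set: X * n.-tuple X] tcons.
Proof. exact: measurable_cons. Qed.

Let pre A : measurable A -> measurable (tcons @^-1` A).
Proof.
by move=> mA; rewrite -[X in measurable X]setTI; exact: measurable_tcons.
Qed.

Let lebesgueS0 : lebesgueS set0 = 0%E.
Proof. by rewrite /lebesgueS preimage_set0 measure0. Qed.

Let lebesgueS_ge0 A : (0 <= lebesgueS A)%E.
Proof. exact: measure_ge0. Qed.

Let lebesgueS_sigma_additive : semi_sigma_additive lebesgueS.
Proof.
move=> F mF tF mUF; rewrite /lebesgueS preimage_bigcup.
apply: measure_semi_sigma_additive.
- by move=> k; exact: pre.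
- apply/trivIsetP => /= i j _ _ ij; rewrite -preimage_setI.
  by move/trivIsetP : tF => /(_ _ _ _ _ ij) ->//; rewrite preimage_set0.
- by rewrite -preimage_bigcup; exact: pre.
Qed.

HB.instance Definition _ := isMeasure.Build _ _ _ lebesgueS
  lebesgueS0 lebesgueS_ge0 lebesgueS_sigma_additive.

Let tuncons (t : n.+1.-tuple X) : X * n.-tuple X :=
  (thead t, [tuple of behead t]).

Let tunconsK : cancel tcons tuncons.
Proof.
by move=> [x t]; rewrite /tuncons /tcons theadE; congr pair; apply/val_inj.
Qed.

Let measurable_tuncons : measurable_fun setT tuncons.
Proof.
apply/measurable_fun_pairP; split => /=.
- exact: measurable_tnth.
- exact: measurable_behead.
Qed.

Let lebesgueS_sigma_finite : sigma_finite setT lebesgueS.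
Proof.
have /sigma_finiteP[F [TF ndF Foo]] :=
  sigma_finiteT (@lebesgue_measure R : {sigma_finite_measure set X -> \bar R}).
have /sigma_finiteP[G [TG ndG Goo]] := sigma_finiteT mu.
pose H k := F k `*` G k.
have tcons_tuncons k : tcons @^-1` (tuncons @^-1` H k) = H k.
  by rewrite -comp_preimage; apply/seteqP; split => x /=; rewrite tunconsK.
exists (fun k => tuncons @^-1` H k).
  apply/esym; rewrite -subTset => t _.
  have [i _ Fi] : (\bigcup_i F i) (tuncons t).1 by rewrite -TF.
  have [j _ Gj] : (\bigcup_i G i) (tuncons t).2 by rewrite -TG.
  exists (maxn i j) => //; split.
    by move: (tuncons t).1 Fi; exact/subsetPset/ndF/leq_maxl.
  by move: (tuncons t).2 Gj; exact/subsetPset/ndG/leq_maxr.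
move=> k; have [mF Fk] := Foo k; have [mG Gk] := Goo k.
have mH : measurable (H k) by exact: measurableX.
split; first by rewrite -[X in measurable X]setTI; exact: measurable_tuncons.
rewrite /lebesgueS tcons_tuncons product_measure1E//.
by rewrite lte_mul_pinfty// ge0_fin_numE.
Qed.

HB.instance Definition _ :=
  Measure_isSigmaFinite.Build _ _ _ lebesgueS lebesgueS_sigma_finite.

End lebesgue_measure_step.

Fixpoint lebesgue_measureRn (R : realType) (n : nat) :
    {sigma_finite_measure set (n.-tuple (measurableTypeR R)) -> \bar R} :=
  match n with
  | 0 => dirac [tuple]
  | k.+1 => lebesgueS (lebesgue_measureRn R k)
  end.

Section analysis_on_Rn.
Context {R : realType}.
Local Notation Re := (@complex.Re R).
Local Notation Im := (@complex.Im R).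
Local Notation normc := (@complex.ComplexField.Normc.normc R).

Definition integralRn n (f : 'rV[R]_n -> R[i]) : R[i] :=
  (\int[lebesgue_measureRn R n]_t Re (f (\row_j tnth t j))) +i*
  (\int[lebesgue_measureRn R n]_t Im (f (\row_j tnth t j))).

Definition mindex (p : nat) := {ffun 'I_p -> nat}.

Definition mlen p (alpha : mindex p) : nat := (\sum_i alpha i)%N.

Definition monomial p (alpha : mindex p) (x : 'rV[R]_p) : R :=
  \prod_i x 0 i ^+ alpha i.

(* Euclidean: the library norm on row vectors is the sup norm. *)
Definition enorm p (x : 'rV[R]_p) : R := Num.sqrt (\sum_i x 0 i ^+ 2).

Definition japanese p (x : 'rV[R]_p) : R := Num.sqrt (1 + enorm x ^+ 2).

Definition dot p (x y : 'rV[R]_p) : R := \sum_i x 0 i * y 0 i.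

Definition partial p (i : 'I_p) (f : 'rV[R]_p -> R[i]) (x : 'rV[R]_p) : R[i] :=
  'D_(delta_mx 0 i) (Re \o f) x +i* 'D_(delta_mx 0 i) (Im \o f) x.

Definition pderiv p (alpha : mindex p) (f : 'rV[R]_p -> R[i]) :
    'rV[R]_p -> R[i] :=
  foldr (fun i g => iter (alpha i) (partial i) g) f (enum 'I_p).

Definition Dop p (beta : mindex p) (f : 'rV[R]_p -> R[i]) (x : 'rV[R]_p) :
    R[i] :=
  (- 'i%C) ^+ mlen beta * pderiv beta f x.

Definition smooth p (f : 'rV[R]_p -> R[i]) : Prop :=
  forall s : seq 'I_p, let g := foldr (@partial p) f s in
    [/\ continuous (Re \o g), continuous (Im \o g) &
        forall i x, derivable (Re \o g) x (delta_mx 0 i) /\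
                    derivable (Im \o g) x (delta_mx 0 i)].

Definition schwartz n (f : 'rV[R]_n -> R[i]) : Prop :=
  smooth f /\
  forall alpha beta : mindex n, exists C : R,
    forall x, normc ((monomial alpha x)%:C * pderiv beta f x) <= C.

Definition expi (t : R) : R[i] := cos t +i* sin t.

Definition fourier n (f : 'rV[R]_n -> R[i]) (xi : 'rV[R]_n) : R[i] :=
  integralRn (fun x => expi (- dot x xi) * f x).

Definition convolution n (f g : 'rV[R]_n -> R[i]) (x : 'rV[R]_n) : R[i] :=
  integralRn (fun y => f (x - y) * g y).

Definition mollifier n (phi : 'rV[R]_n -> R[i]) : Prop :=
  [/\ schwartz phi,
      integralRn phi = 1 &
      forall alpha : mindex n, (0 < mlen alpha)%N ->
        integralRn (fun x => (monomial alpha x)%:C * phi x) = 0].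

Record eps := Eps { eps_val :> R; eps_itv : 0 < eps_val <= 1 }.

Definition net (p : nat) : Type := eps -> 'rV[R]_p -> R[i].

Definition cnet : Type := eps -> R[i].

Definition smooth_net p : set (net p) := [set u | forall e, smooth (u e)].

(* The conditions sup_e e^N ||g_e||_{L^oo} < oo on continuous functions are
   written as bounds uniform in e and x. *)

Definition E_tau n : set (net n) := [set u | smooth_net u /\
  forall alpha : mindex n, exists (N : nat) (C : R), forall (e : eps) x,
    (e : R) ^+ N * normc (((japanese x)^-1 ^+ N)%:C * pderiv alpha (u e) x)
    <= C].

Definition N_S n : set (net n) := [set u | smooth_net u /\
  forall (alpha beta : mindex n) (q : nat), exists C : R, forall (e : eps) x,
    (e : R)^-1 ^+ q * normc ((monomial alpha x)%:C * pderiv beta (u e) x) <= C].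

Definition E_S_infty n : set (net n) := [set u | smooth_net u /\
  exists N : nat, forall alpha beta : mindex n, exists C : R,
    forall (e : eps) x,
    (e : R) ^+ N * normc ((monomial alpha x)%:C * pderiv beta (u e) x) <= C].

Definition E_oM : set cnet := [set h | exists (N : nat) (C : R),
  forall e : eps, (e : R) ^+ N * normc (h e) <= C].

Definition N_o : set cnet := [set h | forall q : nat, exists C : R,
  forall e : eps, (e : R)^-1 ^+ q * normc (h e) <= C].

(* An element of E / N is a coset u + N, as a set of nets, so that equality in
   E / N is equality of sets and G_S_infty is a subset of G_tau_S. *)
Definition coset (V : zmodType) (N : set V) (u : V) : set V :=
  [set w | N (w - u)].

Definition quotient (V : zmodType) (E N : set V) : set (set V) :=
  [set X | exists2 u, E u & X = coset N u].

Definition lift1 (V : Type) (W : zmodType) (N : set W) (F : V -> W)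
    (X : set V) : set W :=
  [set w | exists2 x, X x & coset N (F x) w].

Definition lift2 (V1 V2 : Type) (W : zmodType) (N : set W) (F : V1 -> V2 -> W)
    (X : set V1) (Y : set V2) : set W :=
  [set w | exists x y, [/\ X x, Y y & coset N (F x y) w]].

Definition G_tau_S n : set (set (net n)) := quotient (@E_tau n) (@N_S n).

Definition G_S_infty n : set (set (net n)) := quotient (@E_S_infty n) (@N_S n).

Definition Cbar : set (set cnet) := quotient E_oM N_o.

Section weak_equality.
Context {n : nat}.
Variable phi : 'rV[R]_n -> R[i].

Definition rescale (e : eps) (x : 'rV[R]_n) : R[i] :=
  ((e : R)^-1 ^+ n)%:C * phi ((e : R)^-1 *: x).

(* Only the restriction of the embedding of S' to Schwartz functions occurs in
   the weak equality. *)
Definition iota_emb (f : 'rV[R]_n -> R[i]) : set (net n) :=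
  coset (@N_S n) (fun e => convolution f (rescale e)).

Definition gsub : set (net n) -> set (net n) -> set (net n) :=
  lift2 (@N_S n) (fun u v => u - v).

Definition gmul : set (net n) -> set (net n) -> set (net n) :=
  lift2 (@N_S n) (fun u v e x => u e x * v e x).

Definition gintegral : set (net n) -> set cnet :=
  lift1 N_o (fun (u : net n) e =>
    integralRn (fun x => u e x * fourier (rescale e) x)).

Definition weak_eq (U V : set (net n)) : Prop :=
  forall f, schwartz f ->
    gintegral (gmul (gsub U V) (iota_emb f)) = coset N_o 0.

End weak_equality.

Definition prec (T : Type) (D : set T) (f g : T -> R) : Prop :=
  exists2 c : R, 0 < c & forall t, D t -> f t <= c * g t.

Definition sim (T : Type) (D : set T) (f g : T -> R) : Prop :=
  prec D f g /\ prec D g f.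

Definition weight p (Lambda : 'rV[R]_p -> R) : Prop :=
  [/\ continuous Lambda,
      exists mu : R, [/\ 0 < mu,
        prec setT (fun z => japanese z `^ mu) Lambda,
        prec setT Lambda (@japanese p) &
        sim [set zz : 'rV[R]_p * 'rV[R]_p |
               enorm (zz.2 - zz.1) <= mu * Lambda zz.1]
            (fun zz => Lambda zz.1) (fun zz => Lambda zz.2)] &
      forall t : 'rV[R]_p,
        prec setT (fun z : 'rV[R]_p => Lambda (\row_j (t 0 j * z 0 j))) Lambda].

Definition symbols p (Lambda : 'rV[R]_p -> R) (m rho : R) (N : nat) :
    set (net p) :=
  [set a | smooth_net a /\ forall alpha : mindex p, exists2 c : R, 0 < c &
    forall (e : eps) z, normc (pderiv alpha (a e) z) <=
      c * Lambda z `^ (m - rho * (mlen alpha)%:R) * (e : R)^-1 ^+ N].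

Definition hypoelliptic p (Lambda : 'rV[R]_p -> R) (m l rho : R) (N : nat) :
    set (net p) :=
  [set a | symbols Lambda m rho N a /\ exists2 r : R, 0 < r &
    (exists2 c : R, 0 < c & forall (e : eps) z, r <= enorm z ->
       c * Lambda z `^ l * (e : R) ^+ N <= normc (a e z)) /\
    (forall gamma : mindex p, exists2 c : R, 0 < c &
       forall (e : eps) z, r <= enorm z ->
       normc (pderiv gamma (a e) z) <=
         c * normc (a e z) * Lambda z `^ (- rho * (mlen gamma)%:R))].

Section differential_operator.
Context {n : nat}.
Variable A : {fset mindex n * mindex n}.

Definition representative (c : mindex n * mindex n -> cnet)
    (C : mindex n * mindex n -> set cnet) : Prop :=
  forall ab, ab \in A -> C ab (c ab).

Definition pdo_symbol (c : mindex n * mindex n -> cnet) : net (n + n) :=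
  fun e z => \sum_(ab <- A)
    c ab e * (monomial ab.1 (lsubmx z) * monomial ab.2 (rsubmx z))%:C.

(* For fixed c this is well defined on G_tau_S, but it depends on the
   representative c of the coefficients and not only on their classes, because
   N_o . E_tau is not contained in N_S (a nonzero net in N_o times the
   function 1 does not decay in x). *)
Definition pdo (c : mindex n * mindex n -> cnet) :
    set (net n) -> set (net n) :=
  lift1 (@N_S n) (fun (u : net n) e x => \sum_(ab <- A)
    c ab e * (monomial ab.1 x)%:C * Dop ab.2 (u e) x).

End differential_operator.

End analysis_on_Rn.

Arguments eps R : clear implicits.
Arguments net R p : clear implicits.
Arguments cnet R : clear implicits.
Arguments Cbar R : clear implicits.
Arguments G_tau_S R n : clear implicits.
Arguments G_S_infty R n : clear implicits.

(* Main.v *)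
(** Let [g] be a net and [F] a real test function on the unit cube.  Its wave
packet coefficient [Tw k x F g] is the Fourier coefficient at frequency [k] of
[g] localized at [x] by [F].  Integration by parts shows that an operator [P] with
polynomial coefficients and symbol [a] acts exactly by the finite expansion
[Tw F (P u) = \sum_(g, d) c_(g, d) a^(g, d)(x, k) Tw (F_(g, d)) u], where
[F_(g, d)] is again a test function.  Dividing by [a], which is legitimate for
[|(x, k)| >= r], hypoellipticity makes every term with [(g, d) <> 0] gain a factor
[Lambda ^ - rho <= C <(x, k)> ^ - s].  Iterating this identity, the rapid decay
of [Tw F (P u)] passes to [Tw F u].

Replacing one representative of the coefficients by the other adds to [P u] terms
that are [O(e ^ q)] for all [q] but grow polynomially in [x]; so what one obtains is
[|d^b u_e (x)| <= C (e ^ -N <x> ^ -M + e ^ q <x> ^ M')] with [M'] independent of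
[q].  Derivatives are recovered from the coefficients by testing against the
trigonometric polynomials [((1 + cos t) / 2) ^ M], which concentrate at 0.  Hence
[w_e x := u_e x \prod_j bump (e x_j)] is regular, with [N] independent of the
derivatives: on its support [<x>] is at most a multiple of [1 / e].  Finally [u - w]
vanishes where [e <x>] is small, so it is [O(e ^ q <x> ^ (q + N))] for all [q]; this
is harmless against the rapidly decreasing factor in the weak equality. *)
Require Import Defs.
From mathcomp Require Import all_boot all_order all_algebra.
From mathcomp Require Import finmap complex ring lra zify.
From mathcomp Require Import all_classical all_reals all_analysis.
From mathcomp Require Import measurable_realfun.
Set Implicit Arguments.
Unset Strict Implicit.
Unset Printing Implicit Defensive.

Import Order.TTheory GRing.Theory Num.Theory.
Import numFieldNormedType.Exports.

Local Open Scope classical_set_scope.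
Local Open Scope ring_scope.
Local Open Scope complex_scope.

(** * Integration over R^n *)

Section tuple_integral.
Context {R : realType}.
Local Notation X := (measurableTypeR R).

(** Condition (ii) of hypoellipticity compares the derivatives of the symbol with the symbol itself
    at the same [e]. Dividing by [a] therefore costs the factor [e ^ -N] of the lower bound only in
    front of [Tw F (P u)]; the remainder terms gain decay at no cost in [e]. Hence the identity can
    be iterated as often as the wanted decay demands while the exponent of [e] stays fixed, as
    [E_S_infty] requires. The other exponents of [e] that enter, those of the right-hand side and of
    an a priori bound on [Tw F u], are fixed before the number of iterations is chosen.

    The errors due to the change of representative dictate the order of quantifiers. A cutoff at
    scale [1 / e] turns [e ^ q <x> ^ (M + M')] into a bounded quantity as soon as [q >= M + M'], so
    [M'] has to be known before [q].

    Since the symbol is a polynomial, no asymptotic sum or oscillatory integral occurs, and every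
    packet integral runs over a compact cube. Almost all functions integrated against are tensor
    products, which reduces derivatives, supports and kernel estimates to one variable. *)

Definition vec n (t : n.-tuple X) : 'rV[R]_n := \row_j tnth t j.

Definition vcons n (x : R) (s : 'rV[R]_n) : 'rV[R]_n.+1 :=
  \row_j oapp (s 0) x (unlift ord0 j).

Lemma vcons0 n x (s : 'rV[R]_n) : vcons x s 0 ord0 = x.
Proof. by rewrite mxE unlift_none. Qed.

Lemma vconsS n x (s : 'rV[R]_n) j : vcons x s 0 (lift ord0 j) = s 0 j.
Proof. by rewrite mxE liftK. Qed.

Lemma vec_tcons n (p : X * n.-tuple X) : vec (tcons p) = vcons p.1 (vec p.2).
Proof.
apply/rowP => j; rewrite mxE; case: (unliftP ord0 j) => [k ->|->].
  by rewrite vconsS mxE /tcons tnthS.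
by rewrite vcons0 /tcons tnth0.
Qed.

(* Rational balls form a countable base of the topology of ['rV_n]. *)
Lemma measurable_continuous n (f : 'rV[R]_n -> R) : continuous f ->
  measurable_fun [set: n.-tuple X] (f \o @vec n).
Proof.
move=> cf; apply: (measurability _ (measurable_realfun.RGenOpens.measurableE R)) => /=.
move=> _ [_ [a [b ->]] <-]; rewrite setTI.
set O := f @^-1` `]a, b[%classic.
have oO : open O by apply: open_comp => // ? _; exact: cf.
pose bx (p : 'rV[rat]_n * nat) : set 'rV[R]_n :=
  [set x | forall j, `|ratr (p.1 0 j) - x 0 j| < p.2.+1%:R^-1].
have -> : (f \o @vec n) @^-1` `]a, b[%classic =
    \bigcup_(p in [set p | bx p `<=` O]) ((@vec n) @^-1` bx p).
  apply/seteqP; split => [t Ot|t [p pO /pO]//].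
  have /nbhs_ballP[e /= e0 eO] : nbhs (vec t) O by exact: open_nbhs_nbhs.
  have [k ke] : exists k : nat, k.+1%:R^-1 < e / 2.
    have e2 : 0 < e / 2 by rewrite divr_gt0.
    have [k _ /(_ k (leqnn _))] := near_infty_natSinv_lt (PosNum e2).
    by exists k.
  have k0 : (0 : R) < k.+1%:R^-1 by rewrite invr_gt0.
  have /choice[q hq] : forall j : 'I_n, exists q : rat,
      ratr q \in `](vec t) 0 j - k.+1%:R^-1, (vec t) 0 j + k.+1%:R^-1[.
    by move=> j; apply: rat_in_itvoo; rewrite ltrD2l (lt_trans _ k0)// oppr_lt0.
  exists (\row_j q j, k).
    move=> x /= bxx; apply: eO; split => // i j; rewrite ord1.
    rewrite /ball /=; move: (bxx j) (hq j); rewrite mxE in_itv /= => h1 h2.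
    rewrite -(subrKA (ratr (q j))) (le_lt_trans (ler_normD _ _))//.
    rewrite (splitr e) ltrD //; apply: lt_trans ke => //.
    by rewrite ltr_distlC.
  move=> j /=; rewrite mxE; move: (hq j); rewrite in_itv /= => h.
  by rewrite distrC ltr_distlC.
(* The union is reindexed by all rational boxes, those not contained in [O] contributing [set0], so
   that it ranges over a full countable type. *)
have -> : \bigcup_(p in [set p | bx p `<=` O]) ((@vec n) @^-1` bx p) =
  \bigcup_p (if `[< bx p `<=` O >] then (@vec n) @^-1` bx p else set0).
  apply/seteqP; split => [t [p pO tp]|t [p _]].
    by exists p => //; rewrite (asboolT pO).
  by case: ifPn => // /asboolP pO tp; exists p.
apply: countable_bigcupT_measurable => [|p]; first exact: countableP.
case: ifP => // _.
have -> : (@vec n) @^-1` bx p = \bigcap_(j : 'I_n)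
    ((@tnth n X)^~ j @^-1` `]ratr (p.1 0 j) - p.2.+1%:R^-1,
                            ratr (p.1 0 j) + p.2.+1%:R^-1[%classic).
  apply/seteqP; split => [t tp j _ /=|t tp j /=].
    by move: (tp j); rewrite mxE in_itv /= ltr_distlC.
  by move: (tp j I); rewrite mxE /= in_itv /= ltr_distlC.
apply: fin_bigcap_measurable => [|j _]; first exact: finite_finset.
rewrite -[X in measurable X]setTI; apply: measurable_tnth => //.
Qed.

End tuple_integral.

Section rn_integral.
Context {R : realType}.
Local Notation X := (measurableTypeR R).

Definition IR n (f : 'rV[R]_n -> R) : R :=
  \int[lebesgue_measureRn R n]_t f (vec t).

Definition omega n (x : 'rV[R]_n) : R := \prod_j (oneDsqr (x 0 j))^-1.

(** The dominating weight is a product, so a slice of a tame function is tame again and inductions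
    on the dimension go through. The class is stable under linear combinations, and Fubini's theorem
    applies to it. *)
Definition tame n (f : 'rV[R]_n -> R) : Prop :=
  measurable_fun [set: n.-tuple X] (f \o @vec R n) /\
  exists C, forall x, `|f x| <= C * omega x.

Lemma oneDsqrV_gt0 (x : R) : 0 < (oneDsqr x)^-1.
Proof. by rewrite invr_gt0 (lt_le_trans ltr01)// oneDsqr_ge1. Qed.

Lemma omega_gt0 n (x : 'rV[R]_n) : 0 < omega x.
Proof. by apply: prodr_gt0 => j _; exact: oneDsqrV_gt0. Qed.

Lemma omega_vcons n t (x : 'rV[R]_n) :
  omega (vcons t x) = (oneDsqr t)^-1 * omega x.
Proof.
rewrite /omega big_ord_recl vcons0; congr (_ * _).
by apply: eq_bigr => j _; rewrite vconsS.
Qed.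

Lemma measurable_tensor n (g : 'I_n -> R -> R) :
  (forall j, measurable_fun setT (g j)) ->
  measurable_fun [set: n.-tuple X]
    ((fun x : 'rV[R]_n => \prod_j g j (x 0 j)) \o @vec R n).
Proof.
move=> mg; rewrite (_ : _ \o _ = fun t => \prod_j g j (tnth t j)); last first.
  by apply/funext => t /=; apply: eq_bigr => j _; rewrite mxE.
apply: measurable_prod => j _; apply: measurableT_comp => //.
exact: measurable_tnth.
Qed.

Lemma measurable_oneDsqrV : measurable_fun [set: R] (fun x => (oneDsqr x)^-1).
Proof. by apply: continuous_measurable_fun; exact: continuous_oneDsqrV. Qed.

Lemma measurable_omega n : measurable_fun [set: n.-tuple X] (@omega n \o @vec R n).
Proof.
apply: (@measurable_tensor n (fun _ x => (oneDsqr x)^-1)) => j.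
exact: measurable_oneDsqrV.
Qed.

Lemma integral_oneDsqrV_lty :
  (\int[@lebesgue_measure R]_x ((oneDsqr x)^-1)%:E < +oo)%E.
Proof.
rewrite (@ge0_symfun_integralT _ (fun x => (oneDsqr x)^-1)).
- rewrite [X in (_ * X)%E](_ : _ = (pi / 2)%:E); first by rewrite -EFinM ltry.
  rewrite -integral0y_oneDsqr -set_itvcy.
  by apply: eq_integral => x.
- by move=> x; exact/ltW/oneDsqrV_gt0.
- exact: continuous_oneDsqrV.
- by move=> x /=; rewrite /oneDsqr sqrrN.
Qed.

(** The measure in dimension [n.+1] is the image of a product measure under [tcons]: change of
    variables, then Tonelli. *)
Lemma lebesgueRn_ge0_integralS n (f : 'rV[R]_n.+1 -> \bar R) :
  measurable_fun [set: n.+1.-tuple X] (f \o @vec R n.+1) ->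
  (forall x, 0 <= f x)%E ->
  (\int[lebesgue_measureRn R n.+1]_t f (vec t) =
   \int[@lebesgue_measure R]_x \int[lebesgue_measureRn R n]_t f (vcons x (vec t)))%E.
Proof.
move=> mf f0.
have := @ge0_integral_pushforward _ _ _ _ R _ (@measurable_tcons R n)
  (product_measure1 (@lebesgue_measure R) (lebesgue_measureRn R n)) setT
  (f \o @vec R n.+1) measurableT mf.
move=> /(_ (fun _ _ => f0 _)) /= H.
etransitivity; first exact: H.
rewrite preimage_setT fubini_tonelli1.
- by apply: eq_integral => x _; apply: eq_integral => t _ /=; rewrite vec_tcons.
- exact: measurableT_comp mf (@measurable_tcons R n).
- by move=> x; exact: f0.
Qed.

End rn_integral.

Section rn_integral_theory.
Context {R : realType}.
Local Notation X := (measurableTypeR R).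
Local Notation leb := (@lebesgue_measure R).

Let measurable_Eomega n : measurable_fun [set: n.-tuple X]
  (fun t => (omega (vec t))%:E : \bar R).
Proof. by apply: measurableT_comp => //; exact: measurable_omega. Qed.

Lemma integral_omega_lty n :
  (\int[lebesgue_measureRn R n]_t (omega (vec t))%:E < +oo)%E.
Proof.
elim: n => [|n IH].
  rewrite /= integral_dirac//; first by rewrite diracT mul1e ltry.
  exact: measurable_Eomega.
rewrite (@lebesgueRn_ge0_integralS R n (fun x => (omega x)%:E)); last 2 first.
- exact: measurable_Eomega.
- by move=> x; rewrite lee_fin ltW// omega_gt0.
set I := (\int[_]_t _)%E in IH.
have I0 : (0 <= I)%E by apply: integral_ge0 => t _; rewrite lee_fin ltW// omega_gt0.
have H x : (\int[lebesgue_measureRn R n]_t (omega (vcons x (vec t)))%:E =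
    ((oneDsqr x)^-1)%:E * I)%E.
  under eq_integral do rewrite omega_vcons EFinM.
  rewrite ge0_integralZl//.
  - exact: measurable_Eomega.
  - by move=> t _; rewrite lee_fin ltW// omega_gt0.
under eq_integral do rewrite H.
rewrite ge0_integralZr//.
- have J0 : (0 <= \int[leb]_x ((oneDsqr x)^-1)%:E)%E.
    by apply: integral_ge0 => x _; rewrite lee_fin ltW// oneDsqrV_gt0.
  rewrite lte_mul_pinfty ?ge0_fin_numE// ?integral_oneDsqrV_lty//.
- by apply: measurableT_comp => //; exact: measurable_oneDsqrV.
Qed.

Lemma integrable_omega n :
  (lebesgue_measureRn R n).-integrable setT (EFin \o (@omega R n \o @vec R n)).
Proof.
apply/integrableP; split; first exact: measurable_Eomega.
rewrite (eq_integral (fun t => (omega (vec t))%:E)) ?integral_omega_lty//.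
by move=> t _; rewrite /= ger0_norm// ltW// omega_gt0.
Qed.

Lemma tame_integrable n (f : 'rV[R]_n -> R) : tame f ->
  (lebesgue_measureRn R n).-integrable setT (EFin \o (f \o @vec R n)).
Proof.
move=> [mf [C fC]].
have iC := integrableZl measurableT C (integrable_omega n).
apply: (le_integrable _ _ _ iC) => //; first exact/measurable_EFinP.
by move=> t _; rewrite lee_fin (le_trans (fC _))// ler_norm.
Qed.

(** The integral of a nonnegative function is a supremum over the simple functions below it, and
    this set only grows with the function. *)
Lemma ge0_le_integralT d (T : measurableType d) (mu : {measure set T -> \bar R})
    (f g : T -> \bar R) : (forall x, 0 <= f x)%E -> (forall x, f x <= g x)%E ->
  (\int[mu]_x f x <= \int[mu]_x g x)%E.
Proof.
move=> f0 fg; rewrite !ge0_integralTE//; last first.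
  by move=> x; exact: le_trans (f0 x) (fg x).
apply: le_ereal_sup => _ [h hf <-]; exists h => // x.
exact: le_trans (hf x) (fg x).
Qed.

(* The extended integral of a nonmeasurable function is still monotone. *)
Lemma IR_le n (f : 'rV[R]_n -> R) C : (forall x, `|f x| <= C * omega x) ->
  `|IR f| <= C * IR (@omega R n).
Proof.
move=> fC.
have iC := integrableZl measurableT C (integrable_omega n).
rewrite /IR -RintegralZl//; last exact: integrable_omega.
rewrite /Rintegral integralE.
set D := (\int[_]_x (C * _)%:E)%E.
have Dfin : D \is a fin_num by apply: integrable_fin_num.
have H (g : _ -> \bar R) : (forall t, 0 <= g t)%E ->
    (forall t, g t <= (C * omega (vec t))%:E)%E ->
    (0 <= \int[lebesgue_measureRn R n]_x g x <= D)%E.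
  by move=> g0 gC; rewrite integral_ge0//= ge0_le_integralT.
have H1 := H (EFin \o (f \o @vec R n))^\+%E (funepos_ge0 _).
have H2 := H (EFin \o (f \o @vec R n))^\-%E (funeneg_ge0 _).
have le1 t : ((EFin \o (f \o @vec R n))^\+ t <= (C * omega (vec t))%:E)%E.
  by rewrite funeposE /= -EFin_max lee_fin; move: (fC (vec t)); rewrite ler_norml ge_max; lra.
have le2 t : ((EFin \o (f \o @vec R n))^\- t <= (C * omega (vec t))%:E)%E.
  by rewrite funenegE /= -EFin_max lee_fin; move: (fC (vec t)); rewrite ler_norml ge_max; lra.
move: (H1 le1) (H2 le2); rewrite -(fineK Dfin).
move: (\int[_]_x _)%E => A; move: (\int[_]_x _)%E => B.
(* The positive and negative parts both have integrals in [[0, D]] with [D] finite, so infinite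
   values are excluded and real arithmetic concludes. *)
case: A => [a| |]; case: B => [b| |] //=; rewrite ?lee_fin ?leye_eq//= ler_norml.
- by move=> *; lra.
- by move=> _ /andP[].
- by move=> /andP[].
- by move=> /andP[].
Qed.

Lemma eq_IR n (f g : 'rV[R]_n -> R) : f =1 g -> IR f = IR g.
Proof. by move=> fg; apply: eq_Rintegral => t _; rewrite fg. Qed.

Lemma IRD n (f g : 'rV[R]_n -> R) : tame f -> tame g ->
  IR (fun x => f x + g x) = IR f + IR g.
Proof. by move=> tf tg; rewrite /IR RintegralD//; exact: tame_integrable. Qed.

Lemma IRZ n (f : 'rV[R]_n -> R) c : tame f ->
  IR (fun x => c * f x) = c * IR f.
Proof. by move=> tf; rewrite /IR RintegralZl//; exact: tame_integrable. Qed.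

Lemma le_IR n (f g : 'rV[R]_n -> R) : tame f -> tame g ->
  (forall x, f x <= g x) -> IR f <= IR g.
Proof.
by move=> tf tg fg; rewrite /IR le_Rintegral//; exact: tame_integrable.
Qed.

Lemma IR0 n : IR (fun _ : 'rV[R]_n => 0) = 0.
Proof. by rewrite /IR Rintegral_cst// mul0r. Qed.

Lemma tame0 n : tame (fun _ : 'rV[R]_n => 0 : R).
Proof.
split; last by exists 0 => x; rewrite normr0 mul0r.
exact: (measurable_cst (0 : R)).
Qed.

Lemma tameD n (f g : 'rV[R]_n -> R) : tame f -> tame g ->
  tame (fun x => f x + g x).
Proof.
move=> [mf [C fC]] [mg [D gD]]; split; first exact: measurable_funD.
by exists (C + D) => x; rewrite mulrDl (le_trans (ler_normD _ _))// lerD.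
Qed.

Lemma tameZ n (f : 'rV[R]_n -> R) c : tame f -> tame (fun x => c * f x).
Proof.
move=> [mf [C fC]]; split; first exact: measurable_funM.
by exists (`|c| * C) => x; rewrite normrM -mulrA ler_wpM2l.
Qed.

Lemma tame_vcons n (f : 'rV[R]_n.+1 -> R) x : tame f ->
  tame (fun s => f (vcons x s)).
Proof.
move=> [mf [C fC]]; split.
  rewrite (_ : _ \o _ = (f \o @vec R n.+1) \o (fun t => tcons (x, t))); last first.
    by apply/funext => t /=; rewrite vec_tcons.
  apply: measurableT_comp => //.
  apply: (measurableT_comp (@measurable_tcons R n)).
  exact: measurable_fun_pair (measurable_cst x) (@measurable_id _ _ _).
exists (C * (oneDsqr x)^-1) => s.
by rewrite (le_trans (fC _))// omega_vcons mulrA.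
Qed.

Let ft n (f : 'rV[R]_n.+1 -> R) (p : X * n.-tuple X) : \bar R :=
  (f (vcons p.1 (vec p.2)))%:E.

Let ftE n (f : 'rV[R]_n.+1 -> R) :
  ft f = (EFin \o (f \o @vec R n.+1)) \o @tcons R n.
Proof. by apply/funext => p /=; rewrite vec_tcons. Qed.

Let integrable_ft n (f : 'rV[R]_n.+1 -> R) : tame f ->
  (leb \x lebesgue_measureRn R n)%E.-integrable setT (ft f).
Proof.
move=> tf; have [/measurable_EFinP mf _] := tf.
have mft : measurable_fun setT (ft f).
  by rewrite ftE; exact: measurableT_comp mf (@measurable_tcons R n).
apply/integrableP; split => //.
have /integrableP[_] := tame_integrable tf.
have := @lebesgueRn_ge0_integralS R n (fun x => `|(f x)%:E|%E).
move=> -> //; last exact: measurableT_comp.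
rewrite fubini_tonelli1//; exact: measurableT_comp.
Qed.

Lemma integral_lebesgueRnS n (f : 'rV[R]_n.+1 -> R) : tame f ->
  (\int[lebesgue_measureRn R n.+1]_t (f (vec t))%:E =
   \int[leb \x lebesgue_measureRn R n]_p ft f p)%E.
Proof.
move=> tf; have [/measurable_EFinP mf _] := tf.
have := @integral_pushforward _ _ _ _ R _ (@measurable_tcons R n)
  (product_measure1 leb (lebesgue_measureRn R n)) setT
  (EFin \o (f \o @vec R n.+1)) mf.
rewrite preimage_setT -ftE => /(_ (integrable_ft tf) measurableT) H.
by etransitivity; first exact: H.
Qed.

Lemma IR_S n (f : 'rV[R]_n.+1 -> R) : tame f ->
  IR f = \int[leb]_x IR (fun s => f (vcons x s)).
Proof.
move=> tf; rewrite /IR /Rintegral integral_lebesgueRnS//.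
rewrite -integral12_prod_meas1; last exact: integrable_ft.
congr fine; apply: eq_integral => x _.
rewrite fineK//; apply: integrable_fin_num => //.
exact: (tame_integrable (tame_vcons x tf)).
Qed.

(** Here the first coordinate is integrated innermost, which lets the fundamental theorem of
    calculus act on it. Integrability of every line ensures that [fine] does not alter any inner
    integral. *)
Lemma IR_S_swap n (f : 'rV[R]_n.+1 -> R) : tame f ->
  (forall s, leb.-integrable setT (fun x => (f (vcons x s))%:E)) ->
  IR f = IR (fun s => \int[leb]_x f (vcons x s)).
Proof.
move=> tf fi; rewrite /IR /Rintegral integral_lebesgueRnS//.
rewrite -integral21_prod_meas1; last exact: integrable_ft.
congr fine; apply: eq_integral => t _.
by rewrite fineK//; apply: integrable_fin_num => //.
Qed.

End rn_integral_theory.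

(** * Coordinate lines, compact support and integrals of partial derivatives *)

Section partial_ibp.
Context {R : realType}.
Local Notation leb := (@lebesgue_measure R).

Definition upd n (x : 'rV[R]_n) (j : 'I_n) (t : R) : 'rV[R]_n :=
  \row_k (if k == j then t else x 0 k).

Lemma upd_eq n (x : 'rV[R]_n) j t : upd x j t 0 j = t.
Proof. by rewrite mxE eqxx. Qed.

Lemma upd_neq n (x : 'rV[R]_n) j t k : k != j -> upd x j t 0 k = x 0 k.
Proof. by rewrite mxE => /negbTE ->. Qed.

Lemma upd_id n (x : 'rV[R]_n) j : upd x j (x 0 j) = x.
Proof. by apply/rowP => k; rewrite mxE; case: eqP => [->|]. Qed.

Lemma delta_upd n (x : 'rV[R]_n) j (h : R) :
  h *: delta_mx 0 j + x = upd x j (h *: 1 + x 0 j).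
Proof.
apply/rowP => k; rewrite !mxE eqxx /=; case: eqP => [->|_].
  by [].
by rewrite mulr0 add0r.
Qed.

(** The two difference quotients agree literally, so derivability and derivative transfer to a
    coordinate line with no differentiability assumption. *)
Let growth_line n (f : 'rV[R]_n -> R) x j :
  (fun h : R => h^-1 *: ((f \o shift x) (h *: delta_mx 0 j) - f x)) =
  (fun h => h^-1 *: (((f \o upd x j) \o shift (x 0 j)) (h *: (1 : R)) -
                     (f \o upd x j) (x 0 j))).
Proof. by apply/funext => h /=; rewrite delta_upd upd_id. Qed.

Lemma derivable_line n (f : 'rV[R]_n -> R) x j :
  derivable f x (delta_mx 0 j) <-> derivable (f \o upd x j) (x 0 j) 1.
Proof. by rewrite /derivable growth_line. Qed.

Lemma derive_line n (f : 'rV[R]_n -> R) x j :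
  'D_(delta_mx 0 j) f x = derive1 (f \o upd x j) (x 0 j).
Proof. by rewrite derive1E /derive growth_line. Qed.

Lemma continuousT_comp (T U V : topologicalType) (f : T -> U) (g : U -> V) :
  continuous f -> continuous g -> continuous (fun x => g (f x)).
Proof. by move=> cf cg x; apply: continuous_comp; [exact: cf|exact: cg]. Qed.

Lemma continuous_row n (T : topologicalType) (f : T -> 'rV[R]_n) :
  (forall j, continuous (fun x => f x 0 j)) -> continuous f.
Proof.
move=> cf x A [P Pnb PA]; apply: (filterS PA) => /=.
have : \forall y \near x, forall j, P 0 j (f y 0 j).
  by apply: filter_forall => j; exact: cf x _ (Pnb 0 j).
by apply: filterS => y Py i j; rewrite ord1.
Qed.

Lemma continuous_coord n (j : 'I_n) : continuous (fun x : 'rV[R]_n => x 0 j).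
Proof. by move=> x; exact: coord_continuous. Qed.

Lemma continuous_vcons n t : continuous (@vcons R n t).
Proof.
apply: continuous_row => j; case: (unliftP ord0 j) => [k ->|->].
  rewrite (_ : (fun _ => _) = fun s : 'rV[R]_n => s 0 k); first exact: continuous_coord.
  by apply/funext => s; rewrite vconsS.
rewrite (_ : (fun _ => _) = cst t); first exact: cst_continuous.
by apply/funext => s; rewrite vcons0.
Qed.

Lemma continuous_vcons_l n (s : 'rV[R]_n) : continuous (fun t => vcons t s).
Proof.
apply: continuous_row => j; case: (unliftP ord0 j) => [k ->|->].
  rewrite (_ : (fun _ => _) = cst (s 0 k)); first exact: cst_continuous.
  by apply/funext => t; rewrite vconsS.
rewrite (_ : (fun _ => _) = id); first by move=> x; exact: cvg_id.
by apply/funext => t; rewrite vcons0.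
Qed.

Lemma bounded_on_box n (f : 'rV[R]_n -> R) (L : R) : continuous f ->
  exists C, forall x : 'rV[R]_n, (forall j, `|x 0 j| <= L) -> `|f x| <= C.
Proof.
move=> cf.
pose B := [set x : 'rV[R]_n | forall j, `[- L, L]%classic (x 0 j)].
have cB : compact B.
  by apply: (@rV_compact _ n (fun=> `[- L, L]%classic)) => _; exact: segment_compact.
have [M [_ HM]] := compact_bounded (continuous_compact (continuous_subspaceT cf) cB).
exists (M + 1) => x xB; apply: HM; first by rewrite ltrDl.
exists x => // j; rewrite /= in_itv /=; by rewrite -ler_norml.
Qed.

Lemma tame_compact n (f : 'rV[R]_n -> R) (L : R) : continuous f ->
  (forall x : 'rV[R]_n, (exists k, L < `|x 0 k|) -> f x = 0) -> tame f.
Proof.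
move=> cf f0; split; first exact: measurable_continuous.
have [C HC] := bounded_on_box L cf.
have H1 (t : R) : 0 < oneDsqr t by rewrite (lt_le_trans ltr01)// oneDsqr_ge1.
(* Inside the box each factor of [omega] is at least [(1 + L^2)^-1], so [oneDsqr L ^+ n] compensates
   their product. *)
exists (`|C| * oneDsqr L ^+ n) => x.
have [|/existsNP] := pselect (forall k, `|x 0 k| <= L); last first.
  move=> [k /negP]; rewrite -ltNge => Lk; rewrite f0; last by exists k.
  by rewrite normr0 !mulr_ge0 ?exprn_ge0// ltW ?omega_gt0.
move=> xL; rewrite (le_trans (HC _ xL))// -mulrA (le_trans (ler_norm C))//.
rewrite ler_peMr// /omega -[n in X in X * _]card_ord -prodr_const -big_split /=.
apply: (big_ind (fun z => 1 <= z)) => // [a b|j _]; first exact: mulr_ege1.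
rewrite ler_pdivlMr// mul1r lerD2l.
by rewrite -(real_normK (num_real (x 0 j))) lerXn2r ?nnegrE// (le_trans _ (xL j)).
Qed.

Lemma integrable_dom1 (g : R -> R) (C : R) : measurable_fun setT g ->
  (forall t, `|g t| <= C * (oneDsqr t)^-1) -> leb.-integrable setT (EFin \o g).
Proof.
move=> mg gC.
have iw : leb.-integrable setT (fun x => ((oneDsqr x)^-1)%:E).
  apply/integrableP; split.
    by apply/measurable_EFinP; exact: measurable_oneDsqrV.
  under eq_integral do rewrite /= ger0_norm ?(ltW (oneDsqrV_gt0 _))//.
  exact: integral_oneDsqrV_lty.
apply: (le_integrable _ _ _ (integrableZl measurableT C iw)) => //.
  exact/measurable_EFinP.
by move=> t _; rewrite /= lee_fin (le_trans (gC t))// ler_norm.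
Qed.

Lemma integrable_compact (g : R -> R) (L : R) : continuous g ->
  (forall t, L < `|t| -> g t = 0) -> leb.-integrable setT (EFin \o g).
Proof.
move=> cg g0.
have [||_ [C gC]] := @tame_compact 1 (fun x => g (x 0 ord0)) L.
- by move=> x; apply: continuous_comp; [exact: continuous_coord|exact: cg].
- by move=> x [k]; rewrite ord1; exact: g0.
apply: (@integrable_dom1 _ C); first exact: continuous_measurable_fun.
by move=> t; have := gC (vcons t 0); rewrite vcons0 omega_vcons /omega big_ord0 mulr1.
Qed.

Lemma derive1_outside (g : R -> R) (L : R) : (forall t, L < `|t| -> g t = 0) ->
  forall t, L < `|t| -> derive1 g t = 0.
Proof.
move=> g0 t Lt; rewrite derive1E -(derive_cst (0 : R) t (1 : R)).
apply: near_eq_derive.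
have : \forall y \near t, L < `|y|.
  exact: (@cvgr_norm_gt _ _ _ (nbhs t) _ id t cvg_id _ Lt).
by apply: filterS => y; exact: g0.
Qed.

Lemma Rintegral_derive0 (g : R -> R) (L : R) : (forall t, derivable g t 1) ->
  continuous (derive1 g) -> (forall t, L < `|t| -> g t = 0) ->
  \int[leb]_t derive1 g t = 0.
Proof.
move=> dg cg g0.
(* This is positive and strictly beyond [L], so [g] vanishes at both ends of [[- M, M]]. *)
pose M := `|L| + 1.
have M0 : 0 < M by rewrite ltr_wpDl.
have LM : L < M by rewrite ltr_pwDr// ler_norm.
have := derive1_outside g0; move=> g'0.
have -> : \int[leb]_t derive1 g t = \int[leb]_(t in `[- M, M]) derive1 g t.
  rewrite [RHS]Rintegral_mkcond; apply: eq_Rintegral => t _.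
  rewrite /patch; case: ifPn => // tM; rewrite g'0// (lt_le_trans LM)//.
  rewrite leNgt; apply: contra tM => /ltW; rewrite ler_norml => tM.
  by rewrite inE /= in_itv.
have cg' : continuous g.
  move=> t; apply: differentiable_continuous; exact/derivable1_diffP.
rewrite /Rintegral (@continuous_FTC2 _ _ g).
- by rewrite !g0 ?normrN ?gtr0_norm// subee.
- by rewrite gtrN.
- exact: continuous_subspaceT.
- split => //.
  + by apply: cvg_at_right_filter; exact: cg'.
  + by apply: cvg_at_left_filter; exact: cg'.
- by [].
Qed.

Lemma upd_vconsS n t (s : 'rV[R]_n) k r :
  upd (vcons t s) (lift ord0 k) r = vcons t (upd s k r).
Proof.
apply/rowP => j; case: (unliftP ord0 j) => [i ->|->].
  by rewrite vconsS !mxE liftK /= (inj_eq lift_inj).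
by rewrite vcons0 mxE (negbTE (neq_lift _ _)) vcons0.
Qed.

Lemma upd_vcons0 n t (s : 'rV[R]_n) r : upd (vcons t s) ord0 r = vcons r s.
Proof.
apply/rowP => j; case: (unliftP ord0 j) => [i ->|->].
  by rewrite vconsS !mxE liftK eq_sym (negbTE (neq_lift _ _)).
by rewrite vcons0 mxE eqxx.
Qed.

Let line0 n (f : 'rV[R]_n.+1 -> R) t (s : 'rV[R]_n) :
  f \o upd (vcons t s) ord0 = fun r => f (vcons r s).
Proof. by apply/funext => r /=; rewrite upd_vcons0. Qed.

Let lineS n (f : 'rV[R]_n.+1 -> R) t (s : 'rV[R]_n) k :
  f \o upd (vcons t s) (lift ord0 k) = (fun s => f (vcons t s)) \o upd s k.
Proof. by apply/funext => r /=; rewrite upd_vconsS. Qed.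

Lemma derive_outside n (f : 'rV[R]_n -> R) j (L : R) :
  (forall x : 'rV[R]_n, (exists k, L < `|x 0 k|) -> f x = 0) ->
  forall x : 'rV[R]_n, (exists k, L < `|x 0 k|) -> 'D_(delta_mx 0 j) f x = 0.
Proof.
move=> f0 x [k Lk]; rewrite derive_line.
have [kj|kj] := eqVneq k j.
  apply: (@derive1_outside _ L) => [t Lt|]; last by rewrite -kj.
  by apply: f0; exists j; rewrite upd_eq.
rewrite (_ : f \o _ = cst 0) ?derive1_cst//.
by apply/funext => t /=; apply: f0; exists k; rewrite upd_neq.
Qed.

(** Induction on the dimension: a derivative in the first coordinate is integrated innermost and
    gives 0 by [Rintegral_derive0]; any other derivative lives on the slices, where the induction
    hypothesis applies. *)
Lemma IR_partial n (f : 'rV[R]_n -> R) j (L : R) :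
  (forall x, derivable f x (delta_mx 0 j)) ->
  continuous (fun x => 'D_(delta_mx 0 j) f x) ->
  (forall x : 'rV[R]_n, (exists k, L < `|x 0 k|) -> f x = 0) ->
  IR (fun x => 'D_(delta_mx 0 j) f x) = 0.
Proof.
elim: n f j => [f []//|n IH] f j df cdf f0.
have tD := tame_compact cdf (@derive_outside _ _ j L f0).
case: (unliftP ord0 j) => [k jk|j0]; last first.
  rewrite IR_S_swap//; last first.
    move=> s; apply: (@integrable_compact _ L).
      exact: (continuousT_comp (@continuous_vcons_l n s) cdf).
    move=> t Lt; apply: (@derive_outside _ _ j L f0); exists ord0; by rewrite vcons0.
  rewrite -(IR0 (R := R) n); apply: eq_IR => s.
  have E t : 'D_(delta_mx 0 j) f (vcons t s) = derive1 (fun t => f (vcons t s)) t.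
    by rewrite derive_line j0 vcons0 line0.
  under eq_Rintegral do rewrite E.
  apply: (@Rintegral_derive0 _ L).
  - move=> t; have /derivable_line := df (vcons t s).
    by rewrite j0 vcons0 line0.
  - rewrite (_ : derive1 _ = fun t => 'D_(delta_mx 0 j) f (vcons t s)); last first.
      by apply/funext => t; rewrite E.
    exact: (continuousT_comp (@continuous_vcons_l n s) cdf).
  - by move=> t Lt; apply: f0; exists ord0; rewrite vcons0.
rewrite IR_S//; rewrite (_ : 0 = \int[leb]_t (0 : R)); last by rewrite Rintegral_cst// mul0r.
apply: eq_Rintegral => t _.
have E s : 'D_(delta_mx 0 j) f (vcons t s) =
    'D_(delta_mx 0 k) (fun s => f (vcons t s)) s.
  by rewrite !derive_line jk vconsS lineS.
rewrite (eq_IR E); apply: IH.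
- move=> s; apply/derivable_line; have /derivable_line := df (vcons t s).
  by rewrite jk vconsS lineS.
- rewrite -(funext E).
  exact: (continuousT_comp (@continuous_vcons n t) cdf).
- by move=> s [i Li]; apply: f0; exists (lift ord0 i); rewrite vconsS.
Qed.

End partial_ibp.

(** * Smooth functions of one variable *)

Section smooth_line.
Context {R : realType}.
Implicit Types f g : R -> R.

(** Only existence of [n] successive derivatives is recorded, not continuity of the last; in [cinf],
    continuity at each order comes from the existence of the next derivative. *)
Fixpoint Ck (n : nat) (f : R -> R) : Prop :=
  if n is m.+1 then (forall x : R, derivable f x 1) /\ Ck m (derive1 f) else True.

Definition cinf f : Prop := forall n, Ck n f.

Lemma is_derive1P f (x df : R) :
  is_derive x 1 f df -> derivable f x 1 /\ derive1 f x = df.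
Proof. by case=> dfx <-; rewrite derive1E. Qed.

Lemma derivable1_is f (x : R) : derivable f x 1 -> is_derive x 1 f (derive1 f x).
Proof. by move=> df; rewrite derive1E; exact: derivableP. Qed.

Lemma derive1_funD f g : (forall x : R, derivable f x 1) ->
  (forall x : R, derivable g x 1) ->
  derive1 (fun x => f x + g x) = (fun x => derive1 f x + derive1 g x).
Proof.
move=> df dg; apply/funext => x.
exact: (is_derive1P (is_deriveD (derivable1_is (df x)) (derivable1_is (dg x)))).2.
Qed.

Lemma derive1_funM f g : (forall x : R, derivable f x 1) ->
  (forall x : R, derivable g x 1) ->
  derive1 (fun x => f x * g x) = (fun x => derive1 f x * g x + f x * derive1 g x).
Proof.
move=> df dg; apply/funext => x.
rewrite (is_derive1P (is_deriveM (derivable1_is (df x)) (derivable1_is (dg x)))).2.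
by rewrite addrC /GRing.scale /= mulrC.
Qed.

Lemma derivable_funD f g (x : R) : derivable f x 1 -> derivable g x 1 ->
  derivable (fun x => f x + g x) x 1.
Proof. by move=> df dg; exact: derivableD. Qed.

Lemma derivable_funM f g (x : R) : derivable f x 1 -> derivable g x 1 ->
  derivable (fun x => f x * g x) x 1.
Proof. by move=> df dg; exact: derivableM. Qed.

Lemma Ck_le n f : Ck n.+1 f -> Ck n f.
Proof. by elim: n f => // n IH f [df cf]; split => //; exact: IH. Qed.

Lemma CkD n f g : Ck n f -> Ck n g -> Ck n (fun x => f x + g x).
Proof.
elim: n f g => // n IH f g [df cf] [dg cg]; split.
  by move=> x; exact: derivable_funD.
by rewrite derive1_funD//; exact: IH.
Qed.

Lemma CkM n f g : Ck n f -> Ck n g -> Ck n (fun x => f x * g x).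
Proof.
elim: n f g => // n IH f g Cf Cg.
have [[df cf] [dg cg]] := (Cf, Cg); split.
  by move=> x; exact: derivable_funM.
by rewrite derive1_funM//; apply: CkD; apply: IH => //; exact: Ck_le.
Qed.

Lemma Ck_cst n (c : R) : Ck n (fun=> c).
Proof.
elim: n c => // n IH c; split => [x|]; first exact: derivable_cst.
rewrite (_ : derive1 _ = fun=> (0 : R)); first exact: IH.
by apply/funext => x; exact: derive1_cst.
Qed.

Lemma Ck_id n : Ck n (fun x : R => x).
Proof.
case: n => // n; split => [x|]; first exact: derivable_id.
rewrite (_ : derive1 _ = fun=> (1 : R)); first exact: Ck_cst.
by apply/funext => x; exact: derive1_id.
Qed.

Lemma derivable_funcomp f g (x : R) : derivable g x 1 -> derivable f (g x) 1 ->
  derivable (fun x => f (g x)) x 1.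
Proof.
move=> /derivable1_diffP dg /derivable1_diffP df.
by apply/derivable1_diffP; exact: differentiable_comp.
Qed.

Lemma Ck_comp n f g : Ck n f -> Ck n g -> Ck n (fun x => f (g x)).
Proof.
elim: n f g => // n IH f g Cf Cg.
have [[df cf] [dg cg]] := (Cf, Cg); split.
  by move=> x; exact: derivable_funcomp.
rewrite (_ : derive1 _ = fun x => derive1 f (g x) * derive1 g x).
  by apply: CkM => //; apply: IH => //; exact: Ck_le.
by apply/funext => x; exact: derive1_comp.
Qed.

Lemma cinfD f g : cinf f -> cinf g -> cinf (fun x => f x + g x).
Proof. by move=> cf cg n; exact: CkD. Qed.

Lemma cinfM f g : cinf f -> cinf g -> cinf (fun x => f x * g x).
Proof. by move=> cf cg n; exact: CkM. Qed.

Lemma cinf_comp f g : cinf f -> cinf g -> cinf (fun x => f (g x)).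
Proof. by move=> cf cg n; exact: Ck_comp. Qed.

Lemma cinf_cst c : cinf (fun=> c).
Proof. by move=> n; exact: Ck_cst. Qed.

Lemma cinf_id : cinf (fun x => x).
Proof. by move=> n; exact: Ck_id. Qed.

Lemma cinfX f k : cinf f -> cinf (fun x => f x ^+ k).
Proof.
move=> cf; elim: k => [|k IH].
  by rewrite (_ : (fun _ => _) = fun=> (1 : R))//; exact: cinf_cst.
rewrite (_ : (fun _ => _) = fun x => f x * f x ^+ k); first exact: cinfM.
by apply/funext => x; rewrite exprS.
Qed.

Lemma cinf_derive1 f : cinf f -> cinf (derive1 f).
Proof. by move=> cf n; have [] := cf n.+1. Qed.

Lemma cinf_derivable f (x : R) : cinf f -> derivable f x 1.
Proof. by move=> cf; have [df _] := cf 1; exact: df. Qed.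

Lemma cinf_continuous f : cinf f -> continuous f.
Proof.
move=> cf x; apply: differentiable_continuous.
by apply/derivable1_diffP; exact: cinf_derivable.
Qed.

Lemma cinfZ c f : cinf f -> cinf (fun x => c * f x).
Proof. by move=> cf; apply: cinfM => //; exact: cinf_cst. Qed.

Lemma cinfN f : cinf f -> cinf (fun x => - f x).
Proof.
move=> /(@cinfZ (-1)); rewrite (_ : (fun x => - f x) = fun x => -1 * f x) //.
by apply/funext => x; rewrite mulN1r.
Qed.

Lemma derive1_cos : derive1 (@cos R) = fun x => - sin x.
Proof. by apply/funext => x; exact: (is_derive1P (is_derive_cos x)).2. Qed.

Lemma derive1_sin : derive1 (@sin R) = @cos R.
Proof. by apply/funext => x; exact: (is_derive1P (is_derive_sin x)).2. Qed.

Lemma cinf_trig : cinf (@cos R) /\ cinf (@sin R).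
Proof.
suff H n : Ck n (@cos R) /\ Ck n (@sin R) by split => n; have [] := H n.
elim: n => // n [IHc IHs]; split; split.
- by move=> x; exact: derivable_cos.
- rewrite derive1_cos (_ : (fun x => - sin x) = fun x => -1 * sin x).
    by apply: CkM => //; exact: Ck_cst.
  by apply/funext => x; rewrite mulN1r.
- by move=> x; exact: derivable_sin.
- by rewrite derive1_sin.
Qed.

(* A common shape for [exp (- 1 / t)] extended by 0 and all its derivatives. *)
Definition hexp (p : {poly R}) (t : R) : R :=
  if 0 < t then p.[t^-1] * expR (- t^-1) else 0.

Lemma poly_exp_bounded (p : {poly R}) :
  exists C, forall s, 0 <= s -> `|p.[s]| * expR (- s) <= C.
Proof.
have mono k : exists C, forall s : R, 0 <= s -> s ^+ k * expR (- s) <= C.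
  exists k.+1`!%:R => s s0; rewrite expRN ler_pdivrMr ?expR_gt0//.
  have [k0|k0] := eqVneq k 0%N.
    rewrite k0 expr0 mul1r -expR0 ler_expR//.
  have := expR_ge1Dxn k.-1 s0; rewrite prednK ?lt0n// => h.
  apply: (@le_trans _ _ (k`!%:R * expR s)).
    rewrite mulrC -ler_pdivrMr ?ltr0n ?fact_gt0// (le_trans _ h)//.
    by rewrite lerDr.
  by rewrite ler_wpM2r ?expR_ge0// ler_nat factS leq_pmull.
have /choice[C hC] := mono.
exists (\sum_(i < size p) `|p`_i| * C i) => s s0.
rewrite horner_coef; apply: (@le_trans _ _ (\sum_(i < size p) `|p`_i| * s ^+ i * expR (- s))).
  rewrite -mulr_suml ler_wpM2r ?expR_ge0// (le_trans (ler_norm_sum _ _ _))//.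
  by apply: ler_sum => i _; rewrite normrM normrX (ger0_norm s0).
by apply: ler_sum => i _; rewrite -mulrA ler_wpM2l// hC.
Qed.

(** For [t > 0] the chain rule gives [t^-2 (p - p')(1/t) exp(-1/t)], again of the same shape. At 0,
    boundedness of [(X^2 p)(s) exp(-s)] for [s >= 0] yields [|hexp p h| <= C h^2], which kills the
    difference quotient. *)
Lemma is_derive_hexp p (t : R) :
  is_derive t 1 (hexp p) (hexp ('X^2 * (p - p^`())) t).
Proof.
have [t0|t0|->] := ltgtP t 0.
- rewrite {2}/hexp ltNge (ltW t0) /=.
  apply: (@near_eq_is_derive _ _ _ (cst 0) _ _ _ _ _ (is_derive_cst _ _ _)).
  have : \forall y \near t, y < 0 by exact: (@cvgr_lt _ _ (nbhs t) _ id t cvg_id).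
  by apply: filterS => y y0; rewrite /hexp ltNge (ltW y0).
- rewrite {2}/hexp t0.
  have : is_derive t 1 (fun y => p.[y^-1] * expR (- y^-1))
     (('X^2 * (p - p^`())).[t^-1] * expR (- t^-1)).
    have dV : derivable (fun y : R => y^-1) t 1.
      by apply: derivableV; [rewrite gt_eqF|exact: derivable_id].
    have dVE : derive1 (fun y : R => y^-1) t = - t ^- 2.
      by rewrite derive1E deriveV ?gt_eqF// derive_id /GRing.scale /= mulr1.
    have dN : derivable (fun y : R => - y^-1) t 1 by apply: derivableN.
    have dNE : derive1 (fun y : R => - y^-1) t = t ^- 2.
      by rewrite derive1E deriveN// -derive1E dVE opprK.
    have d1 := derivable_funcomp dV (@derivable_horner R p t^-1).
    have d2 := @derivable_funcomp expR _ t dN (@derivable_expR R _).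
    have e1 : derive1 (fun y => p.[y^-1]) t = p^`().[t^-1] * - t ^- 2.
      by rewrite (derive1_comp dV (@derivable_horner R p t^-1)) dVE derivE.
    have e2 : derive1 (fun y => expR (- y^-1)) t = expR (- t^-1) * t ^- 2.
      rewrite (derive1_comp dN (@derivable_expR R _)) dNE.
      by rewrite (is_derive1P (is_derive_expR _)).2.
    have := is_deriveM (derivable1_is d1) (derivable1_is d2).
    rewrite e1 e2 => H; apply: is_derive_eq.
    transitivity (p.[t^-1] * (expR (- t^-1) * t ^- 2) +
      expR (- t^-1) * (p^`().[t^-1] * - t ^- 2)); first by [].
    by rewrite hornerM hornerXn hornerD hornerN exprVn; ring.
  apply: near_eq_is_derive.
  have : \forall y \near t, 0 < y by exact: (@cvgr_gt _ _ (nbhs t) _ id t cvg_id).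
  by apply: filterS => y y0; rewrite /hexp y0.
- rewrite {2}/hexp ltxx.
  have [C HC] := poly_exp_bounded ('X^2 * p).
  have bound h : `|hexp p h| <= C * h ^+ 2.
    rewrite /hexp; case: ifPn => [h0|_]; last first.
      rewrite normr0 mulr_ge0 ?sqr_ge0//; apply: le_trans (HC 0 (lexx 0)).
      by rewrite mulr_ge0 ?expR_ge0.
    rewrite normrM (ger0_norm (expR_ge0 _)) -ler_pdivrMr ?exprn_gt0//.
    have hV0 : 0 <= h^-1 by rewrite invr_ge0 ltW.
    apply: le_trans (HC h^-1 hV0).
    rewrite hornerM hornerXn normrM normrX (ger0_norm hV0) exprVn.
    by rewrite [leLHS]mulrC mulrA.
  have H : (fun h : R => h^-1 *: ((hexp p \o shift 0) (h *: (1 : R)) - hexp p 0))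
      @ 0^' --> (0 : R).
    apply/cvgr0Pnorm_lt => e e0; near=> h.
    have h0 : h != 0 by near: h; exact: nbhs_dnbhs_neq.
    rewrite /= addr0 /hexp ltxx subr0 -/(hexp p _) /GRing.scale /= mulr1 normrM.
    rewrite normfV mulrC ltr_pdivrMr ?normr_gt0// (le_lt_trans (bound h))//.
    rewrite -(real_normK (num_real h)) expr2 mulrA ltr_pM2r ?normr_gt0//.
    apply: (@le_lt_trans _ _ ((`|C| + 1) * `|h|)).
      by rewrite ler_wpM2r// (le_trans (ler_norm C))// lerDl.
    rewrite mulrC -ltr_pdivlMr ?ltr_wpDl//; near: h.
    by apply: dnbhs0_lt; rewrite divr_gt0// ltr_wpDl.
  split; first by apply/cvg_ex; exists 0.
  exact: cvg_lim H.
Unshelve. all: by end_near. Qed.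

Lemma cinf_hexp p : cinf (hexp p).
Proof.
move=> n; elim: n p => // n IH p; split => [x|].
  by have [] := is_derive1P (is_derive_hexp p x).
rewrite (_ : derive1 _ = hexp ('X^2 * (p - p^`()))); first exact: IH.
by apply/funext => x; exact: (is_derive1P (is_derive_hexp p x)).2.
Qed.

Lemma hexp1_le t : 0 < t -> 1 - t^-1 <= hexp 1 t.
Proof.
by move=> t0; rewrite /hexp t0 hornerC mul1r expR_ge1Dx.
Qed.

(** A plateau function made by composition alone. For [|t| <= 1/2] the inner [hexp] is 0 and the
    quotient is 1; for [|t| >= 1] its argument is at least 3, its value at least [1 - 1/3 > 1/2],
    and the outer argument becomes negative. *)
Definition bump (t : R) : R :=
  hexp 1 (2^-1 - hexp 1 (4 * t ^+ 2 - 1)) / hexp 1 2^-1.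

Lemma cinf_bump : cinf bump.
Proof.
rewrite (_ : bump = fun t =>
  (hexp 1 2^-1)^-1 * hexp 1 (2^-1 + - hexp 1 (4 * t ^+ 2 + - 1))).
  apply/cinfZ/(cinf_comp (cinf_hexp 1)); apply: cinfD; first exact: cinf_cst.
  apply/cinfN/(cinf_comp (cinf_hexp 1)); apply: cinfD; last exact: cinf_cst.
  exact/cinfZ/cinfX/cinf_id.
by apply/funext => t; rewrite mulrC.
Qed.

Lemma bump1 t : `|t| <= 2^-1 -> bump t = 1.
Proof.
move=> t2; have t4 : 4 * t ^+ 2 - 1 <= 0.
  rewrite -(real_normK (num_real t)); move: (normr_ge0 t) => t0; nra.
rewrite /bump {2}/hexp ltNge t4 /= subr0 divff// /hexp invr_gt0 ltr0n.
by rewrite hornerC mul1r gt_eqF// expR_gt0.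
Qed.

Lemma bump0 t : 1 <= `|t| -> bump t = 0.
Proof.
move=> t1; have t4 : 3 <= 4 * t ^+ 2 - 1.
  rewrite -(real_normK (num_real t)); nra.
have := @hexp1_le (4 * t ^+ 2 - 1) (lt_le_trans (ltr0n R 3) t4) => h.
have t3 : (4 * t ^+ 2 - 1)^-1 <= 3^-1.
  by rewrite lef_pV2 ?posrE ?ltr0n// (lt_le_trans _ t4)// ltr0n.
rewrite /bump {1}/hexp ltNge subr_le0 (_ : _ <= _ = true) ?mul0r//.
by apply: le_trans h; lra.
Qed.

End smooth_line.

(** * Complex-valued functions and partial derivatives *)

Section complex_lemmas.
Context {R : realType}.
Local Notation Re := (@complex.Re R).
Local Notation Im := (@complex.Im R).
Local Notation normc := (@complex.ComplexField.Normc.normc R).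
Implicit Types z w : R[i].

Lemma cReD z w : Re (z + w) = Re z + Re w. Proof. by case: z w => [a b] [c d]. Qed.
Lemma cImD z w : Im (z + w) = Im z + Im w. Proof. by case: z w => [a b] [c d]. Qed.
Lemma cReN z : Re (- z) = - Re z. Proof. by case: z. Qed.
Lemma cImN z : Im (- z) = - Im z. Proof. by case: z. Qed.
Lemma cReM z w : Re (z * w) = Re z * Re w - Im z * Im w.
Proof. by case: z w => [a b] [c d]. Qed.
Lemma cImM z w : Im (z * w) = Re z * Im w + Im z * Re w.
Proof. by case: z w => [a b] [c d]. Qed.
Lemma eq_ReIm z w : Re z = Re w -> Im z = Im w -> z = w.
Proof. by case: z w => [a b] [c d] /= -> ->. Qed.

Lemma normc_ge0 z : 0 <= normc z. Proof. by case: z => a b; exact: sqrtr_ge0. Qed.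

Lemma normcM z w : normc (z * w) = normc z * normc w.
Proof. exact: complex.ComplexField.Normc.normcM. Qed.

Lemma le_normcD z w : normc (z + w) <= normc z + normc w.
Proof. exact: complex.le_normcD. Qed.

Lemma normcN z : normc (- z) = normc z.
Proof. exact: complex.normcN. Qed.

Lemma normcB z w : normc (z - w) <= normc z + normc w.
Proof. by rewrite (le_trans (le_normcD _ _))// normcN. Qed.

Lemma normc_real (x : R) : normc x%:C = `|x|.
Proof. by rewrite /= expr0n addr0 sqrtr_sqr. Qed.

Lemma normc0 : normc 0 = 0.
Proof. exact: complex.ComplexField.Normc.normc0. Qed.

Lemma normc1 : normc 1 = 1.
Proof. exact: complex.ComplexField.Normc.normc1. Qed.

Lemma normcX z k : normc (z ^+ k) = normc z ^+ k.
Proof.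
by elim: k => [|k IH]; rewrite ?expr0 ?normc1// !exprS normcM IH.
Qed.

Lemma normc_i : normc 'i%C = 1.
Proof. by rewrite /= expr0n expr1n add0r sqrtr1. Qed.

Lemma normc_sum (I : Type) (r : seq I) (P : pred I) (F : I -> R[i]) :
  normc (\sum_(i <- r | P i) F i) <= \sum_(i <- r | P i) normc (F i).
Proof.
elim/big_rec2 : _ => [|i x y _ IH]; first by rewrite normc0.
by rewrite (le_trans (le_normcD _ _))// lerD2l.
Qed.

Lemma normc_prod (I : Type) (r : seq I) (P : pred I) (F : I -> R[i]) :
  normc (\prod_(i <- r | P i) F i) = \prod_(i <- r | P i) normc (F i).
Proof. by elim/big_rec2 : _ => [|i x y _ <-]; rewrite ?normc1 ?normcM. Qed.

Lemma le_normc_Re z : `|Re z| <= normc z.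
Proof.
by case: z => a b /=; rewrite -sqrtr_sqr ler_wsqrtr// lerDl sqr_ge0.
Qed.

Lemma le_normc_Im z : `|Im z| <= normc z.
Proof.
by case: z => a b /=; rewrite -sqrtr_sqr ler_wsqrtr// lerDr sqr_ge0.
Qed.

Lemma normc_le z : normc z <= `|Re z| + `|Im z|.
Proof.
rewrite {1}(_ : z = (Re z)%:C + 'i%C * (Im z)%:C); last first.
  by case: z => a b; apply: eq_ReIm; rewrite ?cReD ?cImD ?cReM ?cImM /=; ring.
by rewrite (le_trans (le_normcD _ _))// normcM normc_i mul1r !normc_real.
Qed.

End complex_lemmas.

Section complex_line.
Context {R : realType}.
Local Notation Re := (@complex.Re R).
Local Notation Im := (@complex.Im R).
Implicit Types F G : R -> R[i].

Definition cdiff F (t : R) : Prop :=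
  derivable (Re \o F) t 1 /\ derivable (Im \o F) t 1.

Definition cder F (t : R) : R[i] :=
  derive1 (Re \o F) t +i* derive1 (Im \o F) t.

Lemma cderD F G t : cdiff F t -> cdiff G t ->
  cdiff (fun t => F t + G t) t /\
  cder (fun t => F t + G t) t = cder F t + cder G t.
Proof.
move=> [dF1 dF2] [dG1 dG2].
have E1 : Re \o (fun t => F t + G t) = (Re \o F) + (Re \o G).
  by apply/funext => x; exact: cReD.
have E2 : Im \o (fun t => F t + G t) = (Im \o F) + (Im \o G).
  by apply/funext => x; exact: cImD.
split; first by split; [rewrite E1|rewrite E2]; exact: derivableD.
rewrite /cder E1 E2; congr (_ +i* _).
- exact: (is_derive1P (is_deriveD (derivable1_is dF1) (derivable1_is dG1))).2.
- exact: (is_derive1P (is_deriveD (derivable1_is dF2) (derivable1_is dG2))).2.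
Qed.

Lemma cderM F G t : cdiff F t -> cdiff G t ->
  cdiff (fun t => F t * G t) t /\
  cder (fun t => F t * G t) t = cder F t * G t + F t * cder G t.
Proof.
move=> [dF1 dF2] [dG1 dG2].
have E1 : Re \o (fun t => F t * G t) =
    (Re \o F) * (Re \o G) - (Im \o F) * (Im \o G).
  by apply/funext => x; exact: cReM.
have E2 : Im \o (fun t => F t * G t) =
    (Re \o F) * (Im \o G) + (Im \o F) * (Re \o G).
  by apply/funext => x; exact: cImM.
split.
  split.
    by rewrite E1; exact: (derivableB (derivableM dF1 dG1) (derivableM dF2 dG2)).
  by rewrite E2; exact: (derivableD (derivableM dF1 dG2) (derivableM dF2 dG1)).
have H (f g : R -> R) (df : derivable f t 1) (dg : derivable g t 1) :=
  is_deriveM (derivable1_is df) (derivable1_is dg).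
rewrite /cder E1 E2.
rewrite (is_derive1P (is_deriveB (H _ _ dF1 dG1) (H _ _ dF2 dG2))).2.
rewrite (is_derive1P (is_deriveD (H _ _ dF1 dG2) (H _ _ dF2 dG1))).2.
rewrite /GRing.scale /=.
by apply: eq_ReIm; rewrite ?cReD ?cImD ?cReM ?cImM /=; ring.
Qed.

Lemma cder_cst (c : R[i]) t : cdiff (fun=> c) t /\ cder (fun=> c) t = 0.
Proof.
split; first by split; exact: derivable_cst.
by rewrite /cder; congr (_ +i* _); exact: derive1_cst.
Qed.

Definition csmooth F : Prop := cinf (Re \o F) /\ cinf (Im \o F).

Lemma csmooth_cdiff F t : csmooth F -> cdiff F t.
Proof. by move=> [c1 c2]; split; exact: cinf_derivable. Qed.

Lemma csmooth_cder F : csmooth F -> csmooth (cder F).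
Proof. by move=> [c1 c2]; split; exact: cinf_derive1. Qed.

Lemma csmooth_iter_cder F k : csmooth F -> csmooth (iter k cder F).
Proof. by move=> cF; elim: k => //= k; exact: csmooth_cder. Qed.

Lemma csmoothD F G : csmooth F -> csmooth G -> csmooth (fun t => F t + G t).
Proof.
move=> [c1 c2] [d1 d2]; split.
- by rewrite (_ : _ \o _ = fun t => (Re \o F) t + (Re \o G) t);
    [exact: cinfD|apply/funext => t; exact: cReD].
- by rewrite (_ : _ \o _ = fun t => (Im \o F) t + (Im \o G) t);
    [exact: cinfD|apply/funext => t; exact: cImD].
Qed.

Lemma csmoothM F G : csmooth F -> csmooth G -> csmooth (fun t => F t * G t).
Proof.
move=> [c1 c2] [d1 d2]; split.
- rewrite (_ : _ \o _ = fun t =>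
    (Re \o F) t * (Re \o G) t + - ((Im \o F) t * (Im \o G) t)).
    by apply: cinfD; [|apply: cinfN]; exact: cinfM.
  by apply/funext => t; exact: cReM.
- rewrite (_ : _ \o _ = fun t =>
    (Re \o F) t * (Im \o G) t + (Im \o F) t * (Re \o G) t).
    by apply: cinfD; exact: cinfM.
  by apply/funext => t; exact: cImM.
Qed.

Lemma csmooth_real (f : R -> R) : cinf f -> csmooth (fun t => (f t)%:C).
Proof. by move=> cf; split => //; exact: (cinf_cst (0 : R)). Qed.

Lemma csmooth_cst (c : R[i]) : csmooth (fun=> c).
Proof. by split; exact: cinf_cst. Qed.

Lemma cder_real (f : R -> R) t : cder (fun t => (f t)%:C) t = (derive1 f t)%:C.
Proof. by rewrite /cder; congr (_ +i* _); exact: derive1_cst. Qed.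

Lemma csmooth_sum (I : Type) (r : seq I) (F : I -> R -> R[i]) :
  (forall i, csmooth (F i)) -> csmooth (fun t => \sum_(i <- r) F i t).
Proof.
move=> cF; elim: r => [|i r IH].
  rewrite (_ : (fun _ => _) = fun=> 0); first exact: csmooth_cst.
  by apply/funext => t; rewrite big_nil.
rewrite (_ : (fun _ => _) = fun t => F i t + \sum_(j <- r) F j t).
  exact: csmoothD.
by apply/funext => t; rewrite big_cons.
Qed.

Lemma cder_funD F G : csmooth F -> csmooth G ->
  cder (fun t => F t + G t) = fun t => cder F t + cder G t.
Proof.
move=> cF cG; apply/funext => t.
by have [] := cderD (csmooth_cdiff t cF) (csmooth_cdiff t cG).
Qed.

Lemma cder_funM F G : csmooth F -> csmooth G ->
  cder (fun t => F t * G t) = fun t => cder F t * G t + F t * cder G t.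
Proof.
move=> cF cG; apply/funext => t.
by have [] := cderM (csmooth_cdiff t cF) (csmooth_cdiff t cG).
Qed.

Lemma cder_funZ c F : csmooth F ->
  cder (fun t => c * F t) = fun t => c * cder F t.
Proof.
move=> cF; rewrite (cder_funM (csmooth_cst c) cF); apply/funext => t.
by have [_ ->] := cder_cst c t; rewrite mul0r add0r.
Qed.

Lemma cder_fun_sum (I : Type) (r : seq I) (F : I -> R -> R[i]) :
  (forall i, csmooth (F i)) ->
  cder (fun t => \sum_(i <- r) F i t) = fun t => \sum_(i <- r) cder (F i) t.
Proof.
move=> cF; elim: r => [|i r IH].
  apply/funext => t; rewrite big_nil.
  rewrite (_ : (fun _ => _) = fun=> 0); first by have [_ ->] := cder_cst 0 t.
  by apply/funext => u; rewrite big_nil.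
rewrite (_ : (fun _ => _) = fun t => F i t + \sum_(j <- r) F j t).
  rewrite cder_funD//; last exact: csmooth_sum.
  by apply/funext => t; rewrite IH big_cons.
by apply/funext => t; rewrite big_cons.
Qed.

End complex_line.

(** * Leibniz rule and tensor products in several variables *)

Section partial_calculus.
Context {R : realType} {p : nat}.
Local Notation Re := (@complex.Re R).
Local Notation Im := (@complex.Im R).
Local Notation normc := (@complex.ComplexField.Normc.normc R).
Implicit Types (f g : 'rV[R]_p -> R[i]) (s : seq 'I_p).

Definition ccont n (f : 'rV[R]_n -> R[i]) : Prop :=
  continuous (Re \o f) /\ continuous (Im \o f).

(** Derivatives along arbitrary words of indices, as in [smooth]. Working with words avoids ever
    having to permute partial derivatives. *)
Definition dseq s f := foldr (@partial R p) f s.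

Lemma partialE i f x : partial i f x = cder (f \o upd x i) (x 0 i).
Proof. by rewrite /partial !derive_line. Qed.

Lemma smooth_cdiff i f x : smooth f -> cdiff (f \o upd x i) (x 0 i).
Proof.
move=> /(_ [::])/= [_ _ /(_ i x) [d1 d2]]; split.
- exact: ((derivable_line (Re \o f) x i).1 d1).
- exact: ((derivable_line (Im \o f) x i).1 d2).
Qed.

Lemma smooth_ccont f : smooth f -> ccont f.
Proof. by move=> /(_ [::])/= [c1 c2 _]. Qed.

Lemma smooth_dseq s f : smooth f -> smooth (dseq s f).
Proof.
move=> sf t; have := sf (t ++ s).
by rewrite foldr_cat.
Qed.

Lemma smooth_partial i f : smooth f -> smooth (partial i f).
Proof. exact: (@smooth_dseq [:: i]). Qed.

Lemma partialD i f g : smooth f -> smooth g ->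
  partial i (fun x => f x + g x) = fun x => partial i f x + partial i g x.
Proof.
move=> sf sg; apply/funext => x; rewrite !partialE.
by have [_ <-] := cderD (smooth_cdiff i x sf) (smooth_cdiff i x sg).
Qed.

Lemma partialM i f g : smooth f -> smooth g ->
  partial i (fun x => f x * g x) =
  fun x => partial i f x * g x + f x * partial i g x.
Proof.
move=> sf sg; apply/funext => x; rewrite !partialE.
have [_ ->] := cderM (smooth_cdiff i x sf) (smooth_cdiff i x sg).
by rewrite /= upd_id.
Qed.

Lemma continuousR_add (T : topologicalType) (a b : T -> R) :
  continuous a -> continuous b -> continuous (fun x => a x + b x).
Proof. by move=> ca cb x; apply: cvgD; [exact: ca|exact: cb]. Qed.

Lemma continuousR_mul (T : topologicalType) (a b : T -> R) :
  continuous a -> continuous b -> continuous (fun x => a x * b x).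
Proof. by move=> ca cb x; apply: cvgM; [exact: ca|exact: cb]. Qed.

Lemma ccontD n (f g : 'rV[R]_n -> R[i]) : ccont f -> ccont g ->
  ccont (fun x => f x + g x).
Proof.
move=> [f1 f2] [g1 g2]; split.
- rewrite (_ : _ \o _ = fun x => (Re \o f) x + (Re \o g) x).
    exact: continuousR_add.
  by apply/funext => x; exact: cReD.
- rewrite (_ : _ \o _ = fun x => (Im \o f) x + (Im \o g) x).
    exact: continuousR_add.
  by apply/funext => x; exact: cImD.
Qed.

Lemma ccontM n (f g : 'rV[R]_n -> R[i]) : ccont f -> ccont g ->
  ccont (fun x => f x * g x).
Proof.
move=> [f1 f2] [g1 g2]; split.
- rewrite (_ : _ \o _ = fun x => (Re \o f) x * (Re \o g) x
    + -1 * ((Im \o f) x * (Im \o g) x)).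
    apply: continuousR_add; first exact: continuousR_mul.
    by apply: continuousR_mul; [exact: cst_continuous|exact: continuousR_mul].
  by apply/funext => x; rewrite mulN1r; exact: cReM.
- rewrite (_ : _ \o _ = fun x => (Re \o f) x * (Im \o g) x
    + (Im \o f) x * (Re \o g) x).
    by apply: continuousR_add; exact: continuousR_mul.
  by apply/funext => x; exact: cImM.
Qed.

Lemma ccont_cst n c : ccont (fun _ : 'rV[R]_n => c).
Proof. by split; exact: cst_continuous. Qed.

Lemma ccont_sum n (I : Type) (r : seq I) (F : I -> 'rV[R]_n -> R[i]) :
  (forall i, ccont (F i)) -> ccont (fun x => \sum_(i <- r) F i x).
Proof.
move=> cF; elim: r => [|i r IH].
  rewrite (_ : (fun _ => _) = fun=> 0); first exact: ccont_cst.
  by apply/funext => x; rewrite big_nil.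
rewrite (_ : (fun _ => _) = fun x => F i x + \sum_(j <- r) F j x).
  exact: ccontD.
by apply/funext => x; rewrite big_cons.
Qed.

Definition cdiffn f := forall i x, cdiff (f \o upd x i) (x 0 i).

Lemma smoothP f : smooth f <-> forall s, ccont (dseq s f) /\ cdiffn (dseq s f).
Proof.
split=> [sf s|sf s].
  have [c1 c2 d] := sf s; split => // i x; have [d1 d2] := d i x; split.
  - exact: ((derivable_line (Re \o dseq s f) x i).1 d1).
  - exact: ((derivable_line (Im \o dseq s f) x i).1 d2).
have [[c1 c2] d] := sf s; split => // i x; have [d1 d2] := d i x; split.
- exact: ((derivable_line (Re \o dseq s f) x i).2 d1).
- exact: ((derivable_line (Im \o dseq s f) x i).2 d2).
Qed.

Lemma dseq_add s f g : smooth f -> smooth g ->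
  dseq s (fun x => f x + g x) = fun x => dseq s f x + dseq s g x.
Proof.
move=> sf sg; elim: s => //= i s ->.
by apply: partialD; exact: smooth_dseq.
Qed.

Lemma smoothD f g : smooth f -> smooth g -> smooth (fun x => f x + g x).
Proof.
move=> sf sg; apply/smoothP => s; rewrite dseq_add//.
have [cf df] := (smoothP _).1 sf s; have [cg dg] := (smoothP _).1 sg s.
split; first exact: ccontD.
by move=> i x; have [] := cderD (df i x) (dg i x).
Qed.

Lemma dseq_cst s c : dseq s (fun=> c) = fun=> if s is [::] then c else 0.
Proof.
elim: s => //= i s ->; apply/funext => x; rewrite partialE.
by have [_] := cder_cst (if s is [::] then c else 0) (x 0 i).
Qed.

Lemma smooth_cst c : smooth (fun _ : 'rV[R]_p => c).
Proof.
apply/smoothP => s; rewrite dseq_cst; split; first exact: ccont_cst.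
by move=> i x; have [] := cder_cst (if s is [::] then c else 0) (x 0 i).
Qed.

(* All ways to distribute the derivatives of [s] over two factors, with
   multiplicity. *)
Fixpoint splits s : seq (seq 'I_p * seq 'I_p) :=
  if s is i :: s' then
    [seq (i :: q.1, q.2) | q <- splits s'] ++ [seq (q.1, i :: q.2) | q <- splits s']
  else [:: ([::], [::])].

(** Every iterated derivative of the product is one of these finite Leibniz sums, so smoothness of
    the product reduces to continuity and differentiability along lines of the sums. *)
Let smoothM_aux f g : smooth f -> smooth g -> forall s,
  (ccont (fun x => \sum_(q <- splits s) dseq q.1 f x * dseq q.2 g x) /\
   cdiffn (fun x => \sum_(q <- splits s) dseq q.1 f x * dseq q.2 g x)) /\
  dseq s (fun x => f x * g x) =
    fun x => \sum_(q <- splits s) dseq q.1 f x * dseq q.2 g x.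
Proof.
move=> sf sg.
have sumd (r : seq (seq 'I_p * seq 'I_p)) i x : let F := fun x =>
    \sum_(q <- r) dseq q.1 f x * dseq q.2 g x in
    cdiff (F \o upd x i) (x 0 i) /\
    partial i F x = \sum_(q <- r) (partial i (dseq q.1 f) x * dseq q.2 g x +
                                   dseq q.1 f x * partial i (dseq q.2 g) x).
  move=> F; rewrite partialE /F; elim: r {F} => [|q r [IHd IH]].
    rewrite big_nil (_ : _ \o _ = fun=> 0); first exact: cder_cst.
    by apply/funext => t; rewrite /= big_nil.
  have dq1 := smooth_cdiff i x (smooth_dseq q.1 sf).
  have dq2 := smooth_cdiff i x (smooth_dseq q.2 sg).
  have [dM eM] := cderM dq1 dq2.
  have [dS eS] := cderD dM IHd.
  rewrite (_ : _ \o _ = fun t => (dseq q.1 f \o upd x i) t * (dseq q.2 g \o upd x i) t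
    + ((fun x => \sum_(q <- r) dseq q.1 f x * dseq q.2 g x) \o upd x i) t);
    last by apply/funext => t; rewrite /= big_cons.
  split => //; rewrite eS eM IH big_cons !partialE.
  by congr (_ + _); rewrite /= !upd_id.
move=> s; split.
  split; last by move=> i x; have [] := sumd (splits s) i x.
  by apply: ccont_sum => q; apply: ccontM; apply: smooth_ccont; exact: smooth_dseq.
elim: s => [|i s IH].
  by apply/funext => x; rewrite /= big_seq1.
apply/funext => x; rewrite /= -/(dseq s _) IH.
have [_ ->] := sumd (splits s) i x.
by rewrite big_split big_cat /= !big_map.
Qed.

Lemma dseqM s f g : smooth f -> smooth g ->
  dseq s (fun x => f x * g x) =
  fun x => \sum_(q <- splits s) dseq q.1 f x * dseq q.2 g x.
Proof. by move=> sf sg; have [] := smoothM_aux sf sg s. Qed.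

Lemma smoothM f g : smooth f -> smooth g -> smooth (fun x => f x * g x).
Proof.
by move=> sf sg; apply/smoothP => s; have [H ->] := smoothM_aux sf sg s.
Qed.

Lemma dseqZ s c f : smooth f ->
  dseq s (fun x => c * f x) = fun x => c * dseq s f x.
Proof.
move=> sf; elim: s => //= i s ->; apply/funext => x.
rewrite partialM//; [|exact: smooth_cst|exact: smooth_dseq].
by have := dseq_cst [:: i] c => /= ->; rewrite mul0r add0r.
Qed.

Lemma smooth_sum (I : Type) (r : seq I) (F : I -> 'rV[R]_p -> R[i]) :
  (forall i, smooth (F i)) -> smooth (fun x => \sum_(i <- r) F i x).
Proof.
move=> cF; elim: r => [|i r IH].
  rewrite (_ : (fun _ => _) = fun=> 0); first exact: smooth_cst.
  by apply/funext => x; rewrite big_nil.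
rewrite (_ : (fun _ => _) = fun x => F i x + \sum_(j <- r) F j x).
  exact: smoothD.
by apply/funext => x; rewrite big_cons.
Qed.

Lemma dseq_sum s (I : Type) (r : seq I) (F : I -> 'rV[R]_p -> R[i]) :
  (forall i, smooth (F i)) ->
  dseq s (fun x => \sum_(i <- r) F i x) = fun x => \sum_(i <- r) dseq s (F i) x.
Proof.
move=> cF; elim: r => [|i r IH].
  rewrite (_ : (fun _ => _) = fun=> 0).
    by apply/funext => x; rewrite dseq_cst big_nil; case: s.
  by apply/funext => x; rewrite big_nil.
rewrite (_ : (fun _ => _) = fun x => F i x + \sum_(j <- r) F j x).
  rewrite dseq_add//; last exact: smooth_sum.
  by apply/funext => x; rewrite IH big_cons.
by apply/funext => x; rewrite big_cons.
Qed.

(** Monomials, plane waves, packets and cutoffs all have this form. A partial derivative changes a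
    single factor, so only the number of occurrences of each index in a word matters. *)
Definition tensor (F : 'I_p -> R -> R[i]) (x : 'rV[R]_p) : R[i] :=
  \prod_j F j (x 0 j).

Definition ftupd (T : Type) (F : 'I_p -> T) (i : 'I_p) (a : T) (j : 'I_p) : T :=
  if j == i then a else F j.

Lemma tensor_line F x i t : tensor F (upd x i t) =
  F i t * \prod_(j < p | j != i) F j (x 0 j).
Proof.
rewrite /tensor (bigD1 i) //= upd_eq; congr (_ * _).
by apply: eq_bigr => j ji; rewrite upd_neq.
Qed.

Lemma cdiffn_tensor F : (forall j, csmooth (F j)) -> cdiffn (tensor F).
Proof.
move=> cF i x.
rewrite (_ : _ \o _ = fun t => F i t * \prod_(j < p | j != i) F j (x 0 j)).
  have [dc _] := cder_cst (\prod_(j < p | j != i) F j (x 0 j)) (x 0 i).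
  by have [] := cderM (csmooth_cdiff (x 0 i) (cF i)) dc.
by apply/funext => t; exact: tensor_line.
Qed.

Lemma partial_tensor F i : (forall j, csmooth (F j)) ->
  partial i (tensor F) = tensor (ftupd F i (cder (F i))).
Proof.
move=> cF; apply/funext => x; rewrite partialE.
rewrite (_ : _ \o _ = fun t => F i t * \prod_(j < p | j != i) F j (x 0 j)).
  have [dc ec] := cder_cst (\prod_(j < p | j != i) F j (x 0 j)) (x 0 i).
  have [_ ->] := cderM (csmooth_cdiff (x 0 i) (cF i)) dc.
  rewrite ec mulr0 addr0 /tensor [RHS](bigD1 i)//= /ftupd eqxx; congr (_ * _).
  by apply: eq_bigr => j /negbTE ->.
by apply/funext => t; exact: tensor_line.
Qed.

Lemma ccont_tensor F : (forall j, csmooth (F j)) -> ccont (tensor F).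
Proof.
move=> cF; rewrite /tensor; elim: (index_enum _) => [|i r IH].
  rewrite (_ : (fun _ => _) = fun=> 1); first exact: ccont_cst.
  by apply/funext => x; rewrite big_nil.
rewrite (_ : (fun _ => _) = fun x : 'rV[R]_p => F i (x 0 i) * \prod_(j <- r) F j (x 0 j)).
  apply: ccontM => //; have [c1 c2] := cF i; split.
  - exact: (continuousT_comp (@continuous_coord R p i) (cinf_continuous c1)).
  - exact: (continuousT_comp (@continuous_coord R p i) (cinf_continuous c2)).
by apply/funext => x; rewrite big_cons.
Qed.

Lemma dseq_tensor s F : (forall j, csmooth (F j)) ->
  dseq s (tensor F) = tensor (fun j => iter (count_mem j s) cder (F j)).
Proof.
move=> cF; elim: s => //= i s ->.
rewrite partial_tensor => [|j]; last exact: csmooth_iter_cder.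
congr tensor; apply/funext => j; rewrite /ftupd eq_sym.
by have [->|] := eqVneq j i.
Qed.

Lemma smooth_tensor F : (forall j, csmooth (F j)) -> smooth (tensor F).
Proof.
move=> cF; apply/smoothP => s; rewrite dseq_tensor//.
have cF' j : csmooth (iter (count_mem j s) cder (F j)).
  exact: csmooth_iter_cder.
by split; [exact: ccont_tensor|exact: cdiffn_tensor].
Qed.

Definition mseq (alpha : mindex p) : seq 'I_p :=
  flatten [seq nseq (alpha i) i | i <- enum 'I_p].

Lemma pderivE alpha f : pderiv alpha f = dseq (mseq alpha) f.
Proof.
rewrite /pderiv /mseq /dseq; elim: (enum 'I_p) => //= i r ->.
by rewrite foldr_cat; elim: (alpha i) => //= k ->.
Qed.

Lemma count_mseq (alpha : mindex p) j : count_mem j (mseq alpha) = alpha j.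
Proof.
rewrite /mseq count_flatten -map_comp sumnE big_map big_enum /=.
rewrite (bigD1 j)//= count_nseq /= eqxx mul1n big1 ?addn0// => i ij.
by rewrite count_nseq /= (negbTE ij).
Qed.

Definition mcount s : mindex p := [ffun j => count_mem j s].

Let le_ord : rel 'I_p := fun i j => (i <= j)%N.

Lemma sorted_mseq alpha : sorted le_ord (mseq alpha).
Proof.
rewrite /mseq.
have : sorted le_ord (enum 'I_p).
  by have := iota_sorted 0 p; rewrite -val_enum_ord sorted_map.
elim: (enum 'I_p) => //= i r IH ir.
have le_trans_ord : transitive le_ord by move=> ? ? ?; exact: leq_trans.
have := IH (path_sorted ir).
move: ir; rewrite (path_sortedE le_trans_ord) => /andP[/allP ir _] sr.
elim: (alpha i) => //= k; rewrite (path_sortedE le_trans_ord) => -> /=.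
rewrite andbT all_cat all_nseq /le_ord leqnn orbT /=.
apply/allP => j /flattenP[_ /mapP[l lr ->]]; rewrite mem_nseq => /andP[_ /eqP ->].
exact: ir.
Qed.

(** [pderiv] differentiates in one fixed order; a sorted word is determined by its multiplicities
    and so coincides with the word of the multi-index. *)
Lemma pderiv_mcount s f : sorted le_ord s -> dseq s f = pderiv (mcount s) f.
Proof.
move=> ss; rewrite pderivE; congr dseq.
apply: (sorted_eq (leT := le_ord)) => //.
- by move=> ? ? ?; exact: leq_trans.
- by move=> i j /andP[ij ji]; apply/val_inj/anti_leq/andP.
- exact: sorted_mseq.
- apply/allP => j _ /=; rewrite count_mseq ffunE eqxx//.
Qed.

Lemma splits_subseq s q : q \in splits s -> subseq q.1 s /\ subseq q.2 s.
Proof.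
elim: s q => [|i s IH] q /=; first by rewrite inE => /eqP ->.
rewrite mem_cat => /orP[|] /mapP[q' /IH[s1 s2] ->] /=; rewrite ?eqxx; split => //;
  exact: subseq_trans (subseq_cons _ _).
Qed.

(** Both words of a Leibniz term are subwords of the sorted word [mseq alpha], hence sorted: the
    factors are again derivatives by multi-indices, to which the bounds on nets apply. *)
Lemma dseq_splits alpha q f : q \in splits (mseq alpha) ->
  dseq q.1 f = pderiv (mcount q.1) f /\ dseq q.2 f = pderiv (mcount q.2) f.
Proof.
have tr : transitive le_ord by move=> ? ? ?; exact: leq_trans.
move=> /splits_subseq[s1 s2]; split; apply: pderiv_mcount.
- exact: (subseq_sorted tr s1 (sorted_mseq alpha)).
- exact: (subseq_sorted tr s2 (sorted_mseq alpha)).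
Qed.

Lemma pderiv_tensor alpha F : (forall j, csmooth (F j)) ->
  pderiv alpha (tensor F) = tensor (fun j => iter (alpha j) cder (F j)).
Proof.
move=> cF; rewrite pderivE dseq_tensor//.
by congr tensor; apply/funext => j; rewrite count_mseq.
Qed.

End partial_calculus.

(** * Fourier inversion by a concentrating kernel *)

Section kernel1.
Context {R : realType}.
Local Notation leb := (@lebesgue_measure R).
Local Notation Re := (@complex.Re R).
Local Notation Im := (@complex.Im R).

Lemma sin_le_id (v : R) : 0 <= v -> `|sin v| <= v.
Proof.
move=> v0.
have [|c _] := @MVT_segment R (@sin R) (@cos R) 0 v v0 (fun x _ => is_derive_sin x).
  exact/continuous_subspaceT/continuous_sin.
rewrite sin0 !subr0 => ->; rewrite normrM (ger0_norm v0) ler_piMl// cos_max//.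
Qed.

Lemma cos_lbound (u : R) : 1 - u ^+ 2 / 2 <= cos u.
Proof.
have -> : cos u = 1 - 2 * sin (`|u| / 2) ^+ 2.
  rewrite -cos_norm {1}(_ : `|u| = (`|u| / 2) *+ 2); last first.
    by rewrite mulr2n; field.
  by rewrite cos_mulr2n cos2sin2 mulr2n; ring.
have := @sin_le_id (`|u| / 2) (divr_ge0 (normr_ge0 _) (ler0n _ _)).
rewrite -(real_normK (num_real u)) -(real_normK (num_real (sin _))).
move: (normr_ge0 (sin (`|u| / 2))) (normr_ge0 u).
move: (`|sin _|) => s; move: `|u| => v s0 v0 sv; nra.
Qed.

Lemma bernoulli_ge (y : R) k : -1 <= y -> 1 + k%:R * y <= (1 + y) ^+ k.
Proof.
move=> y1; elim: k => [|k IH]; first by rewrite mul0r addr0 expr0.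
rewrite exprS (@le_trans _ _ ((1 + y) * (1 + k%:R * y)))//; last first.
  by rewrite ler_wpM2l//; lra.
have k0 : (0 : R) <= k%:R by exact: ler0n.
rewrite -natr1; nra.
Qed.

(** Used with exponent [m ^ 2]: the kernel then has width about [1/m], mass at least [1/m] near 0,
    and Fourier coefficients that are nonnegative and at most [1/m]. The match between mass and
    largest coefficient is what makes the inversion work. *)
Definition qk (m : nat) (t : R) : R := ((1 + cos t) / 2) ^+ m.

Lemma qk_ge0 m t : 0 <= qk m t.
Proof. by rewrite exprn_ge0// divr_ge0//; have := cos_geN1 t; lra. Qed.

Lemma qk_le1 m t : qk m t <= 1.
Proof.
by rewrite exprn_ile1//; have := cos_le1 t; have := cos_geN1 t; lra.
Qed.

(** Bernoulli's inequality gives [(1 - t^2/4)^(m^2) >= 1 - m^2 t^2/4 >= 3/4]. *)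
Lemma qk_lower m t : (0 < m)%N -> `|t| <= m%:R^-1 -> 2^-1 <= qk (m ^ 2) t.
Proof.
move=> m0 tm; have mR : (0 : R) < m%:R by rewrite ltr0n.
have t2 : t ^+ 2 <= m%:R ^- 2.
  by rewrite -(real_normK (num_real t)) -exprVn lerXn2r ?nnegrE// invr_ge0 ltW.
have t1 : t ^+ 2 <= 1.
  rewrite (le_trans t2)// invf_le1 ?exprn_gt0// exprn_ege1// ler1n//.
have c := cos_lbound t.
have := @bernoulli_ge (- (t ^+ 2 / 4)) (m ^ 2).
rewrite natrX => H; apply: le_trans (le_trans (H _) _).
- have : m%:R ^+ 2 * t ^+ 2 <= 1 by rewrite -ler_pdivlMl ?exprn_gt0// mulr1.
  lra.
- lra.
- rewrite /qk; apply: lerXn2r; rewrite ?nnegrE; [lra| |lra].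
  by have := cos_geN1 t; lra.
Qed.

(** With [th = (1 - cos d)/2] and [M = m^2], the inequalities [(1 - th)^M (1 + M th) <= (1 - th^2)^M
    <= 1] give a tail of order [m^-2], one power of [m] below the mass near 0. *)
Lemma qk_upper m (d t : R) : 0 < d -> d <= `|t| -> `|t| <= 1 -> (0 < m)%N ->
  qk (m ^ 2) t <= 2 / (1 - cos d) / m%:R ^+ 2.
Proof.
move=> d0 dt t1 m0; have mR : (0 : R) < m%:R by rewrite ltr0n.
have p1 : (1 : R) <= pi by have := @pi_ge2 R; lra.
have ct : cos t <= cos d.
  rewrite -(cos_norm t) leNgt ltr_cos ?in_itv /= -?leNgt//.
  - by apply/andP; split; lra.
  - by apply/andP; split; lra.
have cd : cos d < 1.
  rewrite -[X in _ < X]cos0 ltr_cos// in_itv /= ?lexx ?pi_ge0//.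
  by apply/andP; split; lra.
pose th := (1 - cos d) / 2.
have th0 : 0 < th by rewrite divr_gt0// subr_gt0.
have cdN := cos_geN1 d.
have th1 : th <= 1 by rewrite /th; lra.
apply: (@le_trans _ _ ((1 - th) ^+ (m ^ 2))).
  have cN := cos_geN1 t.
  by rewrite /qk lerXn2r ?nnegrE// /th; lra.
have H : (1 - th) ^+ (m ^ 2) * (1 + (m ^ 2)%:R * th) <= 1.
  apply: (@le_trans _ _ ((1 - th) ^+ (m ^ 2) * (1 + th) ^+ (m ^ 2))).
    rewrite ler_wpM2l ?exprn_ge0//; first lra.
    by apply: bernoulli_ge; lra.
  rewrite -exprMn exprn_ile1//; nra.
have mth : 0 < (m ^ 2)%:R * th by rewrite mulr_gt0// ltr0n expn_gt0 m0.
rewrite -(ler_pM2r mth) (_ : _ / _ / _ * _ = 1); last first.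
  by rewrite natrX /th; field; rewrite ?lt0r_neq0//; lra.
apply: le_trans H; rewrite ler_wpM2l ?exprn_ge0//; lra.
Qed.

Lemma central_bin_max n j : ('C(n.*2, j) <= 'C(n.*2, n))%N.
Proof.
have up k : (k < n)%N -> ('C(n.*2, k) <= 'C(n.*2, k.+1))%N.
  move=> kn; rewrite -(@leq_pmul2l k.+1)// mul_bin_left leq_mul2r -addnn.
  by apply/orP; right; lia.
have low k : (k <= n)%N -> ('C(n.*2, k) <= 'C(n.*2, n))%N.
  move=> kn; rewrite -(subKn kn); elim: (n - k)%N => [|i IH].
    by rewrite subn0.
  apply: leq_trans IH; have [ni|ni] := leqP n i.
    by rewrite (_ : (n - i.+1 = n - i)%N)//; lia.
  by rewrite (_ : (n - i = (n - i.+1).+1)%N) ?up//; lia.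
have [jn|nj] := leqP j n; first exact: low.
have [jn|jn] := leqP j n.*2; last by rewrite bin_small.
by rewrite -(bin_sub jn) low//; rewrite -addnn; lia.
Qed.

Definition cb (n : nat) : R := 'C(n.*2, n)%:R / 4 ^+ n.

Lemma cb_ge0 n : 0 <= cb n.
Proof. by rewrite divr_ge0// exprn_ge0. Qed.

Lemma cbS n : cb n.+1 = cb n * ((n.*2.+1)%:R / (n.*2.+2)%:R).
Proof.
have H : (('C(n.+1.*2, n.+1) * n.*2.+2) = 4 * ('C(n.*2, n) * n.*2.+1))%N.
  have f1 := @bin_fact n.+1.*2 n.+1; have f2 := @bin_fact n.*2 n.
  have e1 : (n.+1.*2 - n.+1 = n.+1)%N by rewrite -addnn; lia.
  have e2 : (n.*2 - n = n)%N by rewrite -addnn; lia.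
  rewrite e1 in f1; rewrite e2 in f2.
  have {}f1 := f1 (leq_trans (leqnSn _) _); have {}f2 := f2 _.
  have F0 := fact_gt0 n.
  move: f1 f2; rewrite doubleS !factS -!mul2n => f1 f2.
  apply/eqP; rewrite -(eqn_pmul2r (_ : 0 < n`! * n`! * n.+1)%N) ?muln_gt0 ?F0//.
  apply/eqP.
  have {}f1 : ('C((2 * n).+2, n.+1) * (n.+1 * n`! * (n.+1 * n`!)) =
               (2 * n).+2 * ((2 * n).+1 * (2 * n)`!))%N by apply: f1; lia.
  have {}f2 : ('C(2 * n, n) * (n`! * n`!) = (2 * n)`!)%N by apply: f2; lia.
  move: f1; rewrite -f2; move: 'C(_, n.+1) 'C(_, n) n`! => a b f; lia.
rewrite /cb exprS; have := congr1 (fun k => k%:R : R) H; rewrite !natrM => H'.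
have n0 : (n.*2.+2)%:R != 0 :> R by rewrite pnatr_eq0.
have f0 : (4 : R) ^+ n != 0 by rewrite expf_neq0.
have -> : 'C(n.+1.*2, n.+1)%:R = 4 * ('C(n.*2, n)%:R * n.*2.+1%:R) / n.*2.+2%:R :> R.
  by rewrite -H' mulfK.
by field; rewrite f0 -natrD pnatr_eq0.
Qed.

(** The factor [2n + 1] closes the induction, because [(2n+1)(2n+3) <= (2n+2)^2]. It gives the decay
    of order [n^(-1/2)] of the central binomial without Stirling's formula. *)
Lemma cb_sqr n : cb n ^+ 2 * (n.*2.+1)%:R <= 1.
Proof.
elim: n => [|n IH]; first by rewrite /cb bin0 expr0 divr1 expr1n mulr1.
rewrite cbS exprMn doubleS; apply: le_trans IH; rewrite -mulrA ler_wpM2l ?sqr_ge0//.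
rewrite exprMn exprVn mulrAC ler_pdivrMr ?exprn_gt0// -!natrX -!natrM ler_nat.
by rewrite !expnS !expn0 !muln1; nia.
Qed.

Lemma cb_le m : (0 < m)%N -> cb (m ^ 2) <= m%:R^-1.
Proof.
move=> m0; have mR : (0 : R) < m%:R by rewrite ltr0n.
rewrite -(@ler_pXn2r _ 2) ?nnegrE ?cb_ge0 ?invr_ge0 ?ler0n//.
rewrite exprVn -[leRHS]mul1r ler_pdivlMr ?exprn_gt0//.
apply: le_trans (cb_sqr (m ^ 2)); rewrite ler_wpM2l ?sqr_ge0//.
by rewrite -natrX ler_nat -addnn; lia.
Qed.

Lemma expiD (s t : R) : expi (s + t) = expi s * expi t.
Proof. by apply: eq_ReIm; rewrite ?cReM ?cImM /= ?cosD ?sinD//; ring. Qed.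

Lemma expi0 : expi 0 = 1 :> R[i].
Proof. by rewrite /expi cos0 sin0. Qed.

Lemma normc_expi (t : R) : complex.ComplexField.Normc.normc (expi t) = 1.
Proof. by rewrite /= cos2Dsin2 sqrtr1. Qed.

Lemma expi_nat k (t : R) : expi t ^+ k = expi (k%:R * t).
Proof.
elim: k => [|k IH]; first by rewrite expr0 mul0r expi0.
by rewrite exprS IH -expiD -natr1 mulrDl mul1r addrC.
Qed.

(** Since [(1 + e^(it))^2 = 4 e^(it) (1 + cos t)/2], the kernel is [(1 + e^(it))^(2m)] up to the
    factor [4^-m e^(-imt)]; expand by the binomial formula. *)
Lemma qk_fourier m t : (qk m t)%:C =
  \sum_(j < m.*2.+1) ('C(m.*2, j)%:R / 4 ^+ m)%:C * expi ((j%:R - m%:R) * t).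
Proof.
have H : (1 + expi t) ^+ m.*2 = expi (m%:R * t) * (4 ^+ m)%:C * (qk m t)%:C.
  rewrite -mul2n exprM /qk; elim: m => [|m IH].
    by rewrite !expr0 mul0r expi0 !mulr1.
  rewrite (_ : m.+1%:R * t = m%:R * t + t); last by rewrite -natr1; ring.
  rewrite exprS IH expiD [4 ^+ m.+1]exprS [(_ / 2) ^+ m.+1]exprS.
  rewrite (_ : (1 + expi t) ^+ 2 = expi t * 4%:C * ((1 + cos t) / 2)%:C).
    by rewrite !rmorphM /=; ring.
  have c2 : sin t ^+ 2 = 1 - cos t ^+ 2 by rewrite sin2cos2.
  rewrite expr2; apply: eq_ReIm; rewrite ?cReM ?cImM ?cReD ?cImD ?cReM ?cImM ?cReD ?cImD /=.
    transitivity ((1 + cos t) ^+ 2 - sin t ^+ 2); first by ring.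
    by rewrite c2; field.
  by field.
have E : (qk m t)%:C = ((4 ^+ m)^-1)%:C * (expi (- (m%:R * t)) * (1 + expi t) ^+ m.*2).
  have f0 : (4 : R) ^+ m != 0 by rewrite expf_neq0.
  rewrite H; transitivity (((4 ^+ m)^-1 * 4 ^+ m)%:C *
    (expi (- (m%:R * t)) * expi (m%:R * t)) * (qk m t)%:C).
    by rewrite -expiD addNr expi0 mulVf// rmorph1 !mul1r.
  by rewrite rmorphM /=; ring.
rewrite E (@exprDn _ 1 (expi t)) mulrA mulr_sumr; apply: eq_bigr => j _.
rewrite expr1n mul1r expi_nat -mulr_natl rmorphM /= rmorph_nat.
rewrite mulrBl expiD; ring.
Qed.

Lemma sum_oneDsqrV M :
  \sum_(j < M.*2.+1) (oneDsqr (j%:R - M%:R : R))^-1 <= 6.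
Proof.
(* The term of index [N + 2] is at most [1/(N+1) - 1/(N+2)], so the sum telescopes. *)
have half N : \sum_(i < N.+2) (oneDsqr (i%:R : R))^-1 <= 3 - N.+1%:R^-1.
  elim: N => [|N IH].
    rewrite !big_ord_recr big_ord0 /= /oneDsqr expr0n expr1n /= addr0 !invr1.
    by rewrite (_ : (1 + 1)^-1 = 2^-1 :> R) ?natr1//; lra.
  rewrite big_ord_recr /= (le_trans (lerD IH (lexx _)))//.
  have N0 : (0 : R) <= N%:R by exact: ler0n.
  have -> : oneDsqr (N.+2%:R) = 1 + (N%:R + 2) ^+ 2 :> R by rewrite -addn2 natrD.
  have -> : N.+1%:R = N%:R + 1 :> R by rewrite natr1.
  have -> : N.+2%:R = N%:R + 2 :> R by rewrite -addn2 natrD.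
  have h1 : (1 + (N%:R + 2) ^+ 2)^-1 <= ((N%:R + 1) * (N%:R + 2))^-1 :> R.
    by rewrite lef_pV2 ?posrE; nra.
  have h2 : ((N%:R + 1) * (N%:R + 2))^-1 = (N%:R + 1)^-1 - (N%:R + 2)^-1 :> R.
    by field; rewrite !lt0r_neq0//; lra.
  by move: h1; rewrite h2; lra.
have half' N : \sum_(i < N) (oneDsqr (i%:R : R))^-1 <= 3.
  case: N => [|[|N]]; first by rewrite big_ord0.
    by rewrite big_ord1 /oneDsqr expr0n /= addr0 invr1; lra.
  by rewrite (le_trans (half N))// lerBlDr lerDl invr_ge0.
have E (g : R -> R) : (forall x, g (- x) = g x) ->
  \sum_(j < M.*2.+1) g (j%:R - M%:R) =
  \sum_(i < M.+1) g i%:R + \sum_(i < M.+1) g i%:R - g 0.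
  move=> gN; elim: M => [|M IH].
    by rewrite !big_ord1 subr0 addrK.
  rewrite doubleS big_ord_recl big_ord_recr /=.
  under eq_bigr => i _.
    rewrite -!natr1 opprD addrACA subrr addr0; over.
  rewrite IH !(big_ord_recr M.+1) /=.
  rewrite sub0r gN -addnn.
  rewrite (_ : (M + M).+2%:R - M.+1%:R = M.+1%:R :> R); last first.
    by rewrite -!natr1 natrD; ring.
  ring.
rewrite (E (fun x => (oneDsqr x)^-1)); last by move=> x; rewrite /oneDsqr sqrrN.
have := half' M.+1; have : 0 <= (oneDsqr (0 : R))^-1 by exact/ltW/oneDsqrV_gt0.
lra.
Qed.

End kernel1.

Section concentration_of_kernel.
Context {R : realType}.
Local Notation leb := (@lebesgue_measure R).
Local Notation Re := (@complex.Re R).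
Local Notation Im := (@complex.Im R).
Local Notation normc := (@complex.ComplexField.Normc.normc R).

Lemma IR_tensor n (g : 'I_n -> R -> R) (D : 'I_n -> R) :
  (forall j, measurable_fun setT (g j)) ->
  (forall j t, `|g j t| <= D j * (oneDsqr t)^-1) ->
  tame (fun x : 'rV[R]_n => \prod_j g j (x 0 j)) /\
  IR (fun x : 'rV[R]_n => \prod_j g j (x 0 j)) = \prod_j \int[leb]_t g j t.
Proof.
elim: n g D => [|n IH] g D mg gD.
all: have tg : tame (fun x : 'rV[R]__ => \prod_j g j (x 0 j)).
1,3: split; first exact: measurable_tensor.
1,2: exists (\prod_j D j) => x; rewrite normr_prod /omega -big_split /=.
1,2: by apply: ler_prod => j _; rewrite normr_ge0 gD.
all: split => //.
  rewrite big_ord0 /IR /Rintegral /=.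
  under eq_integral do rewrite big_ord0.
  by rewrite integral_dirac// diracT mul1e.
have [tI HI] := IH (fun j => g (lift ord0 j)) (fun j => D (lift ord0 j))
  (fun j => mg _) (fun j => gD _).
rewrite IR_S// big_ord_recl -HI -RintegralZr//; last first.
  exact: (integrable_dom1 (mg ord0) (gD ord0)).
apply: eq_Rintegral => t _; rewrite -IRZ//; apply: eq_IR => s.
rewrite big_ord_recl vcons0; congr (_ * _).
by apply: eq_bigr => j _; rewrite vconsS.
Qed.

(** The cut at a small [d] carries the mass near [x], the cut at 1 that of the whole cube;
    [concentration] compares the two. *)
Definition qcut (m : nat) (d x t : R) : R :=
  if `|t - x| <= d then qk (m ^ 2) (t - x) else 0.

Lemma continuous_subr (x : R) : continuous (fun t : R => t - x).
Proof. by move=> t; apply: cvgB; [exact: cvg_id|exact: cvg_cst]. Qed.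

Lemma continuous_qk m (x : R) : continuous (fun t : R => qk m (t - x)).
Proof.
apply: (continuousT_comp (@continuous_subr x)); apply: cinf_continuous.
rewrite (_ : qk m = fun t => (2^-1 * (1 + cos t)) ^+ m).
  apply/cinfX/cinfZ/cinfD; [exact: cinf_cst|exact: cinf_trig.1].
by apply/funext => t; rewrite /qk mulrC.
Qed.

Lemma measurable_qcut m d x : measurable_fun setT (qcut m d x).
Proof.
rewrite /qcut; apply: measurable_fun_ifT => //.
- apply: measurable_fun_ler => //; apply: continuous_measurable_fun.
  apply: (continuousT_comp (@continuous_subr x)); exact: norm_continuous.
- apply: continuous_measurable_fun; exact: (@continuous_qk (m ^ 2) x).
Qed.

Lemma qcut_dom m d x t : d <= 1 ->
  `|qcut m d x t| <= oneDsqr (`|x| + 1) * (oneDsqr t)^-1.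
Proof.
move=> d1; rewrite ler_pdivlMr ?(lt_le_trans ltr01 (oneDsqr_ge1 t))//.
rewrite /qcut; case: ifPn => [tx|_]; last first.
  by rewrite normr0 mul0r (le_trans ler01)// oneDsqr_ge1.
have t0 : 0 <= oneDsqr t by rewrite (le_trans ler01)// oneDsqr_ge1.
rewrite ger0_norm ?qk_ge0// (le_trans (ler_piMl t0 (qk_le1 _ _)))//.
rewrite lerD2l -(real_normK (num_real t)) lerXn2r ?nnegrE ?addr_ge0//.
rewrite -{1}(subrK x t) (le_trans (ler_normD _ _))// addrC lerD2l.
exact: le_trans tx d1.
Qed.

Lemma integrable_qcut m d x : d <= 1 -> leb.-integrable setT (EFin \o qcut m d x).
Proof.
move=> d1; apply: (integrable_dom1 (measurable_qcut m d x)).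
by move=> t; exact: qcut_dom.
Qed.

Lemma Rintegral_itv_cst (a b c : R) : a <= b ->
  \int[leb]_t (if a <= t <= b then c else 0) = c * (b - a).
Proof.
move=> ab; rewrite (_ : (fun t => _) = (fun=> c) \_ `[a, b]); last first.
  apply/funext => t; rewrite /patch; congr (if _ then _ else _).
  by apply/idP/idP; rewrite inE /= in_itv.
rewrite -Rintegral_mkcond Rintegral_cst//= lebesgue_measure_itv /= lte_fin.
by case: ltgtP ab => //= -> _; rewrite subrr.
Qed.

Lemma integrable_itv_cst (a b c : R) :
  leb.-integrable setT (EFin \o (fun t => if a <= t <= b then c else 0)).
Proof.
apply: (@integrable_dom1 _ _ (`|c| * oneDsqr (`|a| + `|b|))).
  apply: measurable_fun_ifT => //; apply: measurable_and.
    exact: measurable_fun_ler.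
  exact: measurable_fun_ler.
move=> t; rewrite ler_pdivlMr ?(lt_le_trans ltr01 (oneDsqr_ge1 t))//.
case: ifPn => [tx|_]; last by rewrite normr0 mul0r mulr_ge0// (le_trans ler01)// oneDsqr_ge1.
rewrite ler_wpM2l// lerD2l -(real_normK (num_real t)) lerXn2r ?nnegrE ?addr_ge0//.
rewrite ler_norml; have := ler_norm b; have := ler_norm (- a); rewrite normrN.
have := normr_ge0 a; have := normr_ge0 b; move: tx => /andP[]; lra.
Qed.

Lemma qcut_lower m d x : (0 < m)%N -> m%:R^-1 <= d -> d <= 1 ->
  m%:R^-1 <= \int[leb]_t qcut m d x t.
Proof.
move=> m0 md d1; have mR : (0 : R) < m%:R^-1 by rewrite invr_gt0 ltr0n.
have -> : m%:R^-1 = \int[leb]_t (if x - m%:R^-1 <= t <= x + m%:R^-1 then 2^-1 else 0 : R).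
  by rewrite Rintegral_itv_cst; [field; rewrite pnatr_eq0; lia|lra].
apply: le_Rintegral => // [||t _].
- exact: integrable_itv_cst.
- exact: integrable_qcut.
- rewrite -ler_distlC distrC /qcut; case: ifPn => tm.
    by rewrite ifT ?qk_lower// (le_trans tm).
  by case: ifP => // _; exact: qk_ge0.
Qed.

Lemma qcut_upper m d x : (0 < m)%N -> 0 < d -> d <= 1 ->
  \int[leb]_t qcut m 1 x t <=
  \int[leb]_t qcut m d x t + 4 / (1 - cos d) / m%:R ^+ 2.
Proof.
(* [c] is the bound of [qk_upper] for [d <= |t - x| <= 1]; spread over an interval of length 2 it
   produces the constant 4. *)
move=> m0 d0 d1; set c := 2 / (1 - cos d) / m%:R ^+ 2.
have -> : 4 / (1 - cos d) / m%:R ^+ 2 =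
    \int[leb]_t (if x - 1 <= t <= x + 1 then c else 0 : R).
  by rewrite Rintegral_itv_cst /c; [ring|lra].
rewrite -RintegralD//; last 2 first.
- exact: integrable_qcut.
- exact: integrable_itv_cst.
apply: le_Rintegral => // [||t _].
- exact: integrable_qcut.
- exact: (integrableD measurableT (integrable_qcut m x d1)
    (integrable_itv_cst (x - 1) (x + 1) c)).
have c0 : 0 <= c.
  by rewrite !mulr_ge0 ?invr_ge0 ?exprn_ge0 ?subr_ge0 ?cos_le1.
rewrite -ler_distlC distrC /qcut.
have [td|td] := leP `|t - x| d.
  rewrite (le_trans td d1) lerDl//.
rewrite add0r; case: ifP => // t1; apply: qk_upper => //; exact: ltW.
Qed.

(** By contradiction. Near [x] the function exceeds [K x - eta], elsewhere it is at least [- S], and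
    the kernel mass outside the small cube is a small fraction of the mass [P >= m^-n] inside. The
    hypothesis then forces [K x - eta - eta/2 <= B], whereas [K x - B = 2 eta]. *)
Lemma concentration n (K : 'rV[R]_n -> R) (x : 'rV[R]_n) (B : R) :
  continuous K -> (forall y : 'rV[R]_n, (exists j, 1 < `|y 0 j - x 0 j|) -> K y = 0) ->
  0 <= B ->
  (forall m, (0 < m)%N ->
     IR (fun y : 'rV[R]_n => K y * \prod_j qk (m ^ 2) (y 0 j - x 0 j)) <= B * m%:R^-1 ^+ n) ->
  K x <= B.
Proof.
move=> cK K0 B0 HB; rewrite leNgt; apply/negP => BK.
pose eta := (K x - B) / 2; have eta0 : 0 < eta by rewrite divr_gt0// subr_gt0.
have [d [d0 d1 Hd]] : exists d : R, [/\ 0 < d, d <= 1 &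
    forall y : 'rV[R]_n, (forall j, `|y 0 j - x 0 j| <= d) -> K x - eta <= K y].
  have /nbhs_ballP[e /= e0 He] : nbhs x (K @^-1` [set r | K x - eta < r]).
    apply: cK; apply: (@cvgr_gt _ _ (nbhs (K x)) _ id (K x) cvg_id).
    by rewrite ltrBlDr ltrDl.
  exists (Num.min (e / 2) 1); split; first by rewrite lt_min divr_gt0/=.
    by rewrite ge_min lexx orbT.
  move=> y Hy; apply/ltW/He; split => // i j; rewrite ord1 /ball /= distrC.
  apply: le_lt_trans (Hy j) _.
  by rewrite gt_min ltr_pdivrMr// ltr_pMr// ltr1n.
have [S HS] : exists S, forall y, `|K y| <= S.
  have [S HS] := bounded_on_box (1 + \sum_j `|x 0 j|) cK.
  exists (Num.max S 0) => y.
  have [H|/existsNP[j /negP]] := pselect (forall j, `|y 0 j - x 0 j| <= 1).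
    rewrite le_max HS// => j; rewrite -(subrK (x 0 j) (y 0 j)).
    rewrite (le_trans (ler_normD _ _))// lerD// (bigD1 j)//= lerDl sumr_ge0//.
  by rewrite -ltNge => Hj; rewrite K0; [rewrite normr0 le_max lexx orbT|exists j].
have S0 : 0 <= S by exact: le_trans (HS x).
(* [e] is the relative excess of kernel mass tolerated in each coordinate; over [n] coordinates the
   excess is [(1 + e)^n - 1], weighted by the sup bound [S]. *)
have [e [e0 He]] : exists e : R, 0 < e /\ S * ((1 + e) ^+ n - 1) <= eta / 2.
  have cp : (fun e : R => S * ((1 + e) ^+ n - 1)) @ nbhs (0 : R) --> S * ((1 + 0) ^+ n - 1).
    apply: cvgMr; apply: cvgB; last exact: cvg_cst.
    apply: (@continuous_comp _ _ _ (fun e : R => 1 + e) (fun u => u ^+ n));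
      last exact: exprn_continuous.
    by apply: cvgD; [exact: cvg_cst|exact: cvg_id].
  have : S * ((1 + 0) ^+ n - 1) < eta / 2.
    by rewrite addr0 expr1n subrr mulr0 divr_gt0.
  move=> /(cvgr_lt _ cp) /nbhs_ballP[r /= r0 Hr].
  exists (r / 2); split; first by rewrite divr_gt0.
  apply/ltW/Hr; rewrite /ball /= sub0r normrN gtr0_norm ?divr_gt0//.
  by rewrite ltr_pdivrMr// ltr_pMr// ltr1n.
have cd : cos d < 1.
  have p1 : (1 : R) <= pi by have := @pi_ge2 R; lra.
  rewrite -[X in _ < X]cos0 ltr_cos// in_itv /= ?lexx ?pi_ge0//.
  by apply/andP; split; lra.
have [m [m0 md me]] : exists m : nat, [/\ (0 < m)%N, m%:R^-1 <= d &
    4 / (1 - cos d) / m%:R <= e].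
  (* The two summands are the lower bounds on [m] that make [1/m <= d] and make the tail at most [e]
     times the mass [1/m]. *)
  pose a := d^-1 + 4 / (1 - cos d) / e.
  have b0 : 0 <= 4 / (1 - cos d) by rewrite divr_ge0// subr_ge0 ltW.
  exists (Num.bound a).+1; split => //.
    rewrite -[leRHS]invrK lef_pV2 ?posrE ?invr_gt0// (@le_trans _ _ a)//.
      by rewrite lerDl divr_ge0// ltW.
    by rewrite (le_trans (ltW (archi_boundP _)))// ?ler_nat// addr_ge0 ?divr_ge0 ?invr_ge0// ltW.
  rewrite ler_pdivrMr ?ltr0n// -ler_pdivrMl// mulrC (@le_trans _ _ a)//.
    by rewrite lerDr invr_ge0 ltW.
  by rewrite (le_trans (ltW (archi_boundP _)))// ?ler_nat// addr_ge0 ?divr_ge0 ?invr_ge0// ltW.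
pose G d (y : 'rV[R]_n) := \prod_j qcut m d (x 0 j) (y 0 j).
pose w j := \int[leb]_t qcut m d (x 0 j) t.
have [tG1 IG1] := IR_tensor (fun j => measurable_qcut m d (x 0 j))
  (fun j t => @qcut_dom m d (x 0 j) t d1).
have [tG2 IG2] := IR_tensor (fun j => measurable_qcut m 1 (x 0 j))
  (fun j t => @qcut_dom m 1 (x 0 j) t (lexx _)).
have mR : (0 : R) < m%:R^-1 by rewrite invr_gt0 ltr0n.
have w0 j : m%:R^-1 <= w j by exact: qcut_lower.
have W0 : m%:R^-1 ^+ n <= \prod_j w j.
  rewrite -[n in X in X <= _]card_ord -prodr_const.
  by apply: ler_prod => j _; rewrite w0 andbT ltW.
have W2 : IR (G 1) <= (1 + e) ^+ n * \prod_j w j.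
  rewrite IG2 -[n in X in X * _]card_ord -prodr_const -big_split /=.
  apply: ler_prod => j _; apply/andP; split.
    apply: Rintegral_ge0 => t _; rewrite /qcut; case: ifP => // _; exact: qk_ge0.
  apply: le_trans (qcut_upper _ m0 d0 d1) _.
  rewrite -/(w j) [leRHS]mulrDl mul1r lerD2l expr2 invfM mulrA.
  by apply: ler_pM => //; rewrite ?divr_ge0// ?subr_ge0 ltW// ltW.
pose Q (y : 'rV[R]_n) := K y * \prod_j qk (m ^ 2) (y 0 j - x 0 j).
have tQ : tame Q.
  apply: (@tame_compact _ _ _ (1 + \sum_j `|x 0 j|)).
    apply: continuousR_mul => //.
    rewrite /index_enum; elim: (Finite.enum _) => [|j r IH].
      rewrite (_ : (fun _ => _) = fun=> 1); first exact: cst_continuous.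
      by apply/funext => y; rewrite big_nil.
    rewrite (_ : (fun _ => _) = fun y : 'rV[R]_n => qk (m ^ 2) (y 0 j - x 0 j) *
      \prod_(i <- r) qk (m ^ 2) (y 0 i - x 0 i)).
      apply: continuousR_mul => //.
      apply: (continuousT_comp (@continuous_coord R n j)
        (@continuous_qk (m ^ 2) (x 0 j))).
    by apply/funext => y; rewrite big_cons.
  move=> y [j Hj]; rewrite /Q K0 ?mul0r//; exists j.
  rewrite ltNge; apply: contraTN Hj => Hj; rewrite -leNgt.
  rewrite -(subrK (x 0 j) (y 0 j)) (le_trans (ler_normD _ _))// lerD//.
  by rewrite (bigD1 j)//= lerDl sumr_ge0.
(* Minorant of the integrand: [G 1 - G d] is the kernel on the cube minus the small cube, where only
   [K >= - S] is known. *)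
have Qge y : (K x - eta) * G d y + (- S * G 1 y + S * G d y) <= Q y.
  have [H|/existsNP[j /negP]] := pselect (forall j, `|y 0 j - x 0 j| <= d).
    have E : G d y = G 1 y.
      apply: eq_bigr => j _; rewrite /qcut H ifT//; exact: le_trans (H j) d1.
    have E' : G d y = \prod_j qk (m ^ 2) (y 0 j - x 0 j).
      by apply: eq_bigr => j _; rewrite /qcut H.
    rewrite -E mulNr addNr addr0 /Q -E' ler_wpM2r//; last exact: Hd.
    by rewrite E'; apply: prodr_ge0 => j _; exact: qk_ge0.
  rewrite -ltNge => Hj.
  have -> : G d y = 0.
    by apply/eqP/prodf_eq0; exists j => //; rewrite /qcut leNgt Hj.
  rewrite !mulr0 add0r addr0 mulNr.
  have Q0 (z : 'rV[R]_n) : 0 <= \prod_j qk (m ^ 2) (z 0 j - x 0 j).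
    by apply: prodr_ge0 => i _; exact: qk_ge0.
  have [H1|/existsNP[i /negP]] := pselect (forall j, `|y 0 j - x 0 j| <= 1).
    have -> : G 1 y = \prod_j qk (m ^ 2) (y 0 j - x 0 j).
      by apply: eq_bigr => i _; rewrite /qcut H1.
    rewrite -mulNr ler_wpM2r//.
    by have := HS y; rewrite ler_norml => /andP[].
  rewrite -ltNge => Hi; rewrite /Q K0; last by exists i.
  rewrite mul0r oppr_le0 mulr_ge0//; apply: prodr_ge0 => k _; rewrite /qcut.
  by case: ifP => // _; exact: qk_ge0.
have tS : tame (fun y => - S * G 1 y + S * G d y) by apply: tameD; exact: tameZ.
have := le_IR (tameD (tameZ (K x - eta) tG1) tS) tQ Qge.
rewrite (IRD (tameZ _ tG1) tS) (IRD (tameZ _ tG2) (tameZ _ tG1)).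
rewrite !IRZ// IG1 -/(G 1) => H; have {H} := le_trans H (HB m m0).
have P0 : 0 < \prod_j w j by rewrite (lt_le_trans _ W0)// exprn_gt0.
rewrite -/(w _); set P := \prod_j w j in W0 W2 P0 *.
have : S * IR (G 1) <= S * ((1 + e) ^+ n * P) by rewrite ler_wpM2l.
have : S * ((1 + e) ^+ n - 1) * P <= eta / 2 * P by rewrite ler_wpM2r// ltW.
have : B * m%:R^-1 ^+ n <= B * P by rewrite ler_wpM2l.
rewrite /eta; nra.
Qed.

End concentration_of_kernel.

(** * Complex integrals over cubes and the inversion estimate *)

Section complex_integral.
Context {R : realType} {n : nat}.
Local Notation Re := (@complex.Re R).
Local Notation Im := (@complex.Im R).
Local Notation normc := (@complex.ComplexField.Normc.normc R).
Implicit Types f g : 'rV[R]_n -> R[i].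

Definition ctame f : Prop := tame (Re \o f) /\ tame (Im \o f).

Lemma integralRnE f : integralRn f = IR (Re \o f) +i* IR (Im \o f).
Proof. by []. Qed.

Lemma eq_integralRn f g : f =1 g -> integralRn f = integralRn g.
Proof. by move=> /funext ->. Qed.

Lemma ctameD f g : ctame f -> ctame g -> ctame (fun x => f x + g x).
Proof.
move=> [f1 f2] [g1 g2]; split.
- rewrite (_ : _ \o _ = fun x => (Re \o f) x + (Re \o g) x); first exact: tameD.
  by apply/funext => x; exact: cReD.
- rewrite (_ : _ \o _ = fun x => (Im \o f) x + (Im \o g) x); first exact: tameD.
  by apply/funext => x; exact: cImD.
Qed.

Let ReZ c f : Re \o (fun x => c * f x) =
  fun x => Re c * (Re \o f) x + - Im c * (Im \o f) x.
Proof. by apply/funext => x; rewrite /= cReM mulNr. Qed.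

Let ImZ c f : Im \o (fun x => c * f x) =
  fun x => Re c * (Im \o f) x + Im c * (Re \o f) x.
Proof. by apply/funext => x; rewrite /= cImM. Qed.

Lemma ctameZ c f : ctame f -> ctame (fun x => c * f x).
Proof.
by move=> [f1 f2]; split; rewrite ?ReZ ?ImZ; apply: tameD; exact: tameZ.
Qed.

Lemma ctame0 : ctame (fun=> 0).
Proof. by split; exact: tame0. Qed.

Lemma integralRnD f g : ctame f -> ctame g ->
  integralRn (fun x => f x + g x) = integralRn f + integralRn g.
Proof.
move=> [f1 f2] [g1 g2]; apply: eq_ReIm; rewrite ?cReD ?cImD !integralRnE /=.
- by rewrite -(IRD f1 g1); apply: eq_IR => x; exact: cReD.
- by rewrite -(IRD f2 g2); apply: eq_IR => x; exact: cImD.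
Qed.

Lemma integralRnZ c f : ctame f ->
  integralRn (fun x => c * f x) = c * integralRn f.
Proof.
move=> [f1 f2]; apply: eq_ReIm; rewrite ?cReM ?cImM !integralRnE /=.
- rewrite ReZ (IRD (tameZ _ f1) (tameZ _ f2)) !IRZ//; ring.
- by rewrite ImZ (IRD (tameZ _ f2) (tameZ _ f1)) !IRZ.
Qed.

Lemma integralRn0 : integralRn (fun _ : 'rV[R]_n => 0) = 0.
Proof. by apply: eq_ReIm; rewrite integralRnE /= IR0. Qed.

Lemma ctame_sum (I : Type) (r : seq I) (F : I -> 'rV[R]_n -> R[i]) :
  (forall i, ctame (F i)) -> ctame (fun x => \sum_(i <- r) F i x).
Proof.
move=> tF; elim: r => [|i r IH].
  rewrite (_ : (fun _ => _) = fun=> 0); first exact: ctame0.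
  by apply/funext => x; rewrite big_nil.
rewrite (_ : (fun _ => _) = fun x => F i x + \sum_(j <- r) F j x).
  exact: ctameD.
by apply/funext => x; rewrite big_cons.
Qed.

Lemma integralRn_sum (I : Type) (r : seq I) (F : I -> 'rV[R]_n -> R[i]) :
  (forall i, ctame (F i)) ->
  integralRn (fun x => \sum_(i <- r) F i x) = \sum_(i <- r) integralRn (F i).
Proof.
move=> tF; elim: r => [|i r IH].
  rewrite [RHS]big_nil -[RHS]integralRn0; apply: eq_integralRn => x.
  by rewrite big_nil.
rewrite big_cons -IH -integralRnD//; last exact: ctame_sum.
by apply: eq_integralRn => x; rewrite big_cons.
Qed.

Lemma IR_omega_ge0 : 0 <= IR (@omega R n).
Proof. by apply: Rintegral_ge0 => t _; exact/ltW/omega_gt0. Qed.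

(** Stated for arbitrary functions, through [IR_le], so that it applies to integrands containing
    [convolution] and [fourier] without a separate proof of measurability. *)
Lemma normc_integralRn f C : (forall x, normc (f x) <= C * omega x) ->
  normc (integralRn f) <= 2 * (C * IR (@omega R n)).
Proof.
move=> fC; rewrite (le_trans (normc_le _))// integralRnE /= mulr2n mulrDl mul1r.
by rewrite lerD// IR_le// => x; apply: le_trans (fC x);
  [exact: le_normc_Re|exact: le_normc_Im].
Qed.

Lemma ctame_compact f (L : R) : ccont f ->
  (forall x : 'rV[R]_n, (exists k, L < `|x 0 k|) -> f x = 0) -> ctame f.
Proof.
move=> [c1 c2] f0.
by split; apply: (@tame_compact _ _ _ L) => // x /f0 /= ->.
Qed.

Definition in_cube (x y : 'rV[R]_n) : Prop := forall j, `|y 0 j - x 0 j| <= 1.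

Lemma in_cubePn x y : ~ in_cube x y -> exists j, 1 < `|y 0 j - x 0 j|.
Proof. by move/existsNP => [j /negP]; rewrite -ltNge => H; exists j. Qed.

Lemma cube_support f x : (forall y, ~ in_cube x y -> f y = 0) ->
  forall y : 'rV[R]_n, (exists k, 1 + \sum_j `|x 0 j| < `|y 0 k|) -> f y = 0.
Proof.
move=> f0 y [k Hk]; apply: f0 => /(_ k) yk; move: Hk; apply/negP; rewrite -leNgt.
rewrite -(subrK (x 0 k) (y 0 k)) (le_trans (ler_normD _ _))// lerD//.
by rewrite (bigD1 k)//= lerDl sumr_ge0.
Qed.

Lemma ctame_cube f x : ccont f -> (forall y, ~ in_cube x y -> f y = 0) -> ctame f.
Proof. by move=> cf f0; apply: (ctame_compact cf) (cube_support f0). Qed.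

Lemma IR_cube (h : 'rV[R]_n -> R) x (B : R) : tame h ->
  (forall y, in_cube x y -> `|h y| <= B) -> (forall y, ~ in_cube x y -> h y = 0) ->
  `|IR h| <= B * 2 ^+ n.
Proof.
move=> th hB h0.
pose b j t : R := if x 0 j - 1 <= t <= x 0 j + 1 then 1 else 0.
have mb j : measurable_fun setT (b j).
  apply: measurable_fun_ifT => //; apply: measurable_and;
    exact: measurable_fun_ler.
have [|tb Ib] := IR_tensor mb (D := fun j => oneDsqr (`|x 0 j| + 1)).
  move=> j t; rewrite ler_pdivlMr ?(lt_le_trans ltr01 (oneDsqr_ge1 t))// /b.
  rewrite -ler_distlC distrC; case: ifPn => [tx|_]; last first.
    by rewrite normr0 mul0r (le_trans ler01)// oneDsqr_ge1.
  rewrite normr1 mul1r lerD2l -(real_normK (num_real t)).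
  rewrite lerXn2r ?nnegrE ?addr_ge0//.
  by rewrite -{1}(subrK (x 0 j) t) (le_trans (ler_normD _ _))// addrC lerD2l.
have {}Ib : IR (fun y : 'rV[R]_n => \prod_j b j (y 0 j)) = 2 ^+ n.
  rewrite Ib -[n in RHS]card_ord -prodr_const; apply: eq_bigr => j _.
  by rewrite Rintegral_itv_cst; [ring|lra].
have hb y : `|h y| <= B * \prod_j b j (y 0 j).
  have [yx|yx] := pselect (in_cube x y).
    rewrite (_ : \prod_j _ = 1) ?mulr1 ?hB//; apply: big1 => j _.
    by rewrite /b -ler_distlC distrC yx.
  have [j Hj] := in_cubePn yx.
  rewrite h0// normr0 (_ : \prod_j _ = 0) ?mulr0//.
  by apply/eqP/prodf_eq0; exists j => //; rewrite /b -ler_distlC distrC leNgt Hj.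
rewrite -Ib -IRZ// ler_norml; apply/andP; split.
  rewrite -mulN1r -IRZ; last exact: tameZ.
  apply: le_IR => //; first by do 2 apply: tameZ.
  by move=> y; have := hb y; rewrite mulN1r ler_norml => /andP[].
apply: le_IR => //; first exact: tameZ.
by move=> y; have := hb y; rewrite ler_norml => /andP[].
Qed.

Lemma integralRn_cube f x (B : R) : ccont f ->
  (forall y, in_cube x y -> normc (f y) <= B) ->
  (forall y, ~ in_cube x y -> f y = 0) ->
  normc (integralRn f) <= 2 ^+ n.+1 * B.
Proof.
move=> cf fB f0; have [t1 t2] := ctame_cube cf f0.
rewrite (le_trans (normc_le _))// integralRnE /= exprS mulrC mulrA mulr_natr.
rewrite [_ *+ 2]mulr2n [leRHS]mulrDl lerD// (@IR_cube _ x)// => y yx /=.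
- exact: le_trans (le_normc_Re _) (fB _ yx).
- by rewrite f0.
- exact: le_trans (le_normc_Im _) (fB _ yx).
- by rewrite f0.
Qed.

Lemma integralRn_partial f j (L : R) : cdiffn f -> ccont (partial j f) ->
  (forall x : 'rV[R]_n, (exists k, L < `|x 0 k|) -> f x = 0) ->
  integralRn (partial j f) = 0.
Proof.
move=> df [c1 c2] f0; rewrite integralRnE; apply: eq_ReIm => /=.
- apply: (@IR_partial _ _ (Re \o f) j L) => [x||x /f0 /= ->//]; last exact: c1.
  by apply/derivable_line; have [] := df j x.
- apply: (@IR_partial _ _ (Im \o f) j L) => [x||x /f0 /= ->//]; last exact: c2.
  by apply/derivable_line; have [] := df j x.
Qed.

Definition wave (k x : 'rV[R]_n) : 'rV[R]_n -> R[i] :=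
  tensor (fun j t => expi (- (k 0 j * (t - x 0 j)))).

Lemma csmooth_expi (k x : R) : csmooth (fun t => expi (- (k * (t - x)))).
Proof.
have H : cinf (fun t : R => - (k * (t - x))).
  apply/cinfN/cinfZ; apply: cinfD; [exact: cinf_id|exact: cinf_cst].
by split; apply: cinf_comp => //; have [] := @cinf_trig R.
Qed.

(** Expanding the kernel into exponentials bounds its integral against [K] by a product over
    coordinates. Each factor is at most [cb (m ^ 2) <= 1/m] times [\sum_j 1/(1 + j^2) <= 6], which
    is the power [m^-n] that [concentration] asks for. *)
Let inversion_Re (K : 'rV[R]_n -> R[i]) x B : ccont K ->
  (forall y, ~ in_cube x y -> K y = 0) -> 0 <= B ->
  (forall k, normc (integralRn (fun y => K y * wave k x y)) *
     \prod_j oneDsqr (k 0 j) <= B) ->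
  Re (K x) <= 6 ^+ n * B.
Proof.
move=> cK K0 B0 HB; have [c1 c2] := cK.
apply: (@concentration _ _ (Re \o K) x) => //.
- move=> y [j yj] /=; rewrite K0// => /(_ j); rewrite leNgt yj//.
- by rewrite mulr_ge0// exprn_ge0.
move=> m m0; set M := (m ^ 2)%N.
pose Q (y : 'rV[R]_n) := \prod_j qk M (y 0 j - x 0 j).
pose c (i : 'I_(M.*2.+1)) : R := 'C(M.*2, i)%:R / 4 ^+ M.
(* The frequencies are [M - j] and not [j - M], because [wave] carries a minus sign in its phase. *)
pose kf (f : {ffun 'I_n -> 'I_(M.*2.+1)}) : 'rV[R]_n := \row_j (M%:R - (f j)%:R).
have QE y : (Q y)%:C = \sum_(f : {ffun 'I_n -> 'I_(M.*2.+1)}) (\prod_j c (f j))%:C * wave (kf f) x y.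
  rewrite /Q rmorph_prod /=; under eq_bigr do rewrite qk_fourier.
  rewrite bigA_distr_bigA /=; apply: eq_bigr => f _.
  rewrite rmorph_prod /= /wave /tensor -big_split /=; apply: eq_bigr => j _.
  by rewrite mxE -mulNr opprB.
have tw k : ctame (fun y => K y * wave k x y).
  apply: (@ctame_cube _ x) => [|y /K0 ->]; last by rewrite mul0r.
  by apply: ccontM => //; apply: ccont_tensor => j; exact: csmooth_expi.
have -> : IR (fun y => (Re \o K) y * Q y) = Re (integralRn (fun y => K y * (Q y)%:C)).
  by rewrite integralRnE /=; apply: eq_IR => y; rewrite /= cReM /= mulr0 subr0.
apply: le_trans (ler_norm _) _; apply: le_trans (le_normc_Re _) _.
rewrite (eq_integralRn (g := fun y =>
    \sum_(f : {ffun 'I_n -> 'I_(M.*2.+1)}) (\prod_j c (f j))%:C * (K y * wave (kf f) x y))); last first.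
  by move=> y; rewrite QE mulr_sumr; apply: eq_bigr => f _; rewrite mulrCA.
rewrite integralRn_sum; last by move=> f; apply: ctameZ.
have c0 i : 0 <= c i by rewrite divr_ge0// exprn_ge0.
apply: (@le_trans _ _ (\sum_(f : {ffun 'I_n -> 'I_(M.*2.+1)})
    B * \prod_j (c (f j) * (oneDsqr ((f j)%:R - M%:R))^-1))).
  rewrite (le_trans (normc_sum _ _ _))//; apply: ler_sum => f _.
  rewrite integralRnZ// normcM normc_real ger0_norm; last exact: prodr_ge0.
  have -> : \prod_j (c (f j) * (oneDsqr ((f j)%:R - M%:R))^-1) =
    \prod_j c (f j) * \prod_j (oneDsqr ((f j)%:R - M%:R))^-1 by exact: big_split.
  rewrite [leRHS]mulrCA ler_wpM2l//; first exact: prodr_ge0.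
  rewrite prodfV ler_pdivlMr; last first.
    by apply: prodr_gt0 => j _; rewrite (lt_le_trans ltr01)// oneDsqr_ge1.
  have := HB (kf f); congr (_ * _ <= _); apply: eq_bigr => j _.
  by rewrite mxE /oneDsqr -sqrrN opprB.
rewrite -mulr_sumr.
rewrite -(bigA_distr_bigA (fun (j : 'I_n) (i : 'I_(M.*2.+1)) =>
  c i * (oneDsqr (i%:R - M%:R))^-1)) /= mulrAC [leRHS]mulrC ler_wpM2l//.
rewrite -exprMn -[n in X in _ <= X]card_ord -prodr_const; apply: ler_prod => j _.
apply/andP; split.
  by apply: sumr_ge0 => i _; rewrite mulr_ge0// ltW// oneDsqrV_gt0.
apply: (@le_trans _ _ (\sum_(i < M.*2.+1) cb M * (oneDsqr (i%:R - M%:R : R))^-1)).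
  apply: ler_sum => i _; rewrite ler_wpM2r //.
  by rewrite ler_wpM2r ?invr_ge0 ?exprn_ge0// ler_nat central_bin_max.
rewrite -mulr_sumr mulrC ler_pM//.
- by apply: sumr_ge0 => i _; exact/ltW/oneDsqrV_gt0.
- exact: cb_ge0.
- exact: sum_oneDsqrV.
- exact: cb_le.
Qed.

Lemma inversion_bound (K : 'rV[R]_n -> R[i]) x B : ccont K ->
  (forall y, ~ in_cube x y -> K y = 0) -> 0 <= B ->
  (forall k, normc (integralRn (fun y => K y * wave k x y)) *
     \prod_j oneDsqr (k 0 j) <= B) ->
  normc (K x) <= 2 * 6 ^+ n * B.
Proof.
move=> cK K0 B0 HB.
(* Rotating [K] by the four units 1, -1, i, -i turns the one-sided bound on the real part into a
   bound on both components; this is the factor 2. *)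
have H (c : R[i]) : normc c = 1 -> Re (c * K x) <= 6 ^+ n * B.
  move=> c1; apply: (@inversion_Re (fun y => c * K y)) => //.
  - exact: ccontM (ccont_cst n c) cK.
  - by move=> y /K0 ->; rewrite mulr0.
  move=> k; rewrite (eq_integralRn (g := fun y => c * (K y * wave k x y))).
    rewrite integralRnZ ?normcM ?c1 ?mul1r//.
    apply: (@ctame_cube _ x) => [|y /K0 ->]; last by rewrite mul0r.
    by apply: ccontM => //; apply: ccont_tensor => j; exact: csmooth_expi.
  by move=> y; rewrite mulrA.
rewrite (le_trans (normc_le _))// -mulrA mulr_natl mulr2n lerD// ler_norml.
- have := H 1 normc1; have := H (-1); rewrite normcN normc1 => /(_ erefl).
  by rewrite mulN1r mul1r cReN; lra.
- have := H 'i%C normc_i; have := H (- 'i%C).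
  rewrite normcN normc_i => /(_ erefl); rewrite mulNr cReN cReM /=; lra.
Qed.

End complex_integral.

(** * Wave packets *)

Section wave_packets.
Context {R : realType}.
Local Notation Re := (@complex.Re R).
Local Notation Im := (@complex.Im R).
Local Notation normc := (@complex.ComplexField.Normc.normc R).

Definition testf (F : R -> R) : Prop :=
  cinf F /\ forall t, 1 < `|t| -> F t = 0.

(** The minus sign of integration by parts is built in, here and in [ncder], so that moving
    derivatives onto packets creates no other sign. *)
Definition nder (F : R -> R) (t : R) : R := - derive1 F t.

Definition ncder (F : R -> R[i]) (t : R) : R[i] := - cder F t.

Definition packet (k x : R) (F : R -> R) (t : R) : R[i] :=
  expi (- (k * (t - x))) * (F (t - x))%:C.

Lemma testf_nder F : testf F -> testf (nder F).
Proof.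
move=> [cF F0]; split; first exact/cinfN/cinf_derive1.
by move=> t t1; rewrite /nder (derive1_outside F0)// oppr0.
Qed.

Lemma testf_mulX g F : testf F -> testf (fun s => s ^+ g * F s).
Proof.
move=> [cF F0]; split; first exact: cinfM (cinfX g cinf_id) cF.
by move=> t /F0 ->; rewrite mulr0.
Qed.

Lemma testf_bump : testf bump.
Proof. by split; [exact: cinf_bump|move=> t /ltW; exact: bump0]. Qed.

Definition wop (p : nat * nat) (F : R -> R) : R -> R :=
  iter p.2 nder (fun s => s ^+ p.1 * F s).

Lemma testf_wop p F : testf F -> testf (wop p F).
Proof.
move=> tF; rewrite /wop; elim: p.2 => [|d IH] /=; first exact: testf_mulX.
exact: testf_nder.
Qed.

Lemma testf_bounded F : testf F -> exists C, 0 <= C /\ forall t, `|F t| <= C.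
Proof.
move=> [cF F0].
have cF' : continuous (fun x : 'rV[R]_1 => F (x 0 0)).
  exact: (continuousT_comp (@continuous_coord R 1 0) (cinf_continuous cF)).
have [C HC] := bounded_on_box 1 cF'.
exists `|C|; split=> // t; have [/F0 ->|t1] := ltP 1 `|t|; first by rewrite normr0.
apply: le_trans (ler_norm C); have := HC (vcons t 0); rewrite vcons0; apply.
by move=> j; rewrite ord1 vcons0.
Qed.

Lemma cinf_shift F (x : R) : cinf F -> cinf (fun t => F (t - x)).
Proof.
move=> cF; apply: (cinf_comp cF).
by apply: cinfD; [exact: cinf_id|exact: cinf_cst].
Qed.

Lemma csmooth_packet k x F : cinf F -> csmooth (packet k x F).
Proof.
move=> cF; apply: csmoothM; first exact: csmooth_expi.
exact/csmooth_real/cinf_shift.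
Qed.

Lemma derive1_shift F (x : R) : cinf F ->
  derive1 (fun t => F (t - x)) = fun t => derive1 F (t - x).
Proof.
move=> cF; apply/funext => t.
have ds : is_derive t 1 (fun u : R => u - x) 1.
  by have := is_deriveB (is_derive_id t (1 : R)) (is_derive_cst x t 1); rewrite subr0.
have [d1 d2] := is_derive1P ds.
by rewrite (derive1_comp d1 (@cinf_derivable R F _ cF)) d2 mulr1.
Qed.

Lemma derive1_outside_shift (f : R -> R) (a t : R) : cinf f ->
  (forall s, 1 < `|s - a| -> f s = 0) -> 1 < `|t - a| -> derive1 f t = 0.
Proof.
move=> cf f0 ta.
have E : derive1 (fun s => f (s + a)) (t - a) = derive1 f (t - a + a).
  by have := @derive1_shift f (- a) cf; rewrite opprK => ->.
rewrite subrK in E; rewrite -E; apply: (@derive1_outside _ _ 1) => // s s1.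
by apply: f0; rewrite addrK.
Qed.

Lemma ncder_packet k x F : cinf F -> ncder (packet k x F) =
  fun t => ('i%C * k%:C) * packet k x F t + packet k x (nder F) t.
Proof.
move=> cF; apply/funext => t; rewrite /ncder.
rewrite (cder_funM (csmooth_expi k x)); last exact/csmooth_real/cinf_shift.
rewrite cder_real derive1_shift//.
have -> : cder (fun t => expi (- (k * (t - x)))) t =
    - ('i%C * k%:C) * expi (- (k * (t - x))).
  have dl : is_derive t 1 (fun u : R => - (k * (u - x))) (- k).
    have H := is_deriveB (is_derive_id t (1 : R)) (is_derive_cst x t 1).
    have := is_deriveN (is_deriveM (is_derive_cst k t (1 : R)) H).
    rewrite subr0 => HH; apply: is_derive_eq.
    by rewrite /GRing.scale /= mulr1 mulr0 addr0.
  have [d1 d2] := is_derive1P dl.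
  rewrite /cder.
  have -> : derive1 (Re \o (fun t => expi (- (k * (t - x))))) t =
      - sin (- (k * (t - x))) * - k.
    rewrite (_ : _ \o _ = @cos R \o (fun u => - (k * (u - x)))) //.
    by rewrite (derive1_comp d1 (@derivable_cos R _)) d2 derive1_cos.
  have -> : derive1 (Im \o (fun t => expi (- (k * (t - x))))) t =
      cos (- (k * (t - x))) * - k.
    rewrite (_ : _ \o _ = @sin R \o (fun u => - (k * (u - x)))) //.
    by rewrite (derive1_comp d1 (@derivable_sin R _)) d2 derive1_sin.
  by apply: eq_ReIm; rewrite !(cReM, cImM, cReN, cImN) /=; ring.
rewrite /packet /nder rmorphN /=; ring.
Qed.

Lemma packet_outside k x F t : testf F -> 1 < `|t - x| -> packet k x F t = 0.
Proof. by move=> [_ F0] /F0; rewrite /packet => ->; rewrite mulr0. Qed.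

Lemma normc_packet k x F t : normc (packet k x F t) = `|F (t - x)|.
Proof. by rewrite normcM normc_expi mul1r normc_real. Qed.

Lemma csmooth_ncder P : csmooth P -> csmooth (ncder P).
Proof.
move=> cP; rewrite (_ : ncder P = fun t => -1 * cder P t).
  by apply: csmoothM; [exact: csmooth_cst|exact: csmooth_cder].
by apply/funext => t; rewrite mulN1r.
Qed.

Lemma ncder_fun_sum (I : Type) (r : seq I) (c : I -> R[i]) (F : I -> R -> R[i]) :
  (forall i, csmooth (F i)) ->
  ncder (fun t => \sum_(i <- r) c i * F i t) =
  fun t => \sum_(i <- r) c i * ncder (F i) t.
Proof.
move=> cF; apply/funext => t; rewrite /ncder.
rewrite (@cder_fun_sum R I r (fun i t => c i * F i t)); last first.
  by move=> i; apply: csmoothM => //; exact: csmooth_cst.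
rewrite -sumrN; apply: eq_bigr => i _.
by rewrite cder_funZ// mulrN.
Qed.

(** The sum runs to a common [B] rather than to [b], the additional binomials being 0. All
    multi-indices of an operator can thus share one finite index type. *)
Lemma iter_ncder_packet B b k x F : (b < B)%N -> testf F ->
  iter b ncder (packet k x F) = fun t => \sum_(d < B)
    ('C(b, d)%:R * ('i%C * k%:C) ^+ (b - d)) * packet k x (iter d nder F) t.
Proof.
move=> bB tF; elim: b bB => [|b IH] bB.
  apply/funext => t; case: B bB => // B _.
  rewrite big_ord_recl /= bin0 expr0 !mul1r big1 ?addr0// => i _.
  by rewrite bin0n mul0r mul0r.
have td d : testf (iter d nder F).
  by elim: d => //= d; exact: testf_nder.
rewrite iterS IH ?(ltnW bB)// ncder_fun_sum => [|d]; last first.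
  by apply: csmooth_packet; have [] := td d.
apply/funext => t; set w := 'i%C * k%:C.
under eq_bigr => d _.
  rewrite ncder_packet; last by have [] := td d.
  rewrite -/w mulrDr mulrA; over.
rewrite big_split /=.
(* Index shift before applying Pascal's rule: the last term drops since [b + 1 < B], and a zero term
   is inserted at [d = 0]. *)
have -> : \sum_(d < B) 'C(b, d)%:R * w ^+ (b - d) * packet k x (nder (iter d nder F)) t =
    \sum_(d < B) (if (d == 0 :> nat) then 0 else
      'C(b, d.-1)%:R * w ^+ (b - d.-1) * packet k x (iter d nder F) t).
  case: B bB {IH} => // B bB; rewrite big_ord_recr big_ord_recl /=.
  by rewrite bin_small// !mul0r addr0 add0r; apply: eq_bigr.
rewrite -big_split /=; apply: eq_bigr => d _; case: (d : nat) => [|d'] /=.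
  by rewrite addr0 !bin0 !subn0 !mul1r exprSr.
rewrite binS natrD subSS.
have [bd|db] := leqP b d'.
  by rewrite bin_small ?ltnS// !mul0r !add0r.
have E : w ^+ (b - d') = w ^+ (b - d'.+1) * w by rewrite -exprSr -subSn.
by rewrite E; ring.
Qed.

Definition wcoef (a b : nat) (p : nat * nat) (x k : R) : R[i] :=
  (('C(a, p.1)%:R * x ^+ (a - p.1))%:C) *
  ('C(b, p.2)%:R * ('i%C * k%:C) ^+ (b - p.2)).

(** Taylor expansion of [t ^ a] at the centre [x]; each power of [t - x] is absorbed into the test
    function. *)
Lemma monomial_packet B a k x F t : (a < B)%N ->
  (t ^+ a)%:C * packet k x F t = \sum_(g < B)
    ('C(a, g)%:R * x ^+ (a - g))%:C * packet k x (fun s => s ^+ g * F s) t.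
Proof.
move=> aB; have -> : t ^+ a = \sum_(g < B) 'C(a, g)%:R * x ^+ (a - g) * (t - x) ^+ g.
  rewrite -{1}(subrK x t) addrC exprDn (big_ord_widen_cond B xpredT
    (fun i => x ^+ (a - i) * (t - x) ^+ i *+ 'C(a, i)))//.
  rewrite big_mkcond /=; apply: eq_bigr => i _; rewrite ltnS.
  case: leqP => ia; first by rewrite -mulr_natl mulrA.
  by rewrite bin_small// !mul0r.
rewrite rmorph_sum mulr_suml /=; apply: eq_bigr => g _.
by rewrite /packet !rmorphM /=; ring.
Qed.

Lemma iter_ncder_monomial_packet B a b k x F : (a < B)%N -> (b < B)%N -> testf F ->
  iter b ncder (fun t => (t ^+ a)%:C * packet k x F t) =
  fun t => \sum_(p : 'I_B * 'I_B) wcoef a b (val p.1, val p.2) x k *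
    packet k x (wop (val p.1, val p.2) F) t.
Proof.
move=> aB bB tF.
have tX g := testf_mulX g tF.
have -> : (fun t => (t ^+ a)%:C * packet k x F t) = fun t => \sum_(g < B)
    ('C(a, g)%:R * x ^+ (a - g))%:C * packet k x (fun s => s ^+ g * F s) t.
  by apply/funext => t; exact: monomial_packet.
have H c : iter c ncder (fun t => \sum_(g < B)
    ('C(a, g)%:R * x ^+ (a - g))%:C * packet k x (fun s => s ^+ g * F s) t) =
  fun t => \sum_(g < B) ('C(a, g)%:R * x ^+ (a - g))%:C *
    iter c ncder (packet k x (fun s => s ^+ g * F s)) t.
  elim: c => // c IH; rewrite iterS IH ncder_fun_sum// => g.
  elim: c {IH} => [|c IHc] /=; first by apply: csmooth_packet; have [] := tX g.
  exact: csmooth_ncder.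
rewrite H; apply/funext => t.
under eq_bigr do rewrite (iter_ncder_packet k x bB (tX _)) mulr_sumr.
rewrite pair_bigA /=; apply: eq_bigr => p _.
by rewrite /wcoef mulrA.
Qed.

Section packet_transform.
Context {n : nat}.
Implicit Types (F : 'I_n -> R -> R) (k x : 'rV[R]_n) (g : 'rV[R]_n -> R[i]).

Definition wpacket k x F : 'rV[R]_n -> R[i] :=
  tensor (fun j => packet (k 0 j) (x 0 j) (F j)).

Definition Tw k x F g : R[i] := integralRn (fun y => g y * wpacket k x F y).

Definition testfs F : Prop := forall j, testf (F j).

Lemma wpacket_outside k x F y : testfs F -> ~ in_cube x y -> wpacket k x F y = 0.
Proof.
move=> tF /in_cubePn[j yj]; apply/eqP/prodf_eq0; exists j => //; apply/eqP.
exact: packet_outside.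
Qed.

Lemma ccont_wpacket k x F : testfs F -> ccont (wpacket k x F).
Proof.
by move=> tF; apply: ccont_tensor => j; apply: csmooth_packet; have [] := tF j.
Qed.

Lemma ctame_wpacket k x F g : testfs F -> ccont g ->
  ctame (fun y => g y * wpacket k x F y).
Proof.
move=> tF cg; apply: (@ctame_cube _ _ _ x).
  by apply: ccontM => //; exact: ccont_wpacket.
by move=> y yx; rewrite wpacket_outside// mulr0.
Qed.

Lemma Tw_bound F : testfs F -> exists C, 0 <= C /\ forall k x g B, ccont g ->
  (forall y, in_cube x y -> normc (g y) <= B) -> normc (Tw k x F g) <= C * B.
Proof.
move=> tF; have /choice[c Hc] := fun j => testf_bounded (tF j).
exists (2 ^+ n.+1 * \prod_j c j); split.
  by rewrite mulr_ge0 ?exprn_ge0// prodr_ge0// => j _; have [] := Hc j.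
move=> k x g B cg gB; rewrite -mulrA; apply: (@integralRn_cube _ _ _ x).
- by apply: ccontM => //; exact: ccont_wpacket.
- move=> y yx; rewrite normcM mulrC ler_pM ?normc_ge0// ?gB//.
  rewrite normc_prod; apply: ler_prod => j _; rewrite normc_ge0 normc_packet.
  by have [_] := Hc j; apply.
- by move=> y yx; rewrite wpacket_outside// mulr0.
Qed.

Lemma integralRn_by_parts g j (Psi : 'I_n -> R -> R[i]) x : smooth g ->
  (forall i, csmooth (Psi i)) -> (forall i t, 1 < `|t - x 0 i| -> Psi i t = 0) ->
  integralRn (fun y => partial j g y * tensor Psi y) =
  integralRn (fun y => g y * tensor (ftupd Psi j (ncder (Psi j))) y).
Proof.
move=> sg cP P0.
have sP := smooth_tensor cP.
have out y : ~ in_cube x y -> tensor Psi y = 0.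
  by move=> /in_cubePn[i yi]; apply/eqP/prodf_eq0; exists i => //; apply/eqP/P0.
have out' y : ~ in_cube x y -> tensor (ftupd Psi j (cder (Psi j))) y = 0.
  move=> /in_cubePn[i yi]; apply/eqP/prodf_eq0; exists i => //; apply/eqP.
  rewrite /ftupd; case: eqP => [ij|_]; last exact: P0.
  have H f : (forall t, 1 < `|t - x 0 j| -> f t = 0) -> cinf f ->
      derive1 f (y 0 i) = 0.
    by move=> f0 cf; apply: (derive1_outside_shift cf f0); rewrite -ij.
  have [c1 c2] := cP j.
  by apply: eq_ReIm; rewrite /cder /=; apply: H => // t /P0 /= ->.
have E : partial j (fun y => g y * tensor Psi y) = fun y =>
    partial j g y * tensor Psi y + g y * tensor (ftupd Psi j (cder (Psi j))) y.
  by rewrite partialM// partial_tensor.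
have cP' : forall i, csmooth (ftupd Psi j (cder (Psi j)) i).
  by move=> i; rewrite /ftupd; case: eqP => // _; exact: csmooth_cder.
have t1 : ctame (fun y => partial j g y * tensor Psi y).
  apply: (@ctame_cube _ _ _ x) => [|y /out ->]; last by rewrite mulr0.
  by apply: ccontM; [apply/smooth_ccont/smooth_partial|exact: smooth_ccont].
have t2 : ctame (fun y => g y * tensor (ftupd Psi j (cder (Psi j))) y).
  apply: (@ctame_cube _ _ _ x) => [|y /out' ->]; last by rewrite mulr0.
  by apply: ccontM; [exact: smooth_ccont|exact: ccont_tensor].
have : integralRn (partial j (fun y => g y * tensor Psi y)) = 0.
  have [sM _] := (smoothP _).1 (smoothM sg sP) [::].
  apply: (@integralRn_partial _ _ _ j (1 + \sum_i `|x 0 i|)).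
  - by have [_] := (smoothP _).1 (smoothM sg sP) [::].
  - exact/smooth_ccont/smooth_partial/smoothM.
  - by apply: cube_support => y /out ->; rewrite mulr0.
rewrite E integralRnD// => /eqP; rewrite addr_eq0 => /eqP ->.
rewrite -[LHS]mulN1r -integralRnZ//; apply: eq_integralRn => y.
rewrite mulN1r -mulrN; congr (_ * _).
rewrite /tensor (bigD1 j)//= [RHS](bigD1 j)//= /ftupd eqxx /ncder mulNr.
by congr (- (_ * _)); apply: eq_bigr => i /negbTE ->.
Qed.

Lemma ncder_outside (P : R -> R[i]) (a : R) : csmooth P ->
  (forall t, 1 < `|t - a| -> P t = 0) -> forall t, 1 < `|t - a| -> ncder P t = 0.
Proof.
move=> [c1 c2] P0 t ta.
have H f : (forall t, 1 < `|t - a| -> f t = 0) -> cinf f -> derive1 f t = 0.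
  by move=> f0 cf; exact: (derive1_outside_shift cf f0).
rewrite /ncder /cder !H//; first by apply: eq_ReIm; rewrite /= oppr0.
- by move=> s /P0 /= ->.
- by move=> s /P0 /= ->.
Qed.

Lemma integralRn_dseq s g (Psi : 'I_n -> R -> R[i]) x : smooth g ->
  (forall i, csmooth (Psi i)) -> (forall i t, 1 < `|t - x 0 i| -> Psi i t = 0) ->
  integralRn (fun y => dseq s g y * tensor Psi y) =
  integralRn (fun y => g y * tensor (fun j => iter (count_mem j s) ncder (Psi j)) y).
Proof.
move=> sg; elim: s Psi => [|i s IH] Psi cP P0 //=.
rewrite (@integralRn_by_parts _ _ _ x)//; last exact: smooth_dseq.
rewrite IH.
- apply: eq_integralRn => y; congr (_ * tensor _ _); apply/funext => j.
  rewrite /ftupd eq_sym; have [->|_] := eqVneq i j; last by rewrite add0n.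
  by rewrite addnC addn1 iterSr.
- by move=> j; rewrite /ftupd; case: eqP => // _; exact: csmooth_ncder.
- move=> j t; rewrite /ftupd; case: eqP => [->|_]; last exact: P0.
  by apply: ncder_outside => // u; exact: P0.
Qed.

Lemma Tw_partial k x F g j : testfs F -> smooth g ->
  Tw k x F (partial j g) =
  ('i%C * (k 0 j)%:C) * Tw k x F g + Tw k x (ftupd F j (nder (F j))) g.
Proof.
move=> tF sg; rewrite /Tw (@integralRn_by_parts _ _ _ x)//.
- rewrite -integralRnZ; last by apply: ctame_wpacket => //; exact: smooth_ccont.
  have tF' : testfs (ftupd F j (nder (F j))).
    by move=> i; rewrite /ftupd; case: eqP => // _; exact: testf_nder.
  rewrite -integralRnD; last 2 first.
  - by apply/ctameZ/ctame_wpacket => //; exact: smooth_ccont.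
  - by apply: ctame_wpacket => //; exact: smooth_ccont.
  apply: eq_integralRn => y.
  rewrite /wpacket /tensor (bigD1 j)//= [in X in _ = X + _](bigD1 j)//=.
  rewrite [in X in _ = _ + X](bigD1 j)//= /ftupd eqxx.
  rewrite ncder_packet; last by have [] := tF j.
  have e1 : \prod_(i < n | i != j) (if i == j then ncder (packet (k 0 j) (x 0 j) (F j))
      else packet (k 0 i) (x 0 i) (F i)) (y 0 i) =
      \prod_(i < n | i != j) packet (k 0 i) (x 0 i) (F i) (y 0 i).
    by apply: eq_bigr => i /negbTE ->.
  have e2 : \prod_(i < n | i != j) packet (k 0 i) (x 0 i)
      (if i == j then nder (F j) else F i) (y 0 i) =
      \prod_(i < n | i != j) packet (k 0 i) (x 0 i) (F i) (y 0 i).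
    by apply: eq_bigr => i /negbTE ->.
  rewrite e2; rewrite (eq_bigr (fun i => packet (k 0 i) (x 0 i) (F i) (y 0 i))).
    by ring.
  by move=> i /negbTE ->.
- by move=> i; apply: csmooth_packet; have [] := tF i.
- by move=> i t; exact: packet_outside.
Qed.

(** Repeated use of [i k_j Tw F g = Tw F (d_j g) - Tw F' g], where [F'] is [F] with one factor
    replaced by its [nder]. The induction therefore ranges over all test functions. *)
Lemma Tw_decay1 j M : forall F, testfs F -> exists C, 0 <= C /\
  forall k x g B, smooth g ->
  (forall i y, (i <= M)%N -> in_cube x y -> normc (iter i (partial j) g y) <= B) ->
  `|k 0 j| ^+ M * normc (Tw k x F g) <= C * B.
Proof.
elim: M => [|M IH] F tF.
  have [C [C0 HC]] := Tw_bound tF; exists C; split => // k x g B sg gB.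
  rewrite expr0 mul1r; apply: HC; first exact: smooth_ccont.
  by move=> y; apply: (gB 0%N).
have tF' : testfs (ftupd F j (nder (F j))).
  by move=> i; rewrite /ftupd; case: eqP => // _; exact: testf_nder.
have [C1 [C10 H1]] := IH _ tF; have [C2 [C20 H2]] := IH _ tF'.
exists (C1 + C2); split; first exact: addr_ge0.
move=> k x g B sg gB.
have E : ('i%C * (k 0 j)%:C) * Tw k x F g =
    Tw k x F (partial j g) - Tw k x (ftupd F j (nder (F j))) g.
  by rewrite Tw_partial// addrK.
have := congr1 normc E; rewrite !normcM normc_i mul1r normc_real exprSr -mulrA => ->.
rewrite mulrDl (le_trans (ler_wpM2l _ (normcB _ _)))// mulrDr lerD//.
  apply: H1; first exact: smooth_partial.
  by move=> i y iM yx; rewrite -iterSr; exact: gB.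
by apply: H2 => // i y iM; apply: gB; exact: leqW.
Qed.

End packet_transform.

End wave_packets.

(** * Elementary estimates for [japanese] *)

Section japanese_lemmas.
Context {R : realType}.

Lemma jap_sqr p (x : 'rV[R]_p) : japanese x ^+ 2 = 1 + \sum_j x 0 j ^+ 2.
Proof.
have s0 : 0 <= \sum_j x 0 j ^+ 2 by apply: sumr_ge0 => j _; exact: sqr_ge0.
by rewrite /japanese /enorm !sqr_sqrtr ?addr_ge0 ?sqr_ge0.
Qed.

Lemma jap_ge1 p (x : 'rV[R]_p) : 1 <= japanese x.
Proof.
rewrite -(@ler_pXn2r _ 2) ?nnegrE ?sqrtr_ge0// expr1n jap_sqr lerDl.
by apply: sumr_ge0 => j _; exact: sqr_ge0.
Qed.

Lemma jap_gt0 p (x : 'rV[R]_p) : 0 < japanese x.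
Proof. exact: lt_le_trans ltr01 (jap_ge1 x). Qed.

Lemma jap_ge0 p (x : 'rV[R]_p) : 0 <= japanese x.
Proof. exact/ltW/jap_gt0. Qed.

Lemma le_japP p q (x : 'rV[R]_p) (y : 'rV[R]_q) (c : R) : 0 <= c ->
  japanese x ^+ 2 <= c ^+ 2 * japanese y ^+ 2 -> japanese x <= c * japanese y.
Proof.
move=> c0; rewrite -exprMn ler_pXn2r ?nnegrE ?mulr_ge0 ?jap_ge0//.
Qed.

Lemma coord_le_jap p (x : 'rV[R]_p) j : `|x 0 j| <= japanese x.
Proof.
rewrite -(@ler_pXn2r _ 2) ?nnegrE ?jap_ge0// jap_sqr real_normK ?num_real//.
rewrite (bigD1 j)//= addrCA lerDl addr_ge0// sumr_ge0// => i _.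
exact: sqr_ge0.
Qed.

Lemma sum_row_mx n m (x : 'rV[R]_n) (k : 'rV[R]_m) :
  \sum_j (row_mx x k) 0 j ^+ 2 = \sum_j x 0 j ^+ 2 + \sum_j k 0 j ^+ 2.
Proof.
rewrite big_split_ord /=; congr (_ + _); apply: eq_bigr => j _.
- by rewrite row_mxEl.
- by rewrite row_mxEr.
Qed.

Section row.
Context {n : nat}.
Variables x k : 'rV[R]_n.
Let sx : 0 <= \sum_j x 0 j ^+ 2.
Proof. by apply: sumr_ge0 => j _; exact: sqr_ge0. Qed.
Let sk : 0 <= \sum_j k 0 j ^+ 2.
Proof. by apply: sumr_ge0 => j _; exact: sqr_ge0. Qed.

Lemma jap_row_l : japanese x <= japanese (row_mx x k).
Proof.
rewrite -[leRHS]mul1r; apply: le_japP => //.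
by rewrite expr1n mul1r !jap_sqr sum_row_mx; have := sx; have := sk; lra.
Qed.

Lemma jap_row_r : japanese k <= japanese (row_mx x k).
Proof.
rewrite -[leRHS]mul1r; apply: le_japP => //.
by rewrite expr1n mul1r !jap_sqr sum_row_mx; have := sx; have := sk; lra.
Qed.

Lemma jap_row_le : japanese (row_mx x k) <= japanese x * japanese k.
Proof.
apply: le_japP; first exact: jap_ge0.
by rewrite !jap_sqr sum_row_mx; have := sx; have := sk; nra.
Qed.

Lemma prod_oneDsqr_jap : \prod_j oneDsqr (k 0 j) <= japanese k ^+ (2 * n).
Proof.
have -> : japanese k ^+ (2 * n) = \prod_(j < n) japanese k ^+ 2.
  by rewrite prodr_const card_ord exprM.
apply: ler_prod => j _.
rewrite (le_trans ler01 (oneDsqr_ge1 _)) /= jap_sqr lerD2l.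
rewrite (bigD1 j)//= lerDl sumr_ge0// => i _; exact: sqr_ge0.
Qed.

Lemma jap_cube (y : 'rV[R]_n) : in_cube x y ->
  japanese y <= (2 * n%:R + 2) * japanese x /\
  japanese x <= (2 * n%:R + 2) * japanese y.
Proof.
have H (a b : 'rV[R]_n) : in_cube a b -> japanese b <= (2 * n%:R + 2) * japanese a.
  move=> ab; have n0 : (0 : R) <= n%:R by [].
  have sa : 0 <= \sum_j a 0 j ^+ 2 by apply: sumr_ge0 => j _; exact: sqr_ge0.
  apply: le_japP; first lra.
  rewrite !jap_sqr.
  have : \sum_j b 0 j ^+ 2 <= \sum_j (2 * a 0 j ^+ 2 + 2).
    apply: ler_sum => j _.
    have : (b 0 j - a 0 j) ^+ 2 <= 1.
      by rewrite -real_normK ?num_real// exprn_ile1.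
    by have := sqr_ge0 (b 0 j - 2 * a 0 j); nra.
  rewrite big_split /= -mulr_sumr sumr_const card_ord -[2 *+ n]mulr_natr.
  move: sa; move: (\sum_j _) (\sum_j _) n0 => S T; move: (n%:R : R) => m m0 S0 TS.
  have := mulr_ge0 m0 S0; have := mulr_ge0 (mulr_ge0 m0 m0) S0.
  have := mulr_ge0 m0 m0; lra.
move=> xy; split; first exact: H.
by apply: H => j; rewrite distrC.
Qed.

End row.

Lemma exprD_le (a b : R) M : 0 <= a -> 0 <= b ->
  (a + b) ^+ M <= 2 ^+ M * (a ^+ M + b ^+ M).
Proof.
move=> a0 b0; have [ab|ba] := leP a b.
  apply: (@le_trans _ _ ((2 * b) ^+ M)).
    by rewrite lerXn2r ?nnegrE ?addr_ge0 ?mulr_ge0//; lra.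
  by rewrite exprMn ler_wpM2l ?exprn_ge0// lerDr exprn_ge0.
apply: (@le_trans _ _ ((2 * a) ^+ M)).
  by rewrite lerXn2r ?nnegrE ?addr_ge0 ?mulr_ge0//; lra.
by rewrite exprMn ler_wpM2l ?exprn_ge0// lerDl exprn_ge0.
Qed.

Lemma jap_pow_le p M : exists C, 0 <= C /\ forall x : 'rV[R]_p,
  japanese x ^+ M <= C * (1 + \sum_j `|x 0 j| ^+ M).
Proof.
have [C [C0 HC]] : exists C, 0 <= C /\ forall x : 'rV[R]_p,
    (1 + \sum_j `|x 0 j|) ^+ M <= C * (1 + \sum_j `|x 0 j| ^+ M).
  elim: (index_enum _) => [|j r [C [C0 IH]]].
    by exists 1; split => // x; rewrite !big_nil addr0 expr1n mul1r.
  exists (2 ^+ M * (C + 1)); split; first by rewrite mulr_ge0 ?exprn_ge0 ?addr_ge0.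
  move=> x; rewrite !big_cons addrCA.
  have s0 : 0 <= \sum_(i <- r) `|x 0 i| ^+ M.
    by apply: sumr_ge0 => i _; rewrite exprn_ge0.
  have a0 : 0 <= `|x 0 j| ^+ M by rewrite exprn_ge0.
  apply: le_trans (exprD_le _ _ _) _ => //; first by rewrite addr_ge0// sumr_ge0.
  rewrite -mulrA ler_wpM2l ?exprn_ge0//.
  by have := IH x; nra.
exists C; split => // x; apply: le_trans (HC x).
rewrite lerXn2r ?nnegrE ?jap_ge0 ?addr_ge0 ?sumr_ge0//.
rewrite -(@ler_pXn2r _ 2) ?nnegrE ?jap_ge0 ?addr_ge0 ?sumr_ge0// jap_sqr.
rewrite -[X in X <= _]addr0; elim: (index_enum _) => [|j r IH].
  by rewrite !big_nil !addr0 expr1n.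
rewrite !big_cons.
have s0 : 0 <= \sum_(i <- r) `|x 0 i| by apply: sumr_ge0.
rewrite -[x 0 j ^+ 2]real_normK ?num_real//; have := normr_ge0 (x 0 j); nra.
Qed.

End japanese_lemmas.

(** * Polynomial differential operators acting on wave packets *)

Section transform_of_operator.
Context {R : realType} {n : nat}.
Local Notation normc := (@complex.ComplexField.Normc.normc R).
Implicit Types (F : 'I_n -> R -> R) (k x : 'rV[R]_n) (g u : 'rV[R]_n -> R[i]).

Lemma Tw_decay M F : testfs F -> exists C, 0 <= C /\
  forall k x g B, smooth g ->
  (forall y, in_cube x y -> normc (g y) <= B) ->
  (forall j i y, (i <= M)%N -> in_cube x y -> normc (iter i (partial j) g y) <= B) ->
  japanese k ^+ M * normc (Tw k x F g) <= C * B.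
Proof.
move=> tF; have [C0 [C00 H0]] := Tw_bound tF.
have /choice[C1 H1] := fun j => Tw_decay1 j M tF.
have [D [D0 HD]] := @jap_pow_le R n M.
exists (D * (C0 + \sum_j C1 j)); split.
  by rewrite mulr_ge0// addr_ge0// sumr_ge0// => j _; have [] := H1 j.
move=> k x g B sg gB giB.
apply: (@le_trans _ _ (D * (1 + \sum_j `|k 0 j| ^+ M) * normc (Tw k x F g))).
  by rewrite ler_wpM2r// normc_ge0.
rewrite -!mulrA ler_wpM2l// !mulrDl mul1r lerD//.
  by apply: H0 => //; exact: smooth_ccont.
rewrite !mulr_suml; apply: ler_sum => j _; have [_] := H1 j; apply => // i y.
exact: giB.
Qed.

Lemma monomialE (alpha : mindex n) y :
  (monomial alpha y)%:C = tensor (fun j t => (t ^+ alpha j)%:C) y :> R[i].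
Proof. by rewrite /monomial rmorph_prod. Qed.

Definition wops B (f : {ffun 'I_n -> 'I_B * 'I_B}) F (j : 'I_n) : R -> R :=
  wop (val (f j).1, val (f j).2) (F j).

Definition wcoefs B (alpha beta : mindex n) (f : {ffun 'I_n -> 'I_B * 'I_B}) x k : R[i] :=
  \prod_j wcoef (alpha j) (beta j) (val (f j).1, val (f j).2) (x 0 j) (k 0 j).

Lemma testfs_wops B (f : {ffun 'I_n -> 'I_B * 'I_B}) F : testfs F -> testfs (wops f F).
Proof. by move=> tF j; exact: testf_wop. Qed.

(** Integration by parts and Taylor expansion act coordinatewise; distributing the product of the
    resulting sums leaves one term per choice function [f]. *)
Lemma Tw_monomial B (alpha beta : mindex n) k x F u :
  (forall j, alpha j < B)%N -> (forall j, beta j < B)%N -> testfs F -> smooth u ->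
  integralRn (fun y => (monomial alpha y)%:C * pderiv beta u y * wpacket k x F y) =
  \sum_(f : {ffun 'I_n -> 'I_B * 'I_B})
     wcoefs alpha beta f x k * Tw k x (wops f F) u.
Proof.
move=> aB bB tF su.
pose Psi j t := (t ^+ alpha j)%:C * packet (k 0 j) (x 0 j) (F j) t.
have cP j : csmooth (Psi j).
  apply: csmoothM; first exact/csmooth_real/cinfX/cinf_id.
  by apply: csmooth_packet; have [] := tF j.
have P0 j t : 1 < `|t - x 0 j| -> Psi j t = 0.
  by move=> tx; rewrite /Psi packet_outside// mulr0.
rewrite (eq_integralRn (g := fun y => dseq (mseq beta) u y * tensor Psi y)).
  rewrite (@integralRn_dseq _ _ _ _ _ x)//.
  transitivity (integralRn (fun y => \sum_(f : {ffun 'I_n -> 'I_B * 'I_B})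
     wcoefs alpha beta f x k * (u y * wpacket k x (wops f F) y))).
    apply: eq_integralRn => y.
    transitivity (u y * \prod_j \sum_(p : 'I_B * 'I_B)
        wcoef (alpha j) (beta j) (val p.1, val p.2) (x 0 j) (k 0 j) *
        packet (k 0 j) (x 0 j) (wop (val p.1, val p.2) (F j)) (y 0 j)).
      congr (_ * _); apply: eq_bigr => j _; rewrite count_mseq.
      by rewrite (iter_ncder_monomial_packet _ _ (aB j) (bB j) (tF j)).
    rewrite bigA_distr_bigA /= mulr_sumr; apply: eq_bigr => f _.
    by rewrite mulrCA; congr (_ * _); exact: big_split.
  have tt (f : {ffun 'I_n -> 'I_B * 'I_B}) :
      ctame (fun y => u y * wpacket k x (wops f F) y).
    by apply: ctame_wpacket; [exact: testfs_wops|exact: smooth_ccont].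
  rewrite integralRn_sum; last by move=> f; exact: ctameZ.
  by apply: eq_bigr => f _; rewrite integralRnZ.
move=> y; rewrite -pderivE [in LHS]mulrAC mulrC; congr (_ * _).
by rewrite monomialE; exact/esym/big_split.
Qed.

Definition comb (g d : mindex n) : mindex (n + n) :=
  [ffun i : 'I_(n + n) => match fintype.split i with inl j => g j | inr j => d j end].

Lemma iter_cder_pow (a g : nat) (t : R) :
  iter g cder (fun t : R => (t ^+ a)%:C) t = ((a ^_ g)%:R * t ^+ (a - g))%:C.
Proof.
elim: g t => [|g IH] t; first by rewrite ffactn0 mul1r subn0.
have c : csmooth (fun t : R => (t ^+ (a - g))%:C).
  exact/csmooth_real/cinfX/cinf_id.
rewrite iterS (_ : iter g cder _ = fun t => (a ^_ g)%:R%:C * (t ^+ (a - g))%:C);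
  last by apply/funext => s; rewrite IH rmorphM.
rewrite cder_funZ// cder_real.
have -> : derive1 (fun t : R => t ^+ (a - g)) t = (a - g)%:R * t ^+ (a - g).-1.
  by rewrite derive1E exp_derive /GRing.scale /= mulr1.
by rewrite ffactnSr natrM -rmorphM /= mulrA -subnS.
Qed.

Lemma pdo_symbol_tensor (A : {fset mindex n * mindex n}) c (e : eps R) :
  pdo_symbol A c e = fun z => \sum_(ab <- A)
    c ab e * tensor (fun i t => (t ^+ comb ab.1 ab.2 i)%:C) z.
Proof.
apply/funext => z; apply: eq_bigr => ab _; congr (_ * _).
rewrite rmorphM /= !monomialE /tensor [RHS]big_split_ord /=.
by congr (_ * _); apply: eq_bigr => j _; rewrite ffunE ?(unsplitK (inl j)) ?(unsplitK (inr j)) mxE.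
Qed.

Let smooth_pow (ab : mindex n * mindex n) :
  smooth (tensor (fun (i : 'I_(n + n)) t => (t ^+ comb ab.1 ab.2 i)%:C) : _ -> R[i]).
Proof. by apply: smooth_tensor => i; exact/csmooth_real/cinfX/cinf_id. Qed.

Lemma pderiv_pdo_symbol (A : {fset mindex n * mindex n}) c (e : eps R) (g d : mindex n) x k :
  pderiv (comb g d) (pdo_symbol A c e) (row_mx x k) =
  \sum_(ab <- A) c ab e * (\prod_j
    (((ab.1 j ^_ g j)%:R * x 0 j ^+ (ab.1 j - g j)) *
     ((ab.2 j ^_ d j)%:R * k 0 j ^+ (ab.2 j - d j))))%:C.
Proof.
rewrite pdo_symbol_tensor pderivE dseq_sum; last first.
  by move=> ab; apply: smoothM; [exact: smooth_cst|exact: smooth_pow].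
apply: eq_bigr => ab _; rewrite dseqZ//; congr (_ * _).
rewrite -pderivE pderiv_tensor; last by move=> i; exact/csmooth_real/cinfX/cinf_id.
rewrite /tensor; under eq_bigr do rewrite iter_cder_pow.
rewrite big_split_ord /= -!rmorph_prod -rmorphM /=; congr (_%:C).
rewrite [RHS]big_split /=; congr (_ * _); apply: eq_bigr => j _.
- by rewrite !ffunE !(unsplitK (inl j)) row_mxEl.
- by rewrite !ffunE !(unsplitK (inr j)) row_mxEr.
Qed.

(** The explicit coefficient is identified with a Taylor coefficient of the symbol: the bracket is
    the derivative of orders [p.1] in [x] and [p.2] in [k] of [x ^ a k ^ b]. The factor [(- i) ^ b]
    of [Dop] cancels the [i] of each derivative falling on the exponential. *)
Lemma wcoef_ffact a b (p : nat * nat) (x k : R) :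
  (- 'i%C) ^+ b * wcoef a b p x k =
  (- 'i%C) ^+ p.2 * ((p.1`! * p.2`!)%:R^-1 *
    (((a ^_ p.1)%:R * x ^+ (a - p.1)) * ((b ^_ p.2)%:R * k ^+ (b - p.2))))%:C.
Proof.
case: p => g d /=; rewrite /wcoef /=.
have [bd|db] := ltnP b d.
  by rewrite (bin_small bd) (ffact_small bd) !(mul0r, mulr0).
have -> : (- 'i%C : R[i]) ^+ b = (- 'i%C) ^+ d * (- 'i%C) ^+ (b - d).
  by rewrite -exprD subnKC.
have ii : (- 'i%C : R[i]) ^+ (b - d) * ('i%C * k%:C) ^+ (b - d) = (k ^+ (b - d))%:C.
  rewrite exprMn mulrA -exprMn rmorphXn /= (_ : - 'i%C * 'i%C = 1) ?expr1n ?mul1r//.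
  by apply: eq_ReIm; rewrite ?cReM ?cImM /=; ring.
rewrite -mulrA; congr (_ * _).
transitivity (('C(a, g)%:R * x ^+ (a - g))%:C * 'C(b, d)%:R *
  ((- 'i%C) ^+ (b - d) * ('i%C * k%:C) ^+ (b - d))); first by ring.
rewrite ii -!bin_ffact !natrM.
have g0 : (g`!)%:R != 0 :> R by rewrite pnatr_eq0 -lt0n fact_gt0.
have d0 : (d`!)%:R != 0 :> R by rewrite pnatr_eq0 -lt0n fact_gt0.
have -> : ('C(b, d)%:R : R[i]) = ('C(b, d)%:R : R)%:C by rewrite rmorph_nat.
rewrite -!rmorphM /=; congr (_%:C); field; by rewrite g0 d0.
Qed.

Definition left_idx B (f : {ffun 'I_n -> 'I_B * 'I_B}) : mindex n :=
  [ffun j => val (f j).1].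
Definition right_idx B (f : {ffun 'I_n -> 'I_B * 'I_B}) : mindex n :=
  [ffun j => val (f j).2].

(** The Taylor weight [(- i) ^ |d| / (g! d!)] for the multi-indices [g = left_idx f] and
    [d = right_idx f]. *)
Definition phase B (f : {ffun 'I_n -> 'I_B * 'I_B}) : R[i] :=
  \prod_j ((- 'i%C) ^+ val (f j).2 * ((val (f j).1)`! * (val (f j).2)`!)%:R^-1%:C).

(** This form keeps the coefficients [c ab] apart from one another; it serves to estimate operators
    with negligible coefficients term by term. *)
Lemma Tw_pdo_wcoefs B (A : {fset mindex n * mindex n}) (c : mindex n * mindex n -> R[i]) k x F u :
  (forall ab j, ab \in A -> (ab.1 j < B)%N /\ (ab.2 j < B)%N) ->
  testfs F -> smooth u ->
  Tw k x F (fun y => \sum_(ab <- A) c ab * (monomial ab.1 y)%:C * Dop ab.2 u y) =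
  \sum_(ab <- A) \sum_(f : {ffun 'I_n -> 'I_B * 'I_B})
    c ab * ((- 'i%C) ^+ mlen ab.2 * wcoefs ab.1 ab.2 f x k) * Tw k x (wops f F) u.
Proof.
move=> AB tF su.
pose G (ab : mindex n * mindex n) y :=
  (monomial ab.1 y)%:C * pderiv ab.2 u y * wpacket k x F y.
have tG ab : ctame (G ab).
  apply: (@ctame_cube _ _ _ x) => [|y yx]; last by rewrite /G wpacket_outside// mulr0.
  apply: ccontM; last exact: ccont_wpacket.
  apply: ccontM; last by rewrite pderivE; apply/smooth_ccont/smooth_dseq.
  rewrite (_ : (fun _ => _) = tensor (fun j t => (t ^+ ab.1 j)%:C)).
    by apply: ccont_tensor => j; exact/csmooth_real/cinfX/cinf_id.
  by apply/funext => y; exact: monomialE.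
rewrite [LHS]/Tw (eq_integralRn (g := fun y => \sum_(ab <- A)
    (c ab * (- 'i%C) ^+ mlen ab.2) * G ab y)); last first.
  move=> y; rewrite mulr_suml; apply: eq_bigr => ab _; rewrite /Dop /G; ring.
rewrite integralRn_sum; last by move=> ab; exact: ctameZ.
apply: eq_big_seq => ab abA; rewrite integralRnZ// (@Tw_monomial B)//.
- by rewrite mulr_sumr; apply: eq_bigr => f _; ring.
- by move=> j; have [] := AB ab j abA.
- by move=> j; have [] := AB ab j abA.
Qed.

(* The exact symbolic calculus: a differential operator with polynomial
   coefficients acts on wave packets through the finite Taylor expansion of its
   symbol at the centre (x, k) of the packet. *)
Lemma Tw_pdo B (A : {fset mindex n * mindex n}) c (e : eps R) k x F u :
  (forall ab j, ab \in A -> (ab.1 j < B)%N /\ (ab.2 j < B)%N) ->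
  testfs F -> smooth u ->
  Tw k x F (fun y => \sum_(ab <- A) c ab e * (monomial ab.1 y)%:C * Dop ab.2 u y) =
  \sum_(f : {ffun 'I_n -> 'I_B * 'I_B}) phase f *
    pderiv (comb (left_idx f) (right_idx f)) (pdo_symbol A c e) (row_mx x k) *
    Tw k x (wops f F) u.
Proof.
move=> AB tF su.
rewrite (@Tw_pdo_wcoefs B _ (fun ab => c ab e))//.
rewrite exchange_big /=; apply: eq_bigr => f _.
rewrite pderiv_pdo_symbol -mulr_suml mulr_sumr; congr (_ * _).
apply: eq_bigr => ab _; rewrite [RHS]mulrCA; congr (_ * _).
rewrite /mlen -prodrXr /wcoefs /phase rmorph_prod /= -!big_split /=.
apply: eq_bigr => j _; rewrite wcoef_ffact /= !ffunE rmorphM.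
exact: mulrA.
Qed.

End transform_of_operator.

(** * Decay of wave packet coefficients *)

Section uniform_bounds.
Context {R : realType}.

Lemma fin_bound (I : finType) (T : Type) (P : I -> T -> R) (Q : T -> R) :
  (forall i, exists C, forall t, P i t <= C * Q t) -> (forall t, 0 <= Q t) ->
  exists C, 0 <= C /\ forall i t, P i t <= C * Q t.
Proof.
move=> /choice[C HC] Q0; exists (\sum_i `|C i|); split; first exact: sumr_ge0.
move=> i t; apply: le_trans (HC i t) _; rewrite ler_wpM2r//.
by rewrite (le_trans (ler_norm _))// (bigD1 i)//= lerDl sumr_ge0.
Qed.

Lemma fin_max (I : finType) (P : I -> nat -> Prop) :
  (forall i, exists N, P i N) -> (forall i N N', (N <= N')%N -> P i N -> P i N') ->
  exists N, forall i, P i N.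
Proof.
move=> /choice[N HN] Pmono; exists (\max_i N i) => i.
by apply: Pmono (HN i); exact: leq_bigmax.
Qed.

Lemma eps_gt0 (e : eps R) : 0 < (e : R). Proof. by have /andP[] := eps_itv e. Qed.
Lemma eps_le1 (e : eps R) : (e : R) <= 1. Proof. by have /andP[] := eps_itv e. Qed.
Lemma eps_ge0 (e : eps R) : 0 <= (e : R). Proof. exact/ltW/eps_gt0. Qed.
Lemma epsV_ge1 (e : eps R) : 1 <= (e : R)^-1.
Proof. by rewrite invf_ge1 ?eps_gt0 ?eps_le1. Qed.
Lemma epsV_ge0 (e : eps R) : 0 <= (e : R)^-1.
Proof. by rewrite invr_ge0 eps_ge0. Qed.

Lemma eps_expV (e : eps R) N : (e : R) ^+ N * (e : R)^-1 ^+ N = 1.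
Proof. by rewrite -exprMn mulfV ?expr1n// gt_eqF// eps_gt0. Qed.

Lemma eps_mul_expV (e : eps R) q N : (e : R) ^+ (q + N) * (e : R)^-1 ^+ N = (e : R) ^+ q.
Proof. by rewrite exprD -mulrA eps_expV mulr1. Qed.

Lemma epsV_le (e : eps R) N N' : (N <= N')%N -> (e : R)^-1 ^+ N <= (e : R)^-1 ^+ N'.
Proof. by move=> NN; rewrite ler_weXn2l// epsV_ge1. Qed.

Lemma jap_exp_le p (x : 'rV[R]_p) N N' : (N <= N')%N ->
  japanese x ^+ N <= japanese x ^+ N'.
Proof. by move=> NN; rewrite ler_weXn2l// jap_ge1. Qed.

End uniform_bounds.

Section transform_of_nets.
Context {R : realType} {n : nat}.
Local Notation normc := (@complex.ComplexField.Normc.normc R).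
Implicit Types (F : 'I_n -> R -> R) (k x : 'rV[R]_n).

Lemma iter_partialE j i (g : 'rV[R]_n -> R[i]) :
  iter i (partial j) g = pderiv (mcount (nseq i j)) g.
Proof.
rewrite -pderiv_mcount; last first.
  by elim: i => [|[|i] IH] //=; rewrite leqnn.
by elim: i => //= i ->.
Qed.

Definition mono1 (j : 'I_n) M : mindex n := [ffun l => if l == j then M else 0%N].

Lemma monomial_mono1 j M x : monomial (mono1 j M) x = x 0 j ^+ M :> R.
Proof.
rewrite /monomial (bigD1 j)//= ffunE eqxx big1 ?mulr1// => l /negbTE lj.
by rewrite ffunE lj.
Qed.

Definition mzero : mindex n := [ffun=> 0%N].

Lemma monomial0 x : monomial mzero x = 1 :> R.
Proof. by rewrite /monomial big1// => j _; rewrite ffunE. Qed.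

Lemma pderiv0 (g : 'rV[R]_n -> R[i]) : pderiv mzero g = g.
Proof.
rewrite /pderiv; elim: (enum 'I_n) => //= i r ->.
by rewrite ffunE.
Qed.

(* Bounds in the weighted class of rate [s e]; [s e = e ^- N] gives
   [E_S_infty] and [s e = e ^+ q] gives [N_S]. *)
Definition schwartz_rate (g : net R n) (s : eps R -> R) : Prop :=
  forall alpha beta : mindex n, exists C : R, forall (e : eps R) x,
    normc ((monomial alpha x)%:C * pderiv beta (g e) x) <= C * s e.

Lemma schwartz_rate_jap g s beta M : schwartz_rate g s -> (forall e, 0 <= s e) ->
  exists C, 0 <= C /\ forall (e : eps R) x,
    normc (pderiv beta (g e) x) * japanese x ^+ M <= C * s e.
Proof.
move=> gs s0; have [D [D0 HD]] := @jap_pow_le R n M.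
have [C1 [C10 H1]] : exists C, 0 <= C /\ forall (j : 'I_n) (t : eps R * 'rV[R]_n),
    `|t.2 0 j| ^+ M * normc (pderiv beta (g t.1) t.2) <= C * s t.1.
  apply: fin_bound => // j; have [C HC] := gs (mono1 j M) beta.
  exists C => -[e x] /=; apply: le_trans (HC e x).
  by rewrite normcM normc_real monomial_mono1 normrX.
have [C2 H2] := gs mzero beta.
exists (D * (`|C2| + \sum_(j < n) C1)); split.
  by rewrite mulr_ge0// addr_ge0// sumr_ge0.
move=> e x; set P := normc _; have P0 : 0 <= P by exact: normc_ge0.
apply: (@le_trans _ _ (D * (1 + \sum_j `|x 0 j| ^+ M) * P)).
  by rewrite mulrC ler_wpM2r.
rewrite -!mulrA ler_wpM2l// !mulrDl mul1r lerD//.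
  apply: (@le_trans _ _ (C2 * s e)); last by rewrite ler_wpM2r// ler_norm.
  by have := H2 e x; rewrite monomial0 normcM normc_real normr1 mul1r.
by rewrite !mulr_suml; apply: ler_sum => j _; exact: (H1 j (e, x)).
Qed.

Lemma Tw_schwartz g s M F : smooth_net g -> schwartz_rate g s ->
  (forall e, 0 <= s e) -> testfs F ->
  exists C, 0 <= C /\ forall (e : eps R) k x,
    japanese k ^+ M * normc (Tw k x F (g e)) <= C * (s e * (japanese x ^+ M)^-1).
Proof.
move=> sg gs s0 tF; have [D [D0 HD]] := Tw_decay M tF.
pose cn : R := 2 * n%:R + 2; have cn0 : 0 <= cn by rewrite addr_ge0// mulr_ge0.
have H beta : exists C, forall t : eps R * 'rV[R]_n,
    normc (pderiv beta (g t.1) t.2) * japanese t.2 ^+ M <= C * s t.1.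
  by have [C [_ HC]] := schwartz_rate_jap beta M gs s0; exists C => -[e x]; exact: HC.
have [C1 [C10 H1]] := @fin_bound R ('I_n * 'I_M.+1)%type _ _ _
  (fun p => H (mcount (nseq p.2 p.1))) (fun t => s0 t.1).
have [C2 [C20 H2]] := schwartz_rate_jap mzero M gs s0.
(* On the cube [<x>] and [<y>] are comparable, so decay at [y] becomes decay at the centre [x] at
   the price of [cn ^+ M]. *)
have cube (x y : 'rV[R]_n) (P C : R) (e : eps R) : in_cube x y -> 0 <= P ->
    P * japanese y ^+ M <= C * s e ->
    P <= C * s e * cn ^+ M * (japanese x ^+ M)^-1.
  move=> /jap_cube[_ xy] P0 PC; rewrite ler_pdivlMr ?exprn_gt0 ?jap_gt0//.
  apply: (@le_trans _ _ (P * (cn ^+ M * japanese y ^+ M))).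
    by rewrite ler_wpM2l// -exprMn lerXn2r ?nnegrE ?mulr_ge0 ?jap_ge0.
  by rewrite mulrCA [leRHS]mulrC ler_wpM2l// exprn_ge0.
exists (D * ((C1 + C2) * cn ^+ M)); split.
  by rewrite !mulr_ge0 ?addr_ge0 ?exprn_ge0.
move=> e k x; pose B := (C1 + C2) * s e * cn ^+ M * (japanese x ^+ M)^-1.
have -> : D * ((C1 + C2) * cn ^+ M) * (s e * (japanese x ^+ M)^-1) = D * B.
  by rewrite /B; ring.
have le12 (C : R) : C <= C1 + C2 -> C * s e <= (C1 + C2) * s e.
  by move=> CC; rewrite ler_wpM2r.
apply: HD => [|y yx|j i y iM yx]; first exact: sg.
- apply: cube => //; first exact: normc_ge0.
  have := H2 e y; rewrite pderiv0 => /le_trans; apply; apply: le12.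
  by rewrite lerDr.
- apply: cube => //; first exact: normc_ge0.
  rewrite iter_partialE; have := H1 (j, Ordinal (iM : (i < M.+1)%N)) (e, y).
  by move=> /= /le_trans; apply; apply: le12; rewrite lerDl.
Qed.

(* The growth condition in [E_tau]. *)
Definition tempered (u : net R n) : Prop := forall alpha : mindex n,
  exists (N : nat) (C : R), forall (e : eps R) x,
    normc (pderiv alpha (u e) x) <= C * ((e : R)^-1 ^+ N * japanese x ^+ N).

Lemma tempered_mono u (alpha : mindex n) N N' : (N <= N')%N ->
  (exists C, forall (e : eps R) x,
    normc (pderiv alpha (u e) x) <= C * ((e : R)^-1 ^+ N * japanese x ^+ N)) ->
  exists C, forall (e : eps R) x,
    normc (pderiv alpha (u e) x) <= C * ((e : R)^-1 ^+ N' * japanese x ^+ N').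
Proof.
move=> NN [C HC]; exists `|C| => e x; apply: le_trans (HC e x) _.
have w0 M : 0 <= (e : R)^-1 ^+ M * japanese x ^+ M.
  by rewrite mulr_ge0 ?exprn_ge0 ?jap_ge0 ?epsV_ge0.
apply: (@le_trans _ _ (`|C| * ((e : R)^-1 ^+ N * japanese x ^+ N))).
  by rewrite ler_wpM2r// ler_norm.
by rewrite ler_wpM2l// ler_pM ?exprn_ge0 ?jap_ge0 ?epsV_ge0// ?epsV_le ?jap_exp_le.
Qed.

(** Only finitely many derivatives of [u], those of order at most [M] in one coordinate, enter the
    bound. Hence one exponent [N] serves all test functions. *)
Lemma Tw_tempered u M : smooth_net u -> tempered u ->
  exists N : nat, forall F, testfs F -> exists C, 0 <= C /\ forall (e : eps R) k x,
    japanese k ^+ M * normc (Tw k x F (u e)) <=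
      C * ((e : R)^-1 ^+ N * japanese x ^+ N).
Proof.
move=> su tu.
(* [None] stands for [u] itself, whose bound [Tw_decay] requires separately from those of the
   derivatives. *)
pose P (p : option ('I_n * 'I_M.+1)) N := exists C, forall (e : eps R) x,
  normc (pderiv (if p is Some q then mcount (nseq q.2 q.1) else mzero) (u e) x) <=
    C * ((e : R)^-1 ^+ N * japanese x ^+ N).
have [N HN] : exists N, forall p, P p N.
  apply: fin_max => [p|p N N']; first exact: tu.
  exact: tempered_mono.
have w0 (e : eps R) (x : 'rV[R]_n) : 0 <= (e : R)^-1 ^+ N * japanese x ^+ N.
  by rewrite mulr_ge0 ?exprn_ge0 ?jap_ge0 ?epsV_ge0.
exists N => F tF; have [D [D0 HD]] := Tw_decay M tF.
pose cn : R := 2 * n%:R + 2; have cn0 : 0 <= cn by rewrite addr_ge0// mulr_ge0.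
pose T := (eps R * 'rV[R]_n)%type; pose I := option ('I_n * 'I_M.+1)%type.
pose al (p : I) := if p is Some q then mcount (nseq q.2 q.1) else mzero.
have H (p : I) : exists C, forall t : T,
    normc (pderiv (al p) (u t.1) t.2) <= C * ((t.1 : R)^-1 ^+ N * japanese t.2 ^+ N).
  by have [C HC] := HN p; exists C => -[e x]; exact: HC.
have [C [C0 HC]] := fin_bound H (fun t => w0 t.1 t.2).
exists (D * (C * cn ^+ N)); split; first by rewrite !mulr_ge0 ?exprn_ge0.
move=> e k x.
have -> : D * (C * cn ^+ N) * ((e : R)^-1 ^+ N * japanese x ^+ N) =
    D * (C * ((e : R)^-1 ^+ N * (cn * japanese x) ^+ N)).
  by rewrite exprMn; ring.
have cube y : in_cube x y -> C * ((e : R)^-1 ^+ N * japanese y ^+ N) <=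
    C * ((e : R)^-1 ^+ N * (cn * japanese x) ^+ N).
  move=> /jap_cube[yx _]; rewrite ler_wpM2l// ler_wpM2l ?exprn_ge0 ?epsV_ge0//.
  by rewrite lerXn2r ?nnegrE ?mulr_ge0 ?jap_ge0.
apply: HD => [|y yx|j i y iM yx]; first exact: su.
- by apply: le_trans (cube y yx); have := HC None (e, y); rewrite /= pderiv0.
- apply: le_trans (cube y yx); rewrite iter_partialE.
  exact: (HC (Some (j, Ordinal (iM : (i < M.+1)%N))) (e, y)).
Qed.

Lemma wcoefs_bound B (alpha beta : mindex n) (f : {ffun 'I_n -> 'I_B * 'I_B}) :
  (forall j, alpha j <= B)%N -> (forall j, beta j <= B)%N ->
  exists C, 0 <= C /\ forall x k,
    normc (wcoefs alpha beta f x k) <=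
      C * (japanese x ^+ (B * n) * japanese k ^+ (B * n)).
Proof.
move=> aB bB.
pose c j : R := 'C(alpha j, val (f j).1)%:R * 'C(beta j, val (f j).2)%:R.
exists (\prod_j c j); split; first by apply: prodr_ge0 => j _; rewrite mulr_ge0.
move=> x k.
have -> : \prod_j c j * (japanese x ^+ (B * n) * japanese k ^+ (B * n)) =
    \prod_j (c j * (japanese x ^+ B * japanese k ^+ B)).
  transitivity (\prod_j c j * \prod_(j < n) (japanese x ^+ B * japanese k ^+ B)).
    by rewrite prodr_const card_ord exprMn -!exprM.
  exact/esym/big_split.
rewrite /wcoefs normc_prod; apply: ler_prod => j _; rewrite normc_ge0.
rewrite /wcoef normcM normc_real /= normcM normcX normcM normc_i mul1r normc_real.
rewrite normrM normrX (ger0_norm (ler0n _ _)).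
have -> : normc ('C(beta j, val (f j).2)%:R) = 'C(beta j, val (f j).2)%:R.
  by rewrite -(rmorph_nat (real_complex R)) normc_real ger0_norm.
have p a b (y : 'rV[R]_n) : (a <= B)%N -> `|y 0 j| ^+ (a - b) <= japanese y ^+ B.
  move=> aB'; apply: (@le_trans _ _ (japanese y ^+ (a - b))).
    by rewrite lerXn2r ?nnegrE ?jap_ge0// coord_le_jap.
  by rewrite jap_exp_le// (leq_trans (leq_subr _ _)).
have h1 := p (alpha j) (val (f j).1) x (aB j).
have h2 := p (beta j) (val (f j).2) k (bB j).
rewrite /c mulrACA -!mulrA; do 2 rewrite ler_wpM2l//; rewrite ler_pM ?exprn_ge0//.
Qed.

End transform_of_nets.

Section wave_decay.
Context {R : realType} {n : nat}.
Local Notation normc := (@complex.ComplexField.Normc.normc R).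
Implicit Types (F : 'I_n -> R -> R) (k x : 'rV[R]_n) (g h u : net R n).

Definition rate N M M' q (e : eps R) x : R :=
  (e : R)^-1 ^+ N * (japanese x ^+ M)^-1 + (e : R) ^+ q * japanese x ^+ M'.

Lemma rate_ge0 N M M' q e x : 0 <= rate N M M' q e x.
Proof.
by rewrite /rate addr_ge0// mulr_ge0 ?invr_ge0 ?exprn_ge0 ?jap_ge0 ?epsV_ge0 ?eps_ge0.
Qed.

Lemma rate_mono N1 N2 M M1 M2 q e x : (N1 <= N2)%N -> (M1 <= M2)%N ->
  rate N1 M M1 q e x <= rate N2 M M2 q e x.
Proof.
move=> NN MM; apply: lerD.
  by rewrite ler_wpM2r ?invr_ge0 ?exprn_ge0 ?jap_ge0// epsV_le.
by rewrite ler_wpM2l ?exprn_ge0 ?eps_ge0// jap_exp_le.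
Qed.

(* Rapid decay of all wave packet coefficients, up to errors that are
   negligible in [e] but grow polynomially in [x]: the growth exponent [M'] does
   not depend on [q]. *)
Definition wave_decay g N : Prop := forall M, exists M' : nat, forall q F, testfs F ->
  exists C, 0 <= C /\ forall (e : eps R) k x,
    japanese k ^+ M * normc (Tw k x F (g e)) <= C * rate N M M' q e x.

Lemma TwD k x F (f1 f2 : 'rV[R]_n -> R[i]) : testfs F -> smooth f1 -> smooth f2 ->
  Tw k x F (fun y => f1 y + f2 y) = Tw k x F f1 + Tw k x F f2.
Proof.
move=> tF s1 s2; rewrite /Tw -integralRnD.
- by apply: eq_integralRn => y; rewrite mulrDl.
- by apply: ctame_wpacket => //; exact: smooth_ccont.
- by apply: ctame_wpacket => //; exact: smooth_ccont.
Qed.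

Lemma wave_decayD g h N1 N2 : smooth_net g -> smooth_net h ->
  wave_decay g N1 -> wave_decay h N2 ->
  wave_decay (fun e x => g e x + h e x) (N1 + N2).
Proof.
move=> sg sh dg dh M; have [M1 H1] := dg M; have [M2 H2] := dh M.
exists (M1 + M2)%N => q F tF.
have [C1 [C10 {}H1]] := H1 q F tF; have [C2 [C20 {}H2]] := H2 q F tF.
exists (C1 + C2); split; first exact: addr_ge0.
move=> e k x; rewrite TwD//.
apply: (@le_trans _ _ (japanese k ^+ M * (normc (Tw k x F (g e)) + normc (Tw k x F (h e))))).
  by rewrite ler_wpM2l ?exprn_ge0 ?jap_ge0 ?le_normcD.
rewrite mulrDr mulrDl lerD//.
- by apply: le_trans (H1 e k x) _; rewrite ler_wpM2l// rate_mono ?leq_addr.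
- by apply: le_trans (H2 e k x) _; rewrite ler_wpM2l// rate_mono ?leq_addl.
Qed.

Lemma wave_decay_schwartz g N : smooth_net g ->
  schwartz_rate g (fun e => (e : R)^-1 ^+ N) -> wave_decay g N.
Proof.
move=> sg gs M; exists 0%N => q F tF.
have s0 (e : eps R) : 0 <= (e : R)^-1 ^+ N by rewrite exprn_ge0 ?epsV_ge0.
have [C [C0 HC]] := Tw_schwartz M sg gs s0 tF.
exists C; split => // e k x; apply: le_trans (HC e k x) _; rewrite ler_wpM2l//.
by rewrite /rate lerDl mulr_ge0 ?exprn_ge0 ?eps_ge0 ?jap_ge0.
Qed.

Lemma wave_decay_negligible g : smooth_net g ->
  (forall q, schwartz_rate g (fun e => (e : R) ^+ q)) -> wave_decay g 0.
Proof.
move=> sg gs M; exists 0%N => q F tF.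
have s0 (e : eps R) : 0 <= (e : R) ^+ q by rewrite exprn_ge0 ?eps_ge0.
have [C [C0 HC]] := Tw_schwartz M sg (gs q) s0 tF.
exists C; split => // e k x; apply: le_trans (HC e k x) _; rewrite ler_wpM2l//.
rewrite /rate -[leLHS]add0r lerD//.
  by rewrite mulr_ge0 ?invr_ge0 ?exprn_ge0 ?epsV_ge0 ?jap_ge0.
rewrite ler_wpM2l// expr0 invf_le1; last by rewrite exprn_gt0 ?jap_gt0.
by rewrite exprn_ege1 ?jap_ge1.
Qed.

Definition pdo_net (A : {fset mindex n * mindex n})
    (c : mindex n * mindex n -> cnet R) u : net R n :=
  fun e y => \sum_(ab <- A) c ab e * (monomial ab.1 y)%:C * Dop ab.2 (u e) y.

Lemma smooth_monomial (alpha : mindex n) :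
  smooth (fun y : 'rV[R]_n => (monomial alpha y)%:C).
Proof.
rewrite (_ : (fun _ => _) = tensor (fun j t => (t ^+ alpha j)%:C)).
  by apply: smooth_tensor => j; exact/csmooth_real/cinfX/cinf_id.
by apply/funext => y; exact: monomialE.
Qed.

Lemma smooth_pdo_net A c u : smooth_net u -> smooth_net (pdo_net A c u).
Proof.
move=> su e; apply: smooth_sum => ab; apply: smoothM.
  by apply: smoothM; [exact: smooth_cst|exact: smooth_monomial].
apply: smoothM; first exact: smooth_cst.
by rewrite pderivE; exact/smooth_dseq/su.
Qed.

Lemma fset_degree_bound (A : {fset mindex n * mindex n}) :
  exists B, forall ab j, ab \in A -> (ab.1 j < B)%N /\ (ab.2 j < B)%N.
Proof.
pose B := (\sum_(ab <- A) \sum_(j < n) (ab.1 j + ab.2 j))%N.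
exists B.+1 => ab j abA.
have h : (ab.1 j + ab.2 j <= B)%N.
  rewrite /B (big_rem ab)//= (bigD1 j)//= -!addnA.
  by rewrite addnA leq_addr.
by split; rewrite ltnS (leq_trans _ h)// ?leq_addr ?leq_addl.
Qed.

(** The factors [wcoefs] grow at most like [<x> ^ (B n) <k> ^ (B n)]. The power of [k] is paid by
    asking [Tw_tempered] for [M + B n], that of [x] goes into [M'], and smallness of the
    coefficients at order [q + N] pays for [e ^ -N]. Both [N] and [M'] are fixed before [q]. *)
Lemma wave_decay_coeff A (d : mindex n * mindex n -> cnet R) u :
  (forall ab, ab \in A -> N_o (d ab)) -> smooth_net u -> tempered u ->
  wave_decay (pdo_net A d u) 0.
Proof.
move=> dN su tu M; have [B AB] := fset_degree_bound A.
have [N HN] := Tw_tempered (M + B * n) su tu.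
exists (N + B * n)%N => q F tF.
have /choice[c1 Hc1] (f : {ffun 'I_n -> 'I_B * 'I_B}) := HN _ (testfs_wops f tF).
have /choice[c2 Hc2] (ab : mindex n * mindex n) : exists C, 0 <= C /\ (ab \in A ->
    forall (f : {ffun 'I_n -> 'I_B * 'I_B}) (t : 'rV[R]_n * 'rV[R]_n),
    normc (wcoefs ab.1 ab.2 f t.1 t.2) <=
      C * (japanese t.1 ^+ (B * n) * japanese t.2 ^+ (B * n))).
  have [abA|] := boolP (ab \in A); last by exists 0.
  have H (f : {ffun 'I_n -> 'I_B * 'I_B}) : exists C, forall t : 'rV[R]_n * 'rV[R]_n,
      normc (wcoefs ab.1 ab.2 f t.1 t.2) <=
        C * (japanese t.1 ^+ (B * n) * japanese t.2 ^+ (B * n)).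
    have [|j|C [_ HC]] := @wcoefs_bound R n B ab.1 ab.2 f _ _.
    - by move=> j; apply: ltnW; have [] := AB ab j abA.
    - by apply: ltnW; have [] := AB ab j abA.
    - by exists C => -[x k]; exact: HC.
  have [|C [C0 HC]] := fin_bound H.
    by move=> t; rewrite mulr_ge0 ?exprn_ge0 ?jap_ge0.
  by exists C.
have /choice[c3 Hc3] (ab : mindex n * mindex n) : exists C, 0 <= C /\ (ab \in A ->
    forall e : eps R, normc (d ab e) <= C * (e : R) ^+ (q + N)).
  have [abA|] := boolP (ab \in A); last by exists 0.
  have [C HC] := dN ab abA (q + N)%N; exists `|C|; split => // _ e.
  rewrite -ler_pdivrMr ?exprn_gt0 ?eps_gt0// -exprVn mulrC.
  exact: le_trans (HC e) (ler_norm _).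
exists (\sum_(ab <- A) \sum_f c3 ab * c2 ab * c1 f); split.
  apply: sumr_ge0 => ab _; apply: sumr_ge0 => f _; rewrite !mulr_ge0//.
  - by have [] := Hc3 ab.
  - by have [] := Hc2 ab.
  - by have [] := Hc1 f.
move=> e k x; rewrite /pdo_net (@Tw_pdo_wcoefs _ _ B _ (fun ab => d ab e))//.
apply: (@le_trans _ _ (japanese k ^+ M *
    \sum_(ab <- A) \sum_(f : {ffun 'I_n -> 'I_B * 'I_B})
     normc (d ab e) * normc (wcoefs ab.1 ab.2 f x k) * normc (Tw k x (wops f F) (u e)))).
  rewrite ler_wpM2l ?exprn_ge0 ?jap_ge0// (le_trans (normc_sum _ _ _))//.
  apply: ler_sum => ab _; rewrite (le_trans (normc_sum _ _ _))//.
  apply: ler_sum => f _.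
  by rewrite !normcM normcX normcN normc_i expr1n mul1r.
rewrite mulr_sumr mulr_suml big_seq [leRHS]big_seq; apply: ler_sum => ab abA.
rewrite mulr_sumr mulr_suml; apply: ler_sum => f _.
have [c10 h1] := Hc1 f; have [c20 /(_ abA f (x, k)) /= h2] := Hc2 ab.
have [c30 /(_ abA e) h3] := Hc3 ab.
have jk a : 0 <= japanese k ^+ a by rewrite exprn_ge0 ?jap_ge0.
have jx a : 0 <= japanese x ^+ a by rewrite exprn_ge0 ?jap_ge0.
have ee a : 0 <= (e : R) ^+ a by rewrite exprn_ge0 ?eps_ge0.
apply: (@le_trans _ _ (japanese k ^+ M * (c3 ab * (e : R) ^+ (q + N) *
   (c2 ab * (japanese x ^+ (B * n) * japanese k ^+ (B * n))) *
   normc (Tw k x (wops f F) (u e))))).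
  rewrite ler_wpM2l// ler_wpM2r ?normc_ge0// ler_pM ?normc_ge0//.
have -> : japanese k ^+ M * (c3 ab * (e : R) ^+ (q + N) *
   (c2 ab * (japanese x ^+ (B * n) * japanese k ^+ (B * n))) *
   normc (Tw k x (wops f F) (u e))) =
   (c3 ab * c2 ab * (e : R) ^+ (q + N) * japanese x ^+ (B * n)) *
   (japanese k ^+ (M + B * n) * normc (Tw k x (wops f F) (u e))).
  by rewrite [_ ^+ (M + _)]exprD; ring.
apply: (@le_trans _ _ ((c3 ab * c2 ab * (e : R) ^+ (q + N) * japanese x ^+ (B * n)) *
   (c1 f * ((e : R)^-1 ^+ N * japanese x ^+ N)))).
  by rewrite ler_wpM2l// !mulr_ge0.
have -> : (c3 ab * c2 ab * (e : R) ^+ (q + N) * japanese x ^+ (B * n)) *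
   (c1 f * ((e : R)^-1 ^+ N * japanese x ^+ N)) =
   (c3 ab * c2 ab * c1 f) * ((e : R) ^+ q * japanese x ^+ (N + B * n)).
  by rewrite -(eps_mul_expV e q N) [japanese x ^+ (N + _)]exprD; ring.
by rewrite ler_wpM2l ?mulr_ge0// /rate lerDr mulr_ge0 ?invr_ge0//.

Qed.

End wave_decay.

(** * Parametrix *)

Section parametrix.
Context {R : realType}.
Local Notation normc := (@complex.ComplexField.Normc.normc R).

(** Each use of the inequality moves from [F] to the [op f F], so the induction on [K] is over all
    good [F] at once. Since [lam <= 1], the term [G] is only multiplied by constants while the a
    priori bound [U] acquires [lam ^ K]. *)
Lemma iterate_gain (Phi T : Type) (I : finType) (good : Phi -> Prop) (op : I -> Phi -> Phi)
    (dom : T -> Prop) (a : Phi -> T -> R) (G lam U : T -> R) :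
  (forall f F, good F -> good (op f F)) ->
  (forall t, dom t -> 0 <= G t) -> (forall t, dom t -> 0 <= lam t <= 1) ->
  (forall t, dom t -> 0 <= U t) ->
  (forall F, good F -> exists C, 0 <= C /\ forall t, dom t -> a F t <= C * U t) ->
  (forall F, good F -> exists C D, [/\ 0 <= C, 0 <= D & forall t, dom t ->
     a F t <= C * G t + \sum_f D * lam t * a (op f F) t]) ->
  forall K F, good F -> exists C, 0 <= C /\
    forall t, dom t -> a F t <= C * (G t + lam t ^+ K * U t).
Proof.
move=> gop G0 lam01 U0 aU aG; elim=> [|K IH] F gF.
  have [C [C0 HC]] := aU F gF; exists C; split => // t dt.
  apply: le_trans (HC t dt) _; rewrite expr0 mul1r ler_wpM2l// lerDr; exact: G0.
have [C [D [C0 D0 HC]]] := aG F gF.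
have /choice[E HE] f := IH _ (gop f F gF).
exists (C + \sum_f D * E f); split.
  by rewrite addr_ge0// sumr_ge0// => f _; rewrite mulr_ge0//; have [] := HE f.
move=> t dt; apply: le_trans (HC t dt) _.
have /andP[l0 l1] := lam01 t dt; have g0 := G0 t dt; have u0 := U0 t dt.
have lK0 : 0 <= lam t ^+ K * U t by rewrite mulr_ge0 ?exprn_ge0.
rewrite mulrDl lerD//.
  by rewrite ler_wpM2l// lerDl mulr_ge0 ?exprn_ge0.
rewrite mulr_suml; apply: ler_sum => f _; have [E0 /(_ t dt) h] := HE f.
rewrite -!mulrA ler_wpM2l//; apply: (@le_trans _ _ (lam t * (E f * (G t + lam t ^+ K * U t)))).
  by rewrite ler_wpM2l.
rewrite mulrCA ler_wpM2l// mulrDr lerD//.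
  by rewrite ler_piMl.
by rewrite exprS -mulrA.
Qed.

(** * Comparison of the weight function with powers of [japanese] *)

Section weight_bounds.
Context {p : nat}.
Variables (Lambda : 'rV[R]_p -> R) (Lambda_weight : weight Lambda).

Lemma weight_lower : exists mu b : R, [/\ 0 < mu, 0 < b &
  forall z, b * japanese z `^ mu <= Lambda z].
Proof.
have [_ [mu [mu0 [c c0 h] _ _]] _] := Lambda_weight.
exists mu, c^-1; split => //; first by rewrite invr_gt0.
by move=> z; rewrite ler_pdivrMl// h.
Qed.

Lemma weight_upper : exists B : R, 0 < B /\ forall z, Lambda z <= B * japanese z.
Proof.
have [_ [mu [_ _ [c c0 h] _]] _] := Lambda_weight.
by exists c; split => // z; exact: h.
Qed.

Lemma powR_jap_ge1 (s : R) (z : 'rV[R]_p) : 0 <= s -> 1 <= japanese z `^ s.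
Proof. by move=> s0; rewrite -[leLHS](powRr0 (japanese z)) ler_powR ?jap_ge1. Qed.

Lemma weight_gt0 z : 0 < Lambda z.
Proof.
have [mu [b [mu0 b0 h]]] := weight_lower; apply: lt_le_trans (h z).
by rewrite mulr_gt0// powR_gt0// jap_gt0.
Qed.

(** The exponent [l] may have either sign, so both the weight and its inverse are dominated by the
    same [w = D <z>]; the sign of [l] decides which bound is raised to the power [|l|]. *)
Lemma weight_powV_le (l : R) : exists (L : nat) (C : R), 0 <= C /\
  forall z, (Lambda z `^ l)^-1 <= C * japanese z ^+ L.
Proof.
have [mu [b [mu0 b0 hb]]] := weight_lower; have [B [B0 hB]] := weight_upper.
have [L hL] : exists L : nat, `|l| <= L%:R.
  by exists (Num.bound `|l|); apply/ltW/archi_boundP.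
pose D := 1 + B + b^-1; have bV : 0 < b^-1 by rewrite invr_gt0.
exists L, (D ^+ L); split; first by rewrite exprn_ge0// !addr_ge0// ltW.
move=> z; rewrite -exprMn; set w := D * japanese z.
have j1 := jap_ge1 z; have w1 : 1 <= w by rewrite /w /D; nra.
have Lw : Lambda z <= w by rewrite (le_trans (hB z))// ler_wpM2r ?jap_ge0// /D; lra.
have L0 := weight_gt0 z.
have Lw' : (Lambda z)^-1 <= w.
  apply: (@le_trans _ _ b^-1); last by rewrite /w /D; nra.
  rewrite lef_pV2 ?posrE//; apply: le_trans (hb z).
  by rewrite ler_peMr ?(ltW b0)// powR_jap_ge1// ltW.
rewrite -powR_mulrn; last by lra.
have [l0|l0] := leP 0 l.
  rewrite -powRN.
  apply: (@le_trans _ _ (w `^ l)); last by rewrite ler_powR// (le_trans (ler_norm l)).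
  have -> : Lambda z `^ (- l) = ((Lambda z)^-1) `^ l.
    by rewrite -powR_inv1 ?ltW// -powRrM mulN1r.
  by rewrite ge0_ler_powR// ?nnegrE ?invr_ge0 ?ltW// (lt_le_trans ltr01).
rewrite -powRN; apply: (@le_trans _ _ (w `^ (- l))); last first.
  by rewrite ler_powR// (le_trans _ hL)// -normrN ler_norm.
by rewrite ge0_ler_powR// ?nnegrE ?oppr_ge0 ?ltW// (lt_le_trans ltr01).
Qed.

(** [s = mu rho] is the gain of a single derivative; as [<z> >= 1], derivatives of higher order gain
    at least as much. *)
Lemma weight_gain (rho : R) : 0 < rho -> exists s : R, 0 < s /\
  forall g : nat, (0 < g)%N -> exists C, 0 <= C /\
  forall z, Lambda z `^ (- rho * g%:R) <= C * japanese z `^ (- s).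
Proof.
move=> rho0; have [mu [b [mu0 b0 hb]]] := weight_lower.
exists (mu * rho); split; first by rewrite mulr_gt0.
move=> g g0; exists (b `^ (- rho * g%:R)); split; first exact: powR_ge0.
move=> z; have j1 := jap_ge1 z; have L0 := weight_gt0 z.
have jm0 : 0 < japanese z `^ mu by rewrite powR_gt0// jap_gt0.
apply: (@le_trans _ _ ((b * japanese z `^ mu) `^ (- rho * g%:R))).
  rewrite !mulNr !powRN lef_pV2 ?posrE ?powR_gt0 ?mulr_gt0//.
  by apply: ge0_ler_powR; rewrite ?nnegrE ?mulr_ge0 ?(ltW L0) ?(ltW b0) ?(ltW rho0) ?(ltW jm0) ?hb.
rewrite powRM ?(ltW b0) ?(ltW jm0)// ler_wpM2l ?powR_ge0// -powRrM ler_powR//.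
rewrite mulNr mulrN lerN2 mulrA ler_peMr ?mulr_ge0 ?(ltW mu0) ?(ltW rho0)//.
by rewrite ler1n.
Qed.

End weight_bounds.

Lemma powR_gain p (s : R) P : 0 < s -> exists K : nat, forall z : 'rV[R]_p,
  (japanese z `^ (- s)) ^+ K <= (japanese z ^+ P)^-1.
Proof.
move=> s0; exists (Num.bound (P%:R / s)) => z.
have j0 := jap_gt0 z.
rewrite -powR_mulrn ?powR_ge0// -powRrM mulNr powRN lef_pV2 ?posrE ?powR_gt0 ?exprn_gt0//.
rewrite -powR_mulrn ?jap_ge0// ler_powR ?jap_ge1// -ler_pdivrMl// mulrC.
by apply/ltW/archi_boundP; rewrite divr_ge0// ltW.
Qed.

Section hypoelliptic_operator.
Context {n : nat}.
Variables (Lambda : 'rV[R]_(n + n) -> R) (m l rho : R) (N : nat).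
Hypotheses (Lambda_weight : weight Lambda) (rho0 : 0 < rho).
Variables (A : {fset mindex n * mindex n}) (c : mindex n * mindex n -> cnet R).
Hypothesis c_hypoelliptic : hypoelliptic Lambda m l rho N (pdo_symbol A c).
Variable u : net R n.
Hypotheses (su : smooth_net u) (tu : tempered u).
Implicit Types (F : 'I_n -> R -> R) (k x : 'rV[R]_n).

Lemma mlen_comb_gt0 B (f : {ffun 'I_n -> 'I_B.+1 * 'I_B.+1}) :
  f != [ffun=> (ord0, ord0)] -> (0 < mlen (comb (left_idx f) (right_idx f)))%N.
Proof.
apply: contraR; rewrite -eqn0Ngt /mlen big_split_ord /= addn_eq0 !sum_nat_eq0.
move=> /andP[/forallP f1 /forallP f2]; apply/eqP/ffunP => j.
have := f1 j; have := f2 j; rewrite !ffunE ?(unsplitK (inl j)) ?(unsplitK (inr j)) !ffunE.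
by case: (f j) => a b /= /eqP b0 /eqP a0; congr pair; apply/val_inj.
Qed.

Lemma wops0 B F : wops ([ffun=> (ord0, ord0)] : {ffun 'I_n -> 'I_B.+1 * 'I_B.+1}) F = F.
Proof.
apply/funext => j; apply/funext => t.
by rewrite /wops ffunE /wop /= expr0 mul1r.
Qed.

Lemma phase0 B :
  phase ([ffun=> (ord0, ord0)] : {ffun 'I_n -> 'I_B.+1 * 'I_B.+1}) = 1 :> R[i].
Proof.
rewrite /phase big1// => j _; rewrite ffunE /= expr0 mul1r.
by rewrite fact0 muln1 invr1.
Qed.

Lemma comb0 B (f := [ffun=> (ord0, ord0)] : {ffun 'I_n -> 'I_B.+1 * 'I_B.+1}) :
  comb (left_idx f) (right_idx f) = mzero.
Proof. by apply/ffunP => i; rewrite !ffunE; case: fintype.split => j; rewrite !ffunE. Qed.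

(* [Tw_pdo] solved for its leading term and divided by the symbol [a]: by
   hypoellipticity each other term gains a factor [Lambda ^ - rho]. *)
Lemma parametrix_step : exists B r s D (L : nat) E, [/\ 0 < r, 0 < s, 0 <= D, 0 <= E &
  forall F (e : eps R) k x, testfs F -> r <= enorm (row_mx x k) ->
  normc (Tw k x F (u e)) <=
    E * (e : R)^-1 ^+ N * japanese (row_mx x k) ^+ L *
      normc (Tw k x F (pdo_net A c u e)) +
    \sum_(f : {ffun 'I_n -> 'I_B * 'I_B})
      D * japanese (row_mx x k) `^ (- s) * normc (Tw k x (wops f F) (u e))].
Proof.
have [_ [r r0 [[c1 c10 elliptic] hypo]]] := c_hypoelliptic.
have [B AB] : exists B, forall ab j, ab \in A -> (ab.1 j < B.+1)%N /\ (ab.2 j < B.+1)%N.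
  have [B AB] := fset_degree_bound A; exists B => ab j /(AB _ j)[h1 h2].
  by split; exact: leqW.
have [s [s0 gain]] := weight_gain Lambda_weight rho0.
have [L [E [E0 HE]]] := weight_powV_le Lambda_weight l.
pose f0 : {ffun 'I_n -> 'I_B.+1 * 'I_B.+1} := [ffun=> (ord0, ord0)].
(* The hypoelliptic estimates hold only for [|z| >= r]; a subtype of such points lets [fin_bound]
   collect them into one constant. *)
pose T := {t : eps R * 'rV[R]_(n + n) | r <= enorm t.2}.
pose a (t : eps R * 'rV[R]_(n + n)) := pdo_symbol A c t.1 t.2.
have H (f : {ffun 'I_n -> 'I_B.+1 * 'I_B.+1}) : exists C, forall t : T,
    (if f == f0 then 0 else normc (phase f : R[i]) *
      normc (pderiv (comb (left_idx f) (right_idx f))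
        (pdo_symbol A c (val t).1) (val t).2)) <=
    C * (normc (a (val t)) * japanese (val t).2 `^ (- s)).
  case: eqP => [_|/eqP ff0]; first by exists 0 => t; rewrite mul0r.
  have [C [C0 HC]] := gain _ (mlen_comb_gt0 ff0).
  have [d d0 hd] := hypo (comb (left_idx f) (right_idx f)).
  exists (normc (phase f : R[i]) * (d * C)) => -[[e z] /= rz].
  rewrite -!mulrA ler_wpM2l ?normc_ge0//; apply: le_trans (hd e z rz) _.
  by rewrite -mulrA ler_wpM2l ?(ltW d0)// mulrCA ler_wpM2l ?normc_ge0.
have [|D [D0 HD]] := fin_bound H.
  by move=> t; rewrite mulr_ge0 ?normc_ge0 ?powR_ge0.
exists B.+1, r, s, D, L, (c1^-1 * E); split => //.
  by rewrite mulr_ge0// invr_ge0 ltW.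
move=> F e k x tF rz; set z := row_mx x k.
have az : 0 < normc (pdo_symbol A c e z).
  apply: lt_le_trans (elliptic e z rz).
  by rewrite !mulr_gt0 ?exprn_gt0 ?eps_gt0// powR_gt0// weight_gt0.
have Vaz : (normc (pdo_symbol A c e z))^-1 <=
    c1^-1 * E * (e : R)^-1 ^+ N * japanese z ^+ L.
  apply: (@le_trans _ _ (c1 * Lambda z `^ l * (e : R) ^+ N)^-1).
    rewrite lef_pV2 ?posrE// ?elliptic//.
    by rewrite !mulr_gt0 ?exprn_gt0 ?eps_gt0// powR_gt0// weight_gt0.
  rewrite !invfM -exprVn -!mulrA ler_wpM2l ?invr_ge0 ?(ltW c10)//.
  rewrite mulrC [leRHS]mulrCA ler_wpM2l ?exprn_ge0 ?epsV_ge0//.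
have PE := @Tw_pdo _ _ B.+1 A c e k x F (u e) AB tF (su e).
rewrite -/z (bigD1 f0)// phase0 mul1r comb0 pderiv0 wops0 in PE.
have {}PE : pdo_symbol A c e z * Tw k x F (u e) =
   Tw k x F (pdo_net A c u e) - \sum_(f | f != f0) phase f *
    pderiv (comb (left_idx f) (right_idx f)) (pdo_symbol A c e) z *
    Tw k x (wops f F) (u e).
  by rewrite /pdo_net PE addrK.
apply: (@le_trans _ _ ((normc (pdo_symbol A c e z))^-1 *
  (normc (Tw k x F (pdo_net A c u e)) + \sum_(f : {ffun 'I_n -> 'I_B.+1 * 'I_B.+1})
     D * (normc (pdo_symbol A c e z) * japanese z `^ (- s)) *
     normc (Tw k x (wops f F) (u e))))).
  rewrite ler_pdivlMl// -normcM PE (le_trans (normcB _ _))// lerD2l.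
  rewrite (le_trans (normc_sum _ _ _))// [leRHS](bigD1 f0)//= -[leLHS]add0r lerD//.
    by rewrite !mulr_ge0 ?normc_ge0 ?powR_ge0.
  apply: ler_sum => f ff0; rewrite !normcM ler_wpM2r ?normc_ge0//.
  by have := HD f (exist _ (e, z) rz); rewrite (negbTE ff0).
rewrite mulrDr lerD//; first by rewrite ler_wpM2r ?normc_ge0.
rewrite mulr_sumr; apply: ler_sum => f _; rewrite [leLHS](_ : _ =
  D * japanese z `^ (- s) * normc (Tw k x (wops f F) (u e)))//.
by field; rewrite gt_eqF.
Qed.

(** Dividing by the symbol costs [e ^ -N <x> ^ L]. Asking the right-hand side for decay [M + L] and
    error order [q + N] pays for it: what remains is a loss of [N] in the first exponent of [e] and
    of [L] in the growth of the error. *)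
Lemma rate_shift N1 M M1 L q (e : eps R) x :
  (e : R)^-1 ^+ N * japanese x ^+ L * rate N1 (M + L) M1 (q + N) e x =
  rate (N + N1) M (L + M1) q e x.
Proof.
have jx : japanese x ^+ L != 0 by rewrite gt_eqF// exprn_gt0 ?jap_gt0.
have jM : japanese x ^+ M != 0 by rewrite gt_eqF// exprn_gt0 ?jap_gt0.
rewrite /rate -[in RHS](eps_mul_expV e q N) [(e : R)^-1 ^+ (N + _)]exprD.
rewrite [japanese x ^+ (M + L)]exprD [japanese x ^+ (L + _)]exprD mulrDr.
congr (_ + _); last by ring.
by rewrite invfM; field; rewrite jx jM /= ?gt_eqF// ?eps_gt0.
Qed.

Lemma wave_decay_hypoelliptic N1 : wave_decay (pdo_net A c u) N1 ->
  exists N2, wave_decay u N2.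
Proof.
move=> dP; have [B [r [s [D [L [E [r0 s0 D0 E0 step]]]]]]] := parametrix_step.
have [N0 HU] := Tw_tempered 0 su tu.
exists ((N + N1) + N0)%N => M; have [M1 HG] := dP (M + L)%N.
exists (L + M1)%N => q F tF.
pose T := (eps R * 'rV[R]_n * 'rV[R]_n)%type.
pose z (t : T) := row_mx t.1.2 t.2.
pose U (t : T) := (t.1.1 : R)^-1 ^+ N0 * japanese t.1.2 ^+ N0.
(* The iteration is run on the bare coefficients; the factor [<k> ^ M] is multiplied back at the end
   and cancels this inverse. *)
pose G (t : T) := (japanese t.2 ^+ M)^-1 * rate (N + N1) M (L + M1) q t.1.1 t.1.2.
pose a F (t : T) := normc (Tw t.2 t.1.2 F (u t.1.1)).
have aU H : testfs H -> exists C, 0 <= C /\ forall t, a H t <= C * U t.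
  move=> tH; have [C [C0 HC]] := HU H tH; exists C; split => // -[[e x] k].
  by have := HC e k x; rewrite expr0 mul1r.
(* The power of [<(x, k)>] to be gained: [N0] for the growth of [U] in [x], [M] for the wanted decay
   in [k], [M] for that in [x]. Only [K] depends on [M]; the exponent of [e] does not. *)
have [K HK] := @powR_gain (n + n) s (N0 + (M + M)) s0.
have jV (m' : nat) (y : 'rV[R]_n) : 0 <= (japanese y ^+ m')^-1.
  by rewrite invr_ge0 exprn_ge0 ?jap_ge0.
have [|t _|t _|t _|H tH|H tH|C [C0 HC]] := @iterate_gain _ T
  {ffun 'I_n -> 'I_B * 'I_B} testfs (@wops R n B) (fun t => r <= enorm (z t)) a G
  (fun t => japanese (z t) `^ (- s)) U _ _ _ _ _ _ K F tF.
- by move=> f H tH; exact: testfs_wops.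
- by rewrite mulr_ge0// rate_ge0.
- by rewrite powR_ge0 /= powRN invf_le1 ?powR_gt0 ?jap_gt0// powR_jap_ge1// ltW.
- by rewrite mulr_ge0 ?exprn_ge0 ?epsV_ge0 ?jap_ge0.
- by have [C [C0 HC]] := aU H tH; exists C; split => // t _; exact: HC.
- have [C [C0 HC]] := HG (q + N)%N H tH.
  exists (E * C), D; split => //; first by rewrite mulr_ge0.
  move=> -[[e x] k] /= rz; apply: le_trans (step H e k x tH rz) _; rewrite lerD2r.
  have kM : japanese k ^+ M != 0 by rewrite gt_eqF// exprn_gt0 ?jap_gt0.
  (* The loss [<(x, k)> ^ L] is split as [<x> ^ L <k> ^ L]; the second factor is why decay of order
     [M + L] was requested. *)
  apply: (@le_trans _ _ (E * (e : R)^-1 ^+ N * (japanese x * japanese k) ^+ L *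
      normc (Tw k x H (pdo_net A c u e)))).
    rewrite ler_wpM2r ?normc_ge0// ler_wpM2l ?mulr_ge0 ?exprn_ge0 ?epsV_ge0//.
    by rewrite lerXn2r ?nnegrE ?mulr_ge0 ?jap_ge0 ?jap_row_le.
  rewrite (_ : _ * _ = E * (japanese k ^+ M)^-1 * ((e : R)^-1 ^+ N * japanese x ^+ L) *
      (japanese k ^+ (M + L) * normc (Tw k x H (pdo_net A c u e)))); last first.
    by rewrite exprMn [japanese k ^+ (M + L)]exprD; field.
  apply: le_trans (ler_wpM2l _ (HC e k x)) _.
    by rewrite !mulr_ge0 ?exprn_ge0 ?epsV_ge0 ?jap_ge0.
  by rewrite /G /= -rate_shift le_eqVlt; apply/orP; left; apply/eqP; ring.
have [C' [C'0 HC']] := aU F tF.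
(* [<(x, k)> < rr] in the ball [|(x, k)| < r], where no division is possible and the a priori bound
   alone suffices. *)
pose rr := Num.sqrt (1 + r ^+ 2).
exists (C + C + C' * rr ^+ (N0 + (M + M))); split.
  by rewrite !addr_ge0// mulr_ge0// exprn_ge0// sqrtr_ge0.
move=> e k x; set W := rate _ _ _ _ _ _.
have W0 : 0 <= W by exact: rate_ge0.
pose t : T := (e, x, k).
have Wl : (e : R)^-1 ^+ N0 * (japanese x ^+ M)^-1 <= W.
  rewrite /W /rate -[leLHS]addr0 lerD//; last first.
    by rewrite mulr_ge0 ?exprn_ge0 ?eps_ge0 ?jap_ge0.
  by rewrite ler_wpM2r// epsV_le// leq_addl.
have UW : japanese k ^+ M * U t <= japanese (z t) ^+ (N0 + (M + M)) * W.
  apply: (@le_trans _ _ (japanese (z t) ^+ (N0 + (M + M)) *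
      ((e : R)^-1 ^+ N0 * (japanese x ^+ M)^-1))); last first.
    by rewrite ler_wpM2l// exprn_ge0 ?jap_ge0.
  have -> : japanese k ^+ M * U t = (japanese x ^+ (N0 + M) * japanese k ^+ M) *
      ((e : R)^-1 ^+ N0 * (japanese x ^+ M)^-1).
    have jM : japanese x ^+ M != 0 by rewrite gt_eqF// exprn_gt0 ?jap_gt0.
    by rewrite /U /= exprD; field; rewrite jM /= ?gt_eqF// ?eps_gt0.
  rewrite ler_wpM2r ?mulr_ge0 ?exprn_ge0 ?epsV_ge0//.
  rewrite addnA [leRHS]exprD ler_pM ?exprn_ge0 ?jap_ge0//.
  - by rewrite lerXn2r ?nnegrE ?jap_ge0// jap_row_l.
  - by rewrite lerXn2r ?nnegrE ?jap_ge0// jap_row_r.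
have jk0 : 0 <= japanese k ^+ M by rewrite exprn_ge0 ?jap_ge0.
have jz0 : 0 < japanese (z t) ^+ (N0 + (M + M)) by rewrite exprn_gt0 ?jap_gt0.
rewrite mulrDl; have [rz|zr] := leP r (enorm (z t)).
  rewrite -[leLHS]addr0 lerD//; last first.
    by rewrite !mulr_ge0// exprn_ge0// sqrtr_ge0.
  apply: le_trans (ler_wpM2l jk0 (HC t rz)) _.
  rewrite mulrCA -[C + C]mulr2n -[C *+ 2]mulr_natr -[leRHS]mulrA ler_wpM2l//.
  rewrite mulrDr mulr_natl mulr2n lerD//.
    rewrite /G /= mulrA mulfV ?mul1r ?gt_eqF// ?exprn_gt0 ?jap_gt0//.
    by rewrite rate_mono// leq_addr.
  rewrite mulrCA; apply: le_trans (ler_wpM2r _ (HK (z t))) _.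
    by rewrite mulr_ge0// /U mulr_ge0 ?exprn_ge0 ?epsV_ge0 ?jap_ge0.
  by rewrite ler_pdivrMl.
rewrite -[leLHS]add0r lerD//; first by rewrite mulr_ge0// addr_ge0.
apply: le_trans (ler_wpM2l jk0 (HC' t)) _.
rewrite mulrCA -mulrA ler_wpM2l//; apply: le_trans UW _; rewrite ler_wpM2r//.
rewrite lerXn2r ?nnegrE ?jap_ge0 ?sqrtr_ge0//.
rewrite ler_wsqrtr// lerD2l lerXn2r ?nnegrE ?sqrtr_ge0 ?ltW//.
Qed.

End hypoelliptic_operator.

End parametrix.

(** * From packet coefficients back to pointwise bounds on derivatives *)

Section inversion.
Context {R : realType} {n : nat}.
Local Notation normc := (@complex.ComplexField.Normc.normc R).

Lemma jap_mul_rate N M a b M' q (e : eps R) (x : 'rV[R]_n) :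
  japanese x ^+ a * rate N (M + a + b) M' q e x <= rate N M (a + M') q e x.
Proof.
have j0 m : 0 < japanese x ^+ m by rewrite exprn_gt0 ?jap_gt0.
rewrite /rate mulrDr lerD//; last first.
  by rewrite mulrCA ler_wpM2l ?exprn_ge0 ?eps_ge0// exprD.
rewrite mulrCA ler_wpM2l ?exprn_ge0 ?epsV_ge0//.
rewrite ler_pdivrMr// mulrC ler_pdivlMr// -exprD jap_exp_le//.
by rewrite addnC leq_addr.
Qed.

(* Localize [pderiv beta u] by a bump at [x] and invert: the Fourier coefficients
   of the localization are wave packet coefficients of [u]. *)
Lemma pderiv_decay (u : net R n) N : smooth_net u -> wave_decay u N ->
  forall (beta : mindex n) M, exists M' : nat, forall q, exists C, 0 <= C /\
  forall (e : eps R) x, normc (pderiv beta (u e) x) <= C * rate N M M' q e x.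
Proof.
move=> su du beta M.
pose B := (\max_j beta j).+1.
have bB j : (beta j < B)%N by rewrite ltnS; exact: leq_bigmax.
(* In [k]: [B n] for the growth of [wcoefs] and [2 n] for the product weight in [inversion_bound].
   In [x]: [B n] for the growth of [wcoefs] and [M] for the wanted decay. *)
have [M' HM'] := du (M + B * n + 2 * n)%N.
exists (B * n + M')%N => q.
pose F : 'I_n -> R -> R := fun=> bump.
have tF : testfs F by move=> j; exact: testf_bump.
have /choice[c1 Hc1] (f : {ffun 'I_n -> 'I_B * 'I_B}) := HM' q _ (testfs_wops f tF).
have mzero_le m (j : 'I_n) : (mzero j <= m)%N by rewrite ffunE.
have /choice[c2 Hc2] (f : {ffun 'I_n -> 'I_B * 'I_B}) :=
  @wcoefs_bound R n B mzero beta f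
    (mzero_le B) (fun j => ltnW (bB j)).
exists (2 * 6 ^+ n * \sum_f c2 f * c1 f); split.
  rewrite !mulr_ge0 ?exprn_ge0// sumr_ge0// => f _.
  by rewrite mulr_ge0//; [have [] := Hc2 f|have [] := Hc1 f].
move=> e x.
pose K y := pderiv beta (u e) y * tensor (fun j t => (bump (t - x 0 j))%:C) y.
have -> : pderiv beta (u e) x = K x.
  rewrite /K /tensor big1 ?mulr1// => j _.
  by rewrite subrr bump1// normr0.
rewrite -mulrA; apply: inversion_bound.
- apply: ccontM; first by rewrite pderivE; exact/smooth_ccont/smooth_dseq/su.
  by apply: ccont_tensor => j; apply/csmooth_real/cinf_shift/cinf_bump.
- move=> y /in_cubePn[j yj]; rewrite /K /tensor (bigD1 j)//= bump0 ?ltW//.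
  by rewrite mul0r mulr0.
- rewrite mulr_ge0 ?rate_ge0// sumr_ge0// => f _.
  by rewrite mulr_ge0//; [have [] := Hc2 f|have [] := Hc1 f].
move=> k; rewrite (eq_integralRn (g := fun y =>
    (monomial mzero y)%:C * pderiv beta (u e) y * wpacket k x F y)); last first.
  move=> y; rewrite monomial0 mul1r /K -mulrA; congr (_ * _).
  rewrite mulrC /wpacket /wave /tensor; exact/esym/big_split.
rewrite (@Tw_monomial _ _ B)//; last by move=> j; rewrite ffunE.
apply: (@le_trans _ _ ((\sum_(f : {ffun 'I_n -> 'I_B * 'I_B})
    c2 f * (japanese x ^+ (B * n) * japanese k ^+ (B * n)) *
    normc (Tw k x (wops f F) (u e))) * japanese k ^+ (2 * n))).
  rewrite ler_pM ?normc_ge0 ?prod_oneDsqr_jap//.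
    by apply: prodr_ge0 => j _; rewrite (le_trans ler01)// oneDsqr_ge1.
  rewrite (le_trans (normc_sum _ _ _))//; apply: ler_sum => f _.
  by rewrite normcM ler_wpM2r ?normc_ge0//; have [_] := Hc2 f; apply.
rewrite !mulr_suml; apply: ler_sum => f _.
have [c10 h1] := Hc1 f; have [c20 _] := Hc2 f.
have jk a : 0 <= japanese k ^+ a by rewrite exprn_ge0 ?jap_ge0.
have jx a : 0 <= japanese x ^+ a by rewrite exprn_ge0 ?jap_ge0.
apply: (@le_trans _ _ (c2 f * japanese x ^+ (B * n) *
   (japanese k ^+ (M + B * n + 2 * n) * normc (Tw k x (wops f F) (u e))))).
  rewrite (_ : _ * japanese k ^+ (2 * n) = c2 f * japanese x ^+ (B * n) *
    (japanese k ^+ (B * n + 2 * n) * normc (Tw k x (wops f F) (u e)))).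
    rewrite ler_wpM2l ?mulr_ge0// ler_wpM2r ?normc_ge0// jap_exp_le//.
    by rewrite -addnA leq_addl.
  by rewrite [japanese k ^+ (_ + _)]exprD; ring.
rewrite -!mulrA ler_wpM2l//.
apply: (@le_trans _ _ (japanese x ^+ (B * n) *
  (c1 f * rate N (M + B * n + 2 * n) M' q e x))).
  by rewrite ler_wpM2l.
by rewrite mulrCA ler_wpM2l// jap_mul_rate.
Qed.

End inversion.

(** * Cutoff and weak equality *)

Section quotient_representatives.
Context {R : realType} {n : nat}.
Local Notation normc := (@complex.ComplexField.Normc.normc R).
Implicit Types (u v w g : net R n).

Lemma N_oB (h1 h2 : cnet R) : N_o h1 -> N_o h2 -> N_o (h1 - h2).
Proof.
move=> H1 H2 q; have [C1 {}H1] := H1 q; have [C2 {}H2] := H2 q.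
exists (C1 + C2) => e; apply: le_trans (lerD (H1 e) (H2 e)).
by rewrite -mulrDr ler_wpM2l ?exprn_ge0 ?epsV_ge0// normcB.
Qed.

Lemma N_o_bound (h : cnet R) :
  (forall q, exists C, forall e : eps R, normc (h e) <= C * (e : R) ^+ q) -> N_o h.
Proof.
move=> H q; have [C HC] := H q; exists C => e.
by rewrite exprVn ler_pdivrMl ?exprn_gt0 ?eps_gt0// mulrC.
Qed.

Lemma N_S_rate g q : N_S g -> schwartz_rate g (fun e => (e : R) ^+ q).
Proof.
move=> [_ H] alpha beta; have [C HC] := H alpha beta q; exists C => e x.
have := HC e x; rewrite exprVn ler_pdivrMl ?exprn_gt0 ?eps_gt0//.
by rewrite (mulrC C).
Qed.

Lemma E_S_infty_rate g : E_S_infty g ->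
  exists N, schwartz_rate g (fun e => (e : R)^-1 ^+ N).
Proof.
move=> [_ [N H]]; exists N => alpha beta; have [C HC] := H alpha beta.
exists C => e x; rewrite exprVn ler_pdivlMr ?exprn_gt0 ?eps_gt0// mulrC.
exact: HC.
Qed.

Lemma N_S_bound g q M : N_S g -> exists C, 0 <= C /\ forall (e : eps R) x,
  normc (g e x) <= C * ((e : R) ^+ q * (japanese x ^+ M)^-1).
Proof.
move=> gN; have s0 (e : eps R) : 0 <= (e : R) ^+ q by rewrite exprn_ge0 ?eps_ge0.
have [C [C0 HC]] := schwartz_rate_jap mzero M (N_S_rate q gN) s0.
exists C; split => // e x; rewrite mulrA ler_pdivlMr ?exprn_gt0 ?jap_gt0//.
by have := HC e x; rewrite pderiv0.
Qed.

Lemma N_S0 : N_S (0 : net R n).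
Proof.
split; first by move=> e; exact: smooth_cst.
move=> alpha beta q; exists 0 => e x; rewrite pderivE.
by rewrite (_ : (0 : net R n) e = fun=> 0)// dseq_cst; case: mseq => *; rewrite mulr0 normc0 mulr0.
Qed.

Lemma tempered_E_tau u : E_tau u -> tempered u.
Proof.
move=> [_ H] alpha; have [N [C HC]] := H alpha; exists N, C => e x.
have := HC e x; rewrite normcM normc_real ger0_norm ?exprn_ge0 ?invr_ge0 ?jap_ge0//.
rewrite exprVn -ler_pdivlMl ?exprn_gt0 ?eps_gt0// -ler_pdivlMl ?invr_gt0 ?exprn_gt0 ?jap_gt0//.
move=> /le_trans; apply; rewrite le_eqVlt; apply/orP; left; apply/eqP.
by rewrite !exprVn invrK; ring.
Qed.

Lemma tempered_N_S g : N_S g -> tempered g.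
Proof.
move=> gN alpha; have [C HC] := N_S_rate 0 gN mzero alpha; exists 0%N, C => e x.
by have := HC e x; rewrite !expr0 monomial0 mul1r !mulr1 mul1r.
Qed.

Lemma temperedD u v : smooth_net u -> smooth_net v -> tempered u -> tempered v ->
  tempered (fun e x => u e x + v e x).
Proof.
move=> su sv tu tv alpha; have [N1 H1] := tu alpha; have [N2 H2] := tv alpha.
have [C1 {}H1] := tempered_mono (leq_addr N2 N1) H1.
have [C2 {}H2] := tempered_mono (leq_addl N1 N2) H2.
exists (N1 + N2)%N, (C1 + C2) => e x.
rewrite pderivE dseq_add// -!pderivE mulrDl.
exact: le_trans (le_normcD _ _) (lerD (H1 e x) (H2 e x)).
Qed.

Lemma schwartz_rateN g s : smooth_net g -> schwartz_rate g s ->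
  schwartz_rate (fun e x => -1 * g e x) s.
Proof.
move=> sg gs alpha beta; have [C HC] := gs alpha beta; exists C => e x.
rewrite pderivE dseqZ// -pderivE mulrCA normcM normcN normc1 mul1r.
exact: HC.
Qed.

End quotient_representatives.

Section cutoff.
Context {R : realType} {n : nat}.
Local Notation normc := (@complex.ComplexField.Normc.normc R).

Lemma iter_cder_scale (F : R -> R) (a : R) k : cinf F ->
  iter k cder (fun t => (F (a * t))%:C) =
  fun t => (a ^+ k * iter k (fun f => derive1 f) F (a * t))%:C.
Proof.
move=> cF; have cFk m : cinf (iter m (fun f : R -> R => derive1 f) F).
  by elim: m => //= m; exact: cinf_derive1.
elim: k => [|k IH]; first by apply/funext => t; rewrite expr0 mul1r.
rewrite iterS IH; apply/funext => t; rewrite cder_real; congr (_%:C).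
set G := iter k _ F.
have cG : cinf G by exact: cFk.
have dl : is_derive t 1 (fun u : R => a * u) a.
  have := is_deriveM (is_derive_cst a t (1 : R)) (is_derive_id t (1 : R)).
  by move=> H; apply: is_derive_eq; rewrite /GRing.scale /= mulr1 mulr0 addr0.
have [d1 d2] := is_derive1P dl.
have dG : is_derive t 1 (G \o (fun u => a * u)) (derive1 G (a * t) * a).
  apply: DeriveDef.
    apply/derivable1_diffP; apply: differentiable_comp; apply/derivable1_diffP => //.
    exact: cinf_derivable.
  by rewrite -derive1E (derive1_comp d1 (@cinf_derivable R G _ cG)) d2.
have := is_deriveM (is_derive_cst (a ^+ k) t (1 : R)) dG.
move=> /is_derive1P[_]; rewrite /GRing.scale /= mulr0 addr0 => H.
by rewrite exprSr -mulrA [a * _]mulrC; exact: H.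
Qed.

Lemma testf_iter_derive F k : testf F -> testf (iter k (fun f : R -> R => derive1 f) F).
Proof.
move=> tF; elim: k => //= k [cF F0]; split; first exact: cinf_derive1.
by move=> t t1; rewrite (derive1_outside F0).
Qed.

Definition theta (e : eps R) : 'rV[R]_n -> R[i] :=
  tensor (fun _ t => (bump ((e : R) * t))%:C).

Let csmooth_theta (e : eps R) : csmooth (fun t : R => (bump ((e : R) * t))%:C).
Proof. by apply/csmooth_real/(cinf_comp (@cinf_bump R))/cinfZ/cinf_id. Qed.

Lemma smooth_theta e : smooth (theta e).
Proof. by apply: smooth_tensor => j; exact: csmooth_theta. Qed.

(** Each derivative brings a factor [e <= 1], and where the derivative does not vanish all
    [|e x_j| <= 1], so that [(e <x>)^2 <= 1 + n]. *)
Lemma theta_bound s M : exists C, 0 <= C /\ forall (e : eps R) x,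
  normc (dseq s (theta e) x) * ((e : R) * japanese x) ^+ M <= C.
Proof.
have /choice[c Hc] := fun j : 'I_n =>
  testf_bounded (testf_iter_derive (count_mem j s) (@testf_bump R)).
have c0 : 0 <= \prod_j c j by apply: prodr_ge0 => j _; have [] := Hc j.
have n0 : 0 <= 1 + n%:R :> R by rewrite addr_ge0.
exists (\prod_j c j * (1 + n%:R) ^+ M); split; first by rewrite mulr_ge0 ?exprn_ge0.
move=> e x; rewrite dseq_tensor//.
have [ex|/existsNP[j /negP]] := pselect (forall j, `|(e : R) * x 0 j| <= 1); last first.
  rewrite -ltNge => exj; rewrite /tensor (bigD1 j)//= iter_cder_scale; last exact: cinf_bump.
  have [_ ->//] := testf_iter_derive (count_mem j s) (@testf_bump R).
  by rewrite mulr0 mul0r normc0 mul0r mulr_ge0 ?exprn_ge0.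
rewrite ler_pM ?normc_ge0 ?exprn_ge0 ?mulr_ge0 ?eps_ge0 ?jap_ge0//.
  rewrite normc_prod; apply: ler_prod => j _; rewrite normc_ge0 /=.
  rewrite iter_cder_scale; last exact: cinf_bump.
  rewrite normc_real normrM normrX ger0_norm ?eps_ge0// -[leRHS]mul1r.
  rewrite ler_pM ?exprn_ge0 ?eps_ge0 ?exprn_ile1 ?eps_ge0 ?eps_le1//.
  by have [_] := Hc j; apply.
rewrite lerXn2r ?nnegrE ?mulr_ge0 ?eps_ge0 ?jap_ge0//.
rewrite -(@ler_pXn2r _ 2) ?nnegrE ?mulr_ge0 ?eps_ge0 ?jap_ge0//.
rewrite exprMn jap_sqr mulrDr mulr1 mulr_sumr.
apply: (@le_trans _ _ (1 + \sum_(j < n) 1)).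
  rewrite lerD ?exprn_ile1 ?eps_ge0 ?eps_le1//; apply: ler_sum => j _.
  by rewrite -exprMn -real_normK ?num_real// exprn_ile1.
rewrite sumr_const card_ord; have : 0 <= n%:R :> R by [].
by move: (n%:R : R) => m m0; nra.
Qed.

Lemma theta_far (e : eps R) x : theta e x = 1 \/ 1 <= 2 * ((e : R) * japanese x).
Proof.
have [ex|/existsNP[j /negP]] := pselect (forall j, `|(e : R) * x 0 j| <= 2^-1).
  by left; rewrite /theta /tensor big1// => j _; rewrite bump1.
rewrite -ltNge normrM (ger0_norm (eps_ge0 e)) => exj; right.
have := ler_wpM2l (eps_ge0 e) (coord_le_jap x j).
by move: exj; lra.
Qed.

(** Where [theta] differs from 1 the factor [(2 e <x>) ^ (q + N) >= 1] may be inserted; it turns the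
    loss [e ^ -N] into a gain [e ^ q] at the price of growth in [x]. *)
Lemma cutoff_error (u : net R n) q : tempered u -> exists M C, 0 <= C /\
  forall (e : eps R) x, normc (u e x - u e x * theta e x) <=
    C * ((e : R) ^+ q * japanese x ^+ M).
Proof.
move=> tu; have [N [C HC]] := tu mzero; have [D [D0 HD]] := theta_bound [::] 0.
exists ((q + N) + N)%N, (`|C| * (1 + D) * 2 ^+ (q + N)).
split; first by rewrite !mulr_ge0 ?addr_ge0 ?exprn_ge0.
move=> e x; rewrite -{1}[u e x]mulr1 -mulrBr.
have [->|far] := theta_far e x.
  by rewrite subrr mulr0 normc0 !mulr_ge0 ?exprn_ge0 ?addr_ge0 ?eps_ge0 ?jap_ge0.
have w0 : 0 <= (e : R)^-1 ^+ N * japanese x ^+ N.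
  by rewrite mulr_ge0 ?exprn_ge0 ?epsV_ge0 ?jap_ge0.
apply: (@le_trans _ _ ((`|C| * ((e : R)^-1 ^+ N * japanese x ^+ N)) * (1 + D))).
  rewrite normcM ler_pM ?normc_ge0//.
    have := HC e x; rewrite pderiv0 => /le_trans; apply.
    by rewrite ler_wpM2r// ler_norm.
  rewrite (le_trans (normcB _ _))// normc1 lerD2l.
  by have := HD e x; rewrite expr0 mulr1.
apply: (@le_trans _ _ ((`|C| * ((e : R)^-1 ^+ N * japanese x ^+ N)) * (1 + D) *
   (2 * ((e : R) * japanese x)) ^+ (q + N))).
  apply: ler_peMr; last exact: exprn_ege1.
  by apply: mulr_ge0; [exact: mulr_ge0|exact: addr_ge0].
rewrite le_eqVlt; apply/orP; left; apply/eqP.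
by rewrite -(eps_mul_expV e q N) [japanese x ^+ (q + N + N)]exprD !exprMn; ring.
Qed.

Lemma monomial_le_jap (alpha : mindex n) (x : 'rV[R]_n) :
  `|monomial alpha x| <= japanese x ^+ mlen alpha.
Proof.
rewrite /monomial normr_prod /mlen -prodrXr; apply: ler_prod => j _.
by rewrite normrX exprn_ge0//= lerXn2r ?nnegrE ?jap_ge0// coord_le_jap.
Qed.

(* On the support of [theta e] one has [e <x> <= 1 + n], so the factor [e ^+ q]
   absorbs the polynomial growth of the error in [pderiv_decay]. *)
Lemma E_S_infty_cutoff (u : net R n) N : smooth_net u -> wave_decay u N ->
  E_S_infty (fun e x => u e x * theta e x).
Proof.
move=> su du; split; first by move=> e; apply: smoothM; [exact: su|exact: smooth_theta].
exists N => alpha beta; pose M := mlen alpha.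
have /choice[c Hc] (q : seq 'I_n * seq 'I_n) : exists C, 0 <= C /\
    (q \in splits (mseq beta) -> forall (e : eps R) x,
    japanese x ^+ M * (normc (dseq q.1 (u e) x) * normc (dseq q.2 (theta e) x)) <=
    C * (e : R)^-1 ^+ N).
  have [qb|] := boolP (q \in splits (mseq beta)); last by exists 0.
  have [M' HM] := pderiv_decay su du (mcount q.1) M.
  (* With [q = M + M'] the error term times [<x> ^ M] is exactly [(e <x>) ^ (M + M')], which [D2]
     controls; [D1] controls the regular term. *)
  have [C1 [C10 H1]] := HM (M + M')%N.
  have [D1 [D10 G1]] := theta_bound q.2 0.
  have [D2 [D20 G2]] := theta_bound q.2 (M + M').
  exists (C1 * (D1 + D2)); split; first by rewrite mulr_ge0 ?addr_ge0.
  move=> _ e x; have [-> _] := dseq_splits (u e) qb.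
  have t0 := normc_ge0 (dseq q.2 (theta e) x).
  have jM : japanese x ^+ M != 0 by rewrite gt_eqF// exprn_gt0 ?jap_gt0.
  apply: (@le_trans _ _ (japanese x ^+ M * (C1 * rate N M M' (M + M') e x *
      normc (dseq q.2 (theta e) x)))).
    by rewrite ler_wpM2l ?exprn_ge0 ?jap_ge0// ler_wpM2r.
  rewrite [leLHS](_ : _ = C1 * ((e : R)^-1 ^+ N * (normc (dseq q.2 (theta e) x) *
      ((e : R) * japanese x) ^+ 0) + normc (dseq q.2 (theta e) x) *
      ((e : R) * japanese x) ^+ (M + M'))); last first.
    by rewrite /rate !exprMn [japanese x ^+ (M + M')]exprD; field;
       rewrite jM /= ?gt_eqF// ?eps_gt0.
  rewrite -mulrA ler_wpM2l// mulrDl lerD//.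
    by rewrite [leRHS]mulrC ler_wpM2l ?exprn_ge0 ?epsV_ge0.
  by rewrite (le_trans (G2 e x))// ler_peMr// exprn_ege1// epsV_ge1.
exists (\sum_(q <- splits (mseq beta)) c q) => e x.
rewrite mulrC -ler_pdivlMr ?exprn_gt0 ?eps_gt0// -exprVn.
rewrite pderivE dseqM//; last exact: smooth_theta.
rewrite normcM normc_real.
apply: (@le_trans _ _ (japanese x ^+ M * \sum_(q <- splits (mseq beta))
   (normc (dseq q.1 (u e) x) * normc (dseq q.2 (theta e) x)))).
  rewrite ler_pM ?normc_ge0 ?monomial_le_jap// (le_trans (normc_sum _ _ _))//.
  by apply: ler_sum => q _; rewrite normcM.
rewrite mulr_sumr mulr_suml big_seq [leRHS]big_seq; apply: ler_sum => q qb.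
by have [_] := Hc q; apply.
Qed.

End cutoff.

(** * Moderate bounds for the mollified factor and the Fourier weight *)

Section mollified_functions.
Context {R : realType} {n : nat}.
Local Notation normc := (@complex.ComplexField.Normc.normc R).
Implicit Types (f phi : 'rV[R]_n -> R[i]).

Lemma schwartz_bound f M : schwartz f -> exists C, 0 <= C /\
  forall x, normc (f x) <= C * (japanese x ^+ M)^-1.
Proof.
move=> [sf fb]; pose g : net R n := fun=> f.
have gs : schwartz_rate g (fun=> 1).
  by move=> alpha beta; have [C HC] := fb alpha beta; exists C => e x; rewrite mulr1.
have [C [C0 HC]] := schwartz_rate_jap mzero M gs (fun=> ler01).
exists C; split => // x; rewrite ler_pdivlMr ?exprn_gt0 ?jap_gt0//.
have h1 : 0 < (1 : R) <= 1 by rewrite ltr01 lexx.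
by have := HC (Eps h1) x; rewrite pderiv0 mulr1.
Qed.

Lemma japV_le_omega (x : 'rV[R]_n) : (japanese x ^+ (2 * n))^-1 <= omega x.
Proof.
rewrite /omega prodfV lef_pV2 ?posrE ?exprn_gt0 ?jap_gt0 ?prod_oneDsqr_jap//.
by apply: prodr_gt0 => j _; rewrite (lt_le_trans ltr01)// oneDsqr_ge1.
Qed.

Lemma jap_scale (e : eps R) (y : 'rV[R]_n) : japanese y <= japanese ((e : R)^-1 *: y).
Proof.
rewrite -[leRHS]mul1r; apply: le_japP => //; rewrite expr1n mul1r !jap_sqr lerD2l.
apply: ler_sum => j _; rewrite mxE exprMn ler_peMl ?sqr_ge0//.
by rewrite exprn_ege1// epsV_ge1.
Qed.

(** A crude bound: dilation by [1 / e >= 1] only increases [<y>], and the prefactor [e ^ -n] is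
    kept. A fixed loss in [e] is harmless against errors that are small to every order. *)
Lemma rescale_bound phi M : schwartz phi -> exists C, 0 <= C /\
  forall (e : eps R) y, normc (rescale phi e y) <=
    C * (e : R)^-1 ^+ n * (japanese y ^+ M)^-1.
Proof.
move=> sphi; have [C [C0 HC]] := schwartz_bound M sphi; exists C; split => // e y.
rewrite /rescale normcM normc_real ger0_norm ?exprn_ge0 ?epsV_ge0//.
rewrite [C * _]mulrC -mulrA ler_wpM2l ?exprn_ge0 ?epsV_ge0//.
apply: le_trans (HC _) _; rewrite ler_wpM2l// lef_pV2 ?posrE ?exprn_gt0 ?jap_gt0//.
by rewrite lerXn2r ?nnegrE ?jap_ge0 ?jap_scale.
Qed.

Lemma fourier_rescale_bound phi : schwartz phi -> exists C, 0 <= C /\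
  forall (e : eps R) x, normc (fourier (rescale phi e) x) <= C * (e : R)^-1 ^+ n.
Proof.
move=> sphi; have [C [C0 HC]] := rescale_bound (2 * n) sphi.
exists (2 * (C * IR (@omega R n))).
split; first by rewrite !mulr_ge0 ?IR_omega_ge0.
move=> e x; rewrite [leRHS](_ : _ = 2 * ((C * (e : R)^-1 ^+ n) * IR (@omega R n))).
  apply: normc_integralRn => y; rewrite normcM normc_expi mul1r.
  apply: le_trans (HC e y) _; rewrite ler_wpM2l ?japV_le_omega//.
  by rewrite mulr_ge0 ?exprn_ge0 ?epsV_ge0.
ring.
Qed.

(** Peetre's inequality. *)
Lemma jap_peetre (x y : 'rV[R]_n) : japanese x <= 2 * (japanese (x - y) * japanese y).
Proof.
rewrite [leRHS](_ : _ = (2 * japanese (x - y)) * japanese y); last by ring.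
apply: le_japP; first by rewrite mulr_ge0 ?jap_ge0.
rewrite exprMn !jap_sqr.
have : \sum_j x 0 j ^+ 2 <= \sum_j (2 * (x - y) 0 j ^+ 2 + 2 * y 0 j ^+ 2).
  apply: ler_sum => j _; rewrite !mxE.
  by have := sqr_ge0 (x 0 j - 2 * y 0 j); nra.
rewrite big_split /= -!mulr_sumr.
have : 0 <= \sum_j (x - y) 0 j ^+ 2 by apply: sumr_ge0 => j _; exact: sqr_ge0.
have : 0 <= \sum_j y 0 j ^+ 2 by apply: sumr_ge0 => j _; exact: sqr_ge0.
move: (\sum_j y 0 j ^+ 2) (\sum_j (x - y) 0 j ^+ 2) (\sum_j x 0 j ^+ 2) => a b d.
by nra.
Qed.

Lemma convolution_bound f phi M : schwartz f -> schwartz phi -> exists C, 0 <= C /\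
  forall (e : eps R) x, normc (convolution f (rescale phi e) x) <=
    C * ((e : R)^-1 ^+ n * (japanese x ^+ M)^-1).
Proof.
move=> sf sphi; have [C1 [C10 H1]] := schwartz_bound M sf.
have [C2 [C20 H2]] := rescale_bound (M + 2 * n) sphi.
have io := @IR_omega_ge0 R n.
exists (2 * (C1 * C2 * 2 ^+ M * IR (@omega R n))).
split; first by rewrite !mulr_ge0 ?exprn_ge0.
move=> e x; rewrite [leRHS](_ : _ = 2 * ((C1 * C2 * 2 ^+ M * ((e : R)^-1 ^+ n *
    (japanese x ^+ M)^-1)) * IR (@omega R n))); last by ring.
apply: normc_integralRn => y; rewrite normcM.
have j0 (z : 'rV[R]_n) m : 0 < japanese z ^+ m by rewrite exprn_gt0 ?jap_gt0.
have e0 : 0 <= (e : R)^-1 ^+ n by rewrite exprn_ge0 ?epsV_ge0.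
apply: le_trans (ler_pM (normc_ge0 _) (normc_ge0 _) (H1 (x - y)) (H2 e y)) _.
rewrite exprD invfM.
apply: (@le_trans _ _ (C1 * C2 * (e : R)^-1 ^+ n *
    ((japanese (x - y) ^+ M)^-1 * (japanese y ^+ M)^-1) * omega y)).
  rewrite [leLHS](_ : _ = C1 * C2 * (e : R)^-1 ^+ n *
    ((japanese (x - y) ^+ M)^-1 * (japanese y ^+ M)^-1) * (japanese y ^+ (2 * n))^-1);
    last by ring.
  by rewrite ler_wpM2l ?japV_le_omega// !mulr_ge0 ?invr_ge0// ltW.
rewrite ler_wpM2r ?(ltW (omega_gt0 _))//.
rewrite [leRHS](_ : _ = C1 * C2 * (e : R)^-1 ^+ n * (2 ^+ M * (japanese x ^+ M)^-1));
  last by ring.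
rewrite ler_wpM2l ?mulr_ge0// -invfM -exprMn.
rewrite ler_pdivlMr// mulrC ler_pdivrMr ?exprn_gt0 ?mulr_gt0 ?jap_gt0//.
rewrite -exprMn lerXn2r ?nnegrE ?mulr_ge0 ?jap_ge0//.
exact: jap_peetre.
Qed.

End mollified_functions.

Section weak_equality.
Context {R : realType} {n : nat}.
Local Notation normc := (@complex.ComplexField.Normc.normc R).
Variable phi : 'rV[R]_n -> R[i].
Hypothesis sphi : schwartz phi.

(** Products and integrals of cosets run over all representatives, so [key] estimates an arbitrary
    element of the product coset; equality of the resulting sets then needs [key] and the exhibition
    of one element. *)
Lemma cutoff_weak_eq (u0 u : net R n) : tempered u -> N_S (u - u0) ->
  weak_eq phi (coset (@N_S R n) u0) (coset (@N_S R n) (fun e x => u e x * theta e x)).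
Proof.
move=> tu u0u f sf; set w : net R n := fun e x => u e x * theta e x.
have NS0 (g : net R n) : N_S (g - g) by rewrite subrr; exact: N_S0.
have key (g : net R n) : gmul (gsub (coset (@N_S R n) u0) (coset (@N_S R n) w))
    (iota_emb phi f) g ->
    N_o (fun e => integralRn (fun x => g e x * fourier (rescale phi e) x)).
  move=> [a [b [[u' [w' [uu' ww' aN]]] bN gN]]]; apply: N_o_bound => q.
  (* One [n] pays for the convolution with [rescale phi e] and one for its Fourier transform. In
     [x], decay [M] offsets the growth of the cutoff error and [2 n] leaves an integrable factor. *)
  have [M [C1 [C10 H1]]] := cutoff_error (q + n + n) tu.
  have [C2 [C20 H2]] := convolution_bound (M + 2 * n) sf sphi.
  have [Cf [Cf0 Hf]] := fourier_rescale_bound sphi.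
  have [D1 [D10 G1]] := N_S_bound (q + n + n) 0 uu'.
  have [D0 [D00 G0]] := N_S_bound (q + n + n) 0 u0u.
  have [D2 [D20 G2]] := N_S_bound (q + n + n) 0 ww'.
  have [D3 [D30 G3]] := N_S_bound (q + n + n) 0 aN.
  have [D4 [D40 G4]] := N_S_bound 0 (M + 2 * n) bN.
  have [D5 [D50 G5]] := N_S_bound (q + n) (2 * n) gN.
  have io := @IR_omega_ge0 R n.
  pose Ca := C1 + D1 + D0 + D2 + D3; pose Cb := C2 + D4.
  exists (2 * ((Ca * Cb + D5) * Cf * IR (@omega R n))) => e.
  rewrite [leRHS](_ : _ = 2 * (((Ca * Cb + D5) * Cf * (e : R) ^+ q) *
    IR (@omega R n))); last by ring.
  apply: normc_integralRn => x; rewrite normcM.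
  have E0 m : 0 <= (e : R) ^+ m by rewrite exprn_ge0 ?eps_ge0.
  have V0 m : 0 <= (e : R)^-1 ^+ m by rewrite exprn_ge0 ?epsV_ge0.
  have J0 m : 0 <= japanese x ^+ m by rewrite exprn_ge0 ?jap_ge0.
  have JV0 m : 0 <= (japanese x ^+ m)^-1 by rewrite invr_ge0.
  have ab : normc (a e x) <= Ca * ((e : R) ^+ (q + n + n) * japanese x ^+ M).
    (* The difference of arbitrary representatives is the cutoff error plus four elements of
       [N_S]. *)
    rewrite [a e x](_ : _ = (u e x - u e x * theta e x) + (u' e x - u0 e x)
      - (u e x - u0 e x) - (w' e x - w e x) + (a e x - (u' e x - w' e x))); last by rewrite /w; ring.
    rewrite (le_trans (le_normcD _ _))// !mulrDl lerD//.
      rewrite (le_trans (normcB _ _))// lerD//.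
        rewrite (le_trans (normcB _ _))// lerD//.
          rewrite (le_trans (le_normcD _ _))// lerD//.
          apply: le_trans (G1 e x) _; rewrite expr0 invr1 mulr1 ler_wpM2l//.
          by rewrite ler_peMr// exprn_ege1// jap_ge1.
        apply: le_trans (G0 e x) _; rewrite expr0 invr1 mulr1 ler_wpM2l//.
        by rewrite ler_peMr// exprn_ege1// jap_ge1.
      apply: le_trans (G2 e x) _; rewrite expr0 invr1 mulr1 ler_wpM2l//.
      by rewrite ler_peMr// exprn_ege1// jap_ge1.
    apply: le_trans (G3 e x) _; rewrite expr0 invr1 mulr1 ler_wpM2l//.
    by rewrite ler_peMr// exprn_ege1// jap_ge1.
  have bb : normc (b e x) <= Cb * ((e : R)^-1 ^+ n * (japanese x ^+ (M + 2 * n))^-1).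
    rewrite -(subrK (convolution f (rescale phi e) x) (b e x)) addrC.
    rewrite (le_trans (le_normcD _ _))// mulrDl lerD//.
    apply: le_trans (G4 e x) _; rewrite expr0 mul1r ler_wpM2l//.
    by rewrite ler_peMl// exprn_ege1// epsV_ge1.
  have gb : normc (g e x) <= (Ca * Cb + D5) * ((e : R) ^+ (q + n) * omega x).
    rewrite -(subrK (a e x * b e x) (g e x)) addrC (le_trans (le_normcD _ _))//.
    rewrite mulrDl lerD//; last first.
      apply: le_trans (G5 e x) _; rewrite ler_wpM2l// ler_wpM2l//.
      exact: japV_le_omega.
    rewrite normcM; apply: le_trans (ler_pM (normc_ge0 _) (normc_ge0 _) ab bb) _.
    apply: (@le_trans _ _ (Ca * Cb * ((e : R) ^+ (q + n) * (japanese x ^+ (2 * n))^-1))).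
      rewrite -(eps_mul_expV e (q + n) n) [japanese x ^+ (M + _)]exprD invfM le_eqVlt; apply/orP; left.
      have jM : japanese x ^+ M != 0 by rewrite gt_eqF// exprn_gt0 ?jap_gt0.
      have jN : japanese x ^+ (2 * n) != 0 by rewrite gt_eqF// exprn_gt0 ?jap_gt0.
      by apply/eqP; field; rewrite jM jN /= ?gt_eqF// ?eps_gt0.
    rewrite ler_wpM2l ?mulr_ge0 ?addr_ge0// ler_wpM2l//.
    exact: japV_le_omega.
  apply: le_trans (ler_pM (normc_ge0 _) (normc_ge0 _) gb (Hf e x)) _.
  by rewrite -[in leRHS](eps_mul_expV e q n) le_eqVlt; apply/orP; left; apply/eqP; ring.
apply/seteqP; split => [h [g gX hN]|h hN].
  pose I : cnet R := fun e => integralRn (fun x => g e x * fourier (rescale phi e) x).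
  have IN : N_o (0 - I) by rewrite -(subrr (h - I)); exact: N_oB (N_oB hN hN) (key g gX).
  rewrite /coset /= subr0 (_ : h = (h - I) - (0 - I)); first exact: N_oB.
  by rewrite sub0r opprK subrK.
pose g : net R n := fun e x => (u - w) e x * convolution f (rescale phi e) x.
have gX : gmul (gsub (coset (@N_S R n) u0) (coset (@N_S R n) w)) (iota_emb phi f) g.
  exists (u - w), (fun e => convolution f (rescale phi e)); split.
  - by exists u, w; split => //; exact: NS0.
  - exact: NS0.
  - exact: NS0.
exists g => //; apply: N_oB; last exact: key.
by move: hN; rewrite /coset /= subr0.
Qed.

End weak_equality.

Theorem proposition8p5 (R : realType) (n : nat)
  (phi : 'rV[R]_n -> R[i]) (phi_mollifier : mollifier phi)
  (Lambda : 'rV[R]_(n + n) -> R) (Lambda_weight : weight Lambda)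
  (rho m l : R) (rho_itv : 0 < rho <= 1) (le_lm : l <= m) (N : nat)
  (A : {fset mindex n * mindex n})
  (C : mindex n * mindex n -> set (cnet R))
  (C_Cbar : forall ab, ab \in A -> Cbar R (C ab))
  (C_hypoelliptic : exists c, representative A c C /\
     hypoelliptic Lambda m l rho N (pdo_symbol A c))
  (U V : set (net R n)) (U_G : G_tau_S R n U) (V_G : G_S_infty R n V)
  (c : mindex n * mindex n -> cnet R) (c_rep : representative A c C)
  (pdo_UV : pdo A c U = V) :
  exists2 W : set (net R n), G_S_infty R n W & weak_eq phi U W.
Proof.
have [sphi _ _] := phi_mollifier; have /andP[rho0 _] := rho_itv.
have [c0 [c0_rep c0_hypo]] := C_hypoelliptic.
have [u0 Eu0 UE] := U_G; have [v0 Ev0 VE] := V_G.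
(* The coset equation is read at the member [v0] of [V]: it provides the representative [u] of [U]
   on which all estimates are made, with [v0 - pdo_net A c u] in [N_S]. *)
have [u Uu vN] : pdo A c U v0.
  by rewrite pdo_UV VE /coset /= subrr; exact: N_S0.
have uN : N_S (u - u0) by move: Uu; rewrite UE.
have uE : u = fun e x => u0 e x + (u - u0) e x.
  by apply/funext => e; apply/funext => x; rewrite addrC subrK.
have su : smooth_net u.
  by rewrite uE => e; apply: smoothD; [have [+ _] := Eu0; exact|have [+ _] := uN; exact].
have tu : tempered u.
  rewrite uE; apply: temperedD.
  - by have [] := Eu0.
  - by have [] := uN.
  - exact: tempered_E_tau.
  - exact: tempered_N_S.
pose nu : net R n := v0 - pdo_net A c u.
have nuN : N_S nu := vN.
have snu : smooth_net nu by have [] := nuN.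
have sv : smooth_net v0 by have [] := Ev0.
pose d ab := c0 ab - c ab.
have dN ab : ab \in A -> N_o (d ab).
  move=> abA; have [d0 _ CE] := C_Cbar ab abA.
  have h0 := c0_rep ab abA; have h := c_rep ab abA.
  rewrite CE in h0 h; rewrite (_ : d ab = (c0 ab - d0) - (c ab - d0)).
    exact: N_oB.
  by rewrite opprB addrA subrK.
have [Nv vS] := E_S_infty_rate Ev0.
pose nnu : net R n := fun e x => -1 * nu e x.
have snnu : smooth_net nnu.
  by move=> e; apply: smoothM; [exact: smooth_cst|exact: snu].
(* The equation holds for the representative [c], the symbol estimates for [c0]. The three terms are
   the regular net [v0], the negligible defect of the equation, and the operator with negligible
   coefficients [d = c0 - c]; only the first costs a power of [e]. *)
have wd : wave_decay (pdo_net A c0 u) (Nv + 0 + 0).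
  have -> : pdo_net A c0 u = fun e x => (v0 e x + nnu e x) + pdo_net A d u e x.
    apply/funext => e; apply/funext => x.
    have -> : v0 e x + nnu e x = pdo_net A c u e x.
      by rewrite /nnu mulN1r /nu /= opprB addrC subrK.
    transitivity (\sum_(ab <- A)
      (c ab e * (monomial ab.1 x)%:C * Dop ab.2 (u e) x +
       d ab e * (monomial ab.1 x)%:C * Dop ab.2 (u e) x)); last exact: big_split.
    apply: eq_bigr => ab _; rewrite (_ : d ab e = c0 ab e - c ab e)//; ring.
  apply: wave_decayD.
  - by move=> e; apply: smoothD; [exact: sv|exact: snnu].
  - exact: smooth_pdo_net.
  - apply: wave_decayD => //; first exact: wave_decay_schwartz.
    by apply: wave_decay_negligible => // q; apply: schwartz_rateN => //; exact: N_S_rate.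
  - exact: wave_decay_coeff.
have [N2 ud] := wave_decay_hypoelliptic Lambda_weight rho0 c0_hypo su tu wd.
exists (coset (@N_S R n) (fun e x => u e x * theta e x)).
  by exists (fun e x => u e x * theta e x); first exact: E_S_infty_cutoff ud.
by rewrite UE; exact: cutoff_weak_eq.
Qed.
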